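(* Let $O_F^+$ be a non-Kac free orthogonal quantum group with canonical $F$-matrix. There is a constant $K\ge 1$ depending only on $F$ such that the following holds. Let $k,m\ge 1$ and suppose that $\xi_x^{(k)}=e_{s_1(x)}\otimes\cdots\otimes e_{s_k(x)}$ and $\eta_x^{(k)}=e_{t_1(x)}\otimes\cdots\otimes e_{t_k(x)}$ are in $H_k$ for all $x=1,\dots,m$. Let $$R=\max_{1\le x\le m}\ \max_{1\le i\le k}\left\{(F^*F)_{s_i(x)s_i(x)}^{1/4}\,(F^*F)_{t_i(x)t_i(x)}^{1/4}\right\}.$$ Then, for any $f\in\mathrm{span}\{(\xi_x^{(k)}\otimes1)^*u^{\otimes k}(\eta_x^{(k)}\otimes1):1\le x\le m\}$: (1) if $R>1$, then $\|f\|_{C_r(O_F^+)}\le K R^{2k}\|f\|_{L^2(O_F^+)}$; (2) if $R<1$, then $K^{-1}\|f\|_{L^2(O_F^+)}\le\|f\|_{C_r(O_F^+)}\le K\|f\|_{L^2(O_F^+)}$.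
   Context: Canonical $F$-matrix: $N\ge 2$ and $F=\sum_{i=1}^N\lambda_i e_{i,N+1-i}\in M_N(\mathbb{R})$ with all $\lambda_i\neq 0$ real, $F^2=\pm\mathrm{Id}_N$, and for some integer $0\le p\le N/2$: $0<|\lambda_1|\le\cdots\le|\lambda_p|<1<|\lambda_{N-p+1}|\le\cdots\le|\lambda_N|$ and $|\lambda_j|=1$ for $p<j\le N-p$. Here $e_{ij}$ are matrix units and $(e_j)$ is the standard basis of $\mathbb{C}^N$; $F^*F$ is diagonal. The quantum group: $C(O_F^+)$ is the universal unital $C^*$-algebra generated by $u_{ij}$ ($1\le i,j\le N$) such that $u=\sum e_{ij}\otimes u_{ij}$ is unitary and $u=(F\otimes 1)u^c(F^{-1}\otimes 1)$, $u^c=\sum e_{ij}\otimes u_{ij}^*$; the comultiplication is $\Delta(u_{ij})=\sum_k u_{ik}\otimes u_{kj}$. $\mathrm{Pol}(O_F^+)$ is the unital $*$-algebra generated by the $u_{ij}$; $h$ is the Haar state, i.e. the unique state with $(\mathrm{id}\otimes h)\Delta=h(\cdot)1=(h\otimes\mathrm{id})\Delta$, faithful on $\mathrm{Pol}(O_F^+)$. $L^2(O_F^+)$ is the completion of $\mathrm{Pol}(O_F^+)$ for $\langle f,g\rangle=h(g^*f)$, and $\|f\|_{C_r(O_F^+)}$ is the operator norm of left multiplication by $f$ on $L^2(O_F^+)$. $O_F^+$ is of Kac type if and only if $F$ is unitary, i.e. $F^*F=\mathrm{Id}_N$. $u^{\otimes k}=\sum e_{i_1j_1}\otimes\cdots\otimes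 e_{i_kj_k}\otimes u_{i_1j_1}\cdots u_{i_kj_k}$ (sum over all indices) is the $k$-fold tensor representation, so that $(\xi\otimes1)^*u^{\otimes k}(\eta\otimes1)=u_{s_1t_1}\cdots u_{s_kt_k}$ for $\xi=e_{s_1}\otimes\cdots\otimes e_{s_k}$, $\eta=e_{t_1}\otimes\cdots\otimes e_{t_k}$. With $T=\sum_{j=1}^N e_j\otimes Fe_j$, $H_k\subseteq(\mathbb{C}^N)^{\otimes k}$ is the space of $\xi$ with $(\mathrm{id}^{\otimes i}\otimes T^*\otimes\mathrm{id}^{\otimes(k-2-i)})\xi=0$ for $0\le i\le k-2$ ($H_1=\mathbb{C}^N$). *)

(* Defs.v *)
From mathcomp Require Import all_boot all_order all_algebra.
From mathcomp Require Import all_classical all_reals all_analysis.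
From mathcomp Require Import complex.

Set Implicit Arguments.
Unset Strict Implicit.
Unset Printing Implicit Defensive.
Import Order.TTheory GRing.Theory Num.Theory.
Import numFieldNormedType.Exports.
Local Open Scope classical_set_scope.
Local Open Scope ring_scope.

(* Unital C*-algebras, as an explicit record: an HB join of algType and
   completeNormedModType is rejected, for lack of a join below numDomainType. *)
Record cstarAlgType (R : realType) := CStarAlgType {
  cstar_sort :> algType R[i] ;
  star : cstar_sort -> cstar_sort ;
  cnorm : cstar_sort -> R ;
  starK : involutive star ;
  starD : {morph star : x y / x + y} ;
  starZ : forall (c : R[i]) x, star (c *: x) = c^* *: star x ;
  starM : forall x y, star (x * y) = star y * star x ;
  cnorm_eq0 : forall x, cnorm x = 0 -> x = 0 ;
  cnormD : forall x y, cnorm (x + y) <= cnorm x + cnorm y ;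
  cnormZ : forall (c : R[i]) x, cnorm (c *: x) = Normc.normc c * cnorm x ;
  cnormM : forall x y, cnorm (x * y) <= cnorm x * cnorm y ;
  cnorm_starM : forall x, cnorm (star x * x) = cnorm x ^+ 2 ;
  cnorm_complete : forall x : nat -> cstar_sort,
    (forall e : R, 0 < e -> exists n0 : nat, forall n m : nat,
       (n0 <= n)%N -> (n0 <= m)%N -> cnorm (x n - x m) < e) ->
    exists l : cstar_sort, cnorm (x n - l) @[n --> \oo] --> (0 : R)
}.

Definition is_star_morphism (R : realType) (A B : cstarAlgType R)
    (phi : {lrmorphism A -> B}) : Prop :=
  forall a : A, phi (star a) = star (phi a).

Definition is_state (R : realType) (A : cstarAlgType R)
    (h : {scalar A}) : Prop :=
  h 1 = 1 /\ forall a : A, 0 <= h (star a * a).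

(* Indices start at 0: [rev_ord i] has value N - 1 - i, and the 1-based range
   N - p + 1 .. N becomes N - p .. N - 1. *)
Definition canonical_F (R : realType) (N : nat) (F : 'M[R]_N) : Prop :=
  exists (lam : 'I_N -> R) (p : nat),
  [/\ F = \sum_(i < N) lam i *: delta_mx i (rev_ord i),
      forall i, lam i != 0,
      F *m F = 1%:M \/ F *m F = - 1%:M,
      (p.*2 <= N)%N &
      [/\ forall i : 'I_N, (i < p)%N -> `|lam i| < 1,
          forall i j : 'I_N, (i <= j < p)%N -> `|lam i| <= `|lam j|,
          forall i : 'I_N, (N - p <= i)%N -> 1 < `|lam i|,
          forall i j : 'I_N, (N - p <= i <= j)%N -> `|lam i| <= `|lam j| &
          forall i : 'I_N, (p <= i < N - p)%N -> `|lam i| = 1]].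

(* F has real entries, so that F^* is the transpose of F. *)
Definition FstarF (R : realType) (N : nat) (F : 'M[R]_N) : 'M[R]_N := F^T *m F.

Definition kac_type (R : realType) (N : nat) (F : 'M[R]_N) : Prop :=
  FstarF F = 1%:M.

Section FreeOrthogonal.
Variables (R : realType) (N : nat) (F : 'M[R]_N).
Local Notation C := R[i].

(* M (x) 1_A, for a scalar matrix M *)
Definition scal_mx (A : cstarAlgType R) (M : 'M[R]_N) : 'M[A]_N :=
  map_mx (fun x : R => (x%:C)%C%:A) M.

Definition conj_mx (A : cstarAlgType R) (u : 'M[A]_N) : 'M[A]_N :=
  map_mx (fun a : A => star a) u.

Definition OF_relations (A : cstarAlgType R) (u : 'M[A]_N) : Prop :=
  [/\ (conj_mx u)^T *m u = 1%:M,
      u *m (conj_mx u)^T = 1%:M &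
      u = scal_mx A F *m conj_mx u *m scal_mx A (invmx F)].

(* the unital *-subalgebra generated by the entries of u *)
Inductive Pol (A : cstarAlgType R) (u : 'M[A]_N) : set A :=
| Pol_gen i j : Pol u (u i j)
| Pol_one : Pol u 1
| Pol_add a b : Pol u a -> Pol u b -> Pol u (a + b)
| Pol_scale (c : C) a : Pol u a -> Pol u (c *: a)
| Pol_mul a b : Pol u a -> Pol u b -> Pol u (a * b)
| Pol_star a : Pol u a -> Pol u (star a).

(* (A, u) is C(O_F^+): the relations hold, u generates A as a C*-algebra, and
   every C*-algebra with a solution of the relations receives a *-morphism
   from A (which is then unique, by density). *)
Definition is_free_orthogonal (A : cstarAlgType R) (u : 'M[A]_N) : Prop :=
  [/\ OF_relations u,
      forall (a : A) (e : R), 0 < e ->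
        exists2 b : A, Pol u b & cnorm (a - b) < e &
      forall (B : cstarAlgType R) (v : 'M[B]_N), OF_relations v ->
        exists2 phi : {lrmorphism A -> B},
          is_star_morphism phi & forall i j, phi (u i j) = v i j].

Section Haar.
Variables (A : cstarAlgType R) (u : 'M[A]_N) (h : {scalar A}).

(* The product of the u_(s_l, t_l), starred at the positions l where b_l is
   true; these monomials span Pol. *)
Definition star_monomial (n : nat) (b : n.-tuple bool)
    (s t : n.-tuple 'I_N) : A :=
  \prod_(l < n) (if tnth b l then star (u (tnth s l) (tnth t l))
                 else u (tnth s l) (tnth t l)).

(* Since Delta is a *-morphism with Delta(u_ij) = sum_k u_ik (x) u_kj, it maps
   [star_monomial b s t] to
     sum_r (star_monomial b s r) (x) (star_monomial b r t).
   The two equations are (id (x) h) Delta = h(.) 1 = (h (x) id) Delta on the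
   monomials, hence on C(O_F^+) by linearity and continuity. *)
Definition is_haar_state : Prop :=
  is_state h /\
  forall (n : nat) (b : n.-tuple bool) (s t : n.-tuple 'I_N),
    \sum_(r : n.-tuple 'I_N) h (star_monomial b r t) *: star_monomial b s r
      = (h (star_monomial b s t))%:A /\
    \sum_(r : n.-tuple 'I_N) h (star_monomial b s r) *: star_monomial b r t
      = (h (star_monomial b s t))%:A.

Definition l2norm (f : A) : R := Num.sqrt (complex.Re (h (star f * f))).

(* A vector of L^2(O_F^+), the completion of Pol, is represented by a Cauchy
   sequence of elements of Pol. *)
Definition l2_cauchy (g : nat -> A) : Prop :=
  (forall n, Pol u (g n)) /\
  forall e : R, 0 < e -> exists n0 : nat, forall n m : nat,
    (n0 <= n)%N -> (n0 <= m)%N -> l2norm (g n - g m) < e.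

(* Operator norm of left multiplication by f on L^2(O_F^+): supremum of the
   norms of f g, for the vectors g of norm at most 1. It is taken in the
   extended reals, where it is meaningful without knowing it to be finite. *)
Definition reduced_norm (f : A) : \bar R :=
  ereal_sup [set r%:E | r in [set r : R |
    exists (g : nat -> A) (a : R),
      [/\ l2_cauchy g, l2norm (g n) @[n --> \oo] --> a, a <= 1 &
          l2norm (f * g n) @[n --> \oo] --> r]]].

End Haar.

(* The k-fold tensor power of C^N, in coordinates: the value of xi at w is the
   coefficient of xi on e_(w_1) (x) .. (x) e_(w_k). *)
Definition tensor (k : nat) := {ffun k.-tuple 'I_N -> C}.

Definition basis_tensor (k : nat) (s : k.-tuple 'I_N) : tensor k :=
  [ffun w => (w == s)%:R].

(* T = sum_j e_j (x) F e_j; the coordinate of F e_j on e_b is F b j *)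
Definition Tvec : tensor 2 :=
  [ffun w => \sum_(j < N) (tnth w ord0 == j)%:R * (F (tnth w ord_max) j)%:C%C].

(* the coordinate on p ++ q of (id^i (x) T^* (x) id^j) xi, with k = i + 2 + j *)
Definition contractT (i j k : nat) (ek : (i + (2 + j))%N = k) (xi : tensor k)
    (p : i.-tuple 'I_N) (q : j.-tuple 'I_N) : C :=
  \sum_(w : 2.-tuple 'I_N)
    (Tvec w)^* * xi (tcast ek [tuple of p ++ [tuple of w ++ q]]).

Definition in_H (k : nat) (xi : tensor k) : Prop :=
  forall (i j : nat) (ek : (i + (2 + j))%N = k)
         (p : i.-tuple 'I_N) (q : j.-tuple 'I_N), contractT ek xi p q = 0.

(* (xi (x) 1)^* u^{(x) k} (eta (x) 1) *)
Definition coefficient (A : cstarAlgType R) (u : 'M[A]_N) (k : nat)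
    (xi eta : tensor k) : A :=
  \sum_(s : k.-tuple 'I_N) \sum_(t : k.-tuple 'I_N)
    ((xi s)^* * eta t) *: \prod_(l < k) u (tnth s l) (tnth t l).

Definition in_span (A : cstarAlgType R) (m : nat) (a : 'I_m -> A) : set A :=
  [set f | exists c : 'I_m -> C, f = \sum_(x < m) c x *: a x].

(* 0 is a neutral default: the terms are nonnegative. *)
Definition max_ratio (k m : nat) (s t : 'I_m -> k.-tuple 'I_N) : R :=
  \big[Num.max/0]_(x < m) \big[Num.max/0]_(i < k)
    (FstarF F (tnth (s x) i) (tnth (s x) i) `^ (1 / 4) *
     FstarF F (tnth (t x) i) (tnth (t x) i) `^ (1 / 4)).

End FreeOrthogonal.

(* Main.v *)
(* The argument uses a concrete model of the reduced algebra. Let H_n be the space of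
   the n-fold tensors killed by all contractions with T, and let S_i, D_i be the
   compressed creation and the annihilation operators on the sum of the H_n; they
   satisfy D_i S_j = delta_ij - phi_n lam_i' lam_j' S_i' D_j' on H_n, where i' = N - 1 - i
   and phi_n = [n]_q / [n+1]_q with q + 1/q = Tr(F^*F). On the sum of the spaces
   H_n (x) H_n the operators
     v_ij = +- lam_i sqrt(phi) S_i (x) S_j  +-  lam_j' sqrt(phi) D_i' (x) D_j'
   satisfy the relations of O_F^+, so that universality represents C(O_F^+) on the
   Hilbert completion; the vacuum state is invariant because v intertwines the
   coaction on words, and hence it is the Haar state.
   Write v = v^+ + v^- for creation and annihilation. If (e, e') is a pair of letters
   of a word without cancellation, then v^-_e v^+_e' = phi^2 v^+_e v^-_e' up to the
   square roots; so v_(s,t) is a sum over p of (p creations) (k - p annihilations) with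
   scalar coefficients that are at most q^(k/2) times a Gaussian binomial in base q^2,
   hence of order q^(k/2). The p-th term of a linear combination is at most its
   Hilbert-Schmidt norm, which compares to the L^2 norm by the factor R^(2(k-p)); the
   sum over p is a geometric series whose ratio takes finitely many values. *)
Require Import Defs.
From HB Require Import structures.
From mathcomp Require Import all_boot all_order all_algebra.
From mathcomp Require Import all_classical all_reals all_analysis.
From mathcomp Require Import complex ring lra.
Set Implicit Arguments.
Unset Strict Implicit.
Unset Printing Implicit Defensive.
Import Order.TTheory GRing.Theory Num.Theory.
Import numFieldNormedType.Exports.
Local Open Scope classical_set_scope.
Local Open Scope ring_scope.

(** * Bounded operators on a Hilbert space *)

(** The algebra and its state are given only through their defining properties, so all norms are
    transported to the model. As vectors of L^2 are limits of elements of [Pol], one inequality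
    suffices: the L^2 norm of f g is at most a constant times those of f and of g, for g in [Pol];
    and the L^2 norm of such an element is the norm of its image of the vacuum. No power of q
    survives. Applied to the vacuum, a word keeps only its term with k creations, whose scalar has
    square exactly 1/[k+1]_q, at least a constant times q^k. Hence the L^2 norm of f controls the
    creation coefficients at the same order q^(k/2) that bounds all other terms from above. Turning
    the creation of a letter (i, j) into an annihilation multiplies the squared coefficient by
    lam_j'^2 / lam_i^2 = (F^*F)_ii (F^*F)_jj, the fourth power of the quantity whose maximum is R.
    The series over p therefore has ratio R^2: it is of the order of its last term if R > 1 and
    bounded if R < 1. The constants blow up near R = 1, but R is one of at most N^2 numbers, so that
    they depend only on F. *)

Record semi_inner (R : realType) (V : lmodType R[i]) (B : V -> V -> R) : Prop :=
  SemiInner {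
    formC : forall x y, B x y = B y x ;
    formDl : forall x y z, B (x + y) z = B x z + B y z ;
    formZl : forall (r : R) x y, B ((r%:C)%C *: x) y = r * B x y ;
    form_ge0 : forall x, 0 <= B x x }.

Definition fnorm (R : realType) (V : Type) (B : V -> V -> R) (x : V) : R :=
  Num.sqrt (B x x).

Section SemiInnerTheory.
Variables (R : realType) (V : lmodType R[i]) (B : V -> V -> R).
Hypothesis hB : semi_inner B.

Lemma formDr x y z : B x (y + z) = B x y + B x z.
Proof. by rewrite formC // formDl // !(formC hB x). Qed.

Lemma formZr r x y : B x ((r%:C)%C *: y) = r * B x y.
Proof. by rewrite formC // formZl // formC. Qed.

Lemma scaleN1C (x : V) : ((-1 : R)%:C)%C *: x = - x.
Proof. by rewrite rmorphN rmorph1 scaleN1r. Qed.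

Lemma formNl x y : B (- x) y = - B x y.
Proof. by rewrite -scaleN1C formZl // mulN1r. Qed.

Lemma formNr x y : B x (- y) = - B x y.
Proof. by rewrite formC // formNl formC. Qed.

Lemma form0l y : B 0 y = 0.
Proof. by have := formNl 0 y; rewrite oppr0; lra. Qed.

Lemma form0r y : B y 0 = 0.
Proof. by rewrite formC // form0l. Qed.

Lemma form_suml (I : Type) (r : seq I) (P : pred I) (f : I -> V) y :
  B (\sum_(i <- r | P i) f i) y = \sum_(i <- r | P i) B (f i) y.
Proof.
by elim/big_rec2: _ => [|i a x _ <-]; rewrite ?form0l ?formDl.
Qed.

(** The form may be degenerate. Positivity on [B v v * u - B u v * v] avoids a division; if both
    vectors are null, positivity on [x + y] and [x - y] forces [B x y = 0]. *)
Lemma form_CS2 x y : B x y ^+ 2 <= B x x * B y y.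
Proof.
have key u v : 0 < B v v -> B u v ^+ 2 <= B u u * B v v.
  move=> v0; have := form_ge0 hB ((B v v)%:C%C *: u - (B u v)%:C%C *: v).
  rewrite formDl // formDr formDr !formNl !formNr !formZl // !formZr (formC hB v u).
  set a := B u u; set b := B u v; set c := B v v => h.
  have : 0 <= c * (a * c - b ^+ 2).
    by apply: le_trans h _; rewrite le_eqVlt; apply/orP; left; apply/eqP; ring.
  by rewrite pmulr_rge0 // subr_ge0.
have := form_ge0 hB x; have := form_ge0 hB y.
rewrite [in X in X -> _]le_eqVlt => /orP[/eqP y0|y0 _]; last exact: key.
rewrite le_eqVlt => /orP[/eqP x0|x0]; last by rewrite (formC hB x) mulrC; apply: key.
have := form_ge0 hB (x + y); have := form_ge0 hB (x - y).
rewrite !formDl // !formDr !formNl !formNr (formC hB y x) -x0 -y0 => h1 h2.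
by have -> : B x y = 0 by lra.
Qed.

Lemma fnorm_ge0 x : 0 <= fnorm B x. Proof. exact: sqrtr_ge0. Qed.

Lemma fnorm_sqr x : fnorm B x ^+ 2 = B x x.
Proof. by rewrite sqr_sqrtr // form_ge0. Qed.

Lemma form_CS x y : B x y <= fnorm B x * fnorm B y.
Proof.
rewrite -sqrtrM ?form_ge0 //; apply: le_trans (ler_norm _) _.
by rewrite -sqrtr_sqr ler_sqrt ?mulr_ge0 ?form_ge0 // form_CS2.
Qed.

Lemma fnormD x y : fnorm B (x + y) <= fnorm B x + fnorm B y.
Proof.
rewrite -(@ler_pXn2r _ 2) ?nnegrE ?addr_ge0 ?fnorm_ge0 //.
rewrite sqrrD !fnorm_sqr formDl // !formDr (formC hB y x).
by have := form_CS x y; rewrite mulr2n; lra.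
Qed.

Lemma fnorm0 : fnorm B 0 = 0.
Proof. by rewrite /fnorm form0l sqrtr0. Qed.

Lemma fnormN x : fnorm B (- x) = fnorm B x.
Proof. by rewrite /fnorm formNl formNr opprK. Qed.

Lemma fnormB x y : fnorm B (x - y) = fnorm B (y - x).
Proof. by rewrite -fnormN opprB. Qed.

Lemma fnorm_sum (I : Type) (r : seq I) (P : pred I) (f : I -> V) :
  fnorm B (\sum_(i <- r | P i) f i) <= \sum_(i <- r | P i) fnorm B (f i).
Proof.
elim/big_rec2: _ => [|i a x _ h]; first by rewrite fnorm0.
by apply: le_trans (fnormD _ _) _; rewrite lerD2l.
Qed.

End SemiInnerTheory.

(** The law [hipJ] for complex scalars is what makes the real part stand for a sesquilinear form.
    The nonzero vector [hone] makes the operators a nonzero ring, and later serves as the vacuum. *)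
Record hilbert (R : realType) := Hilbert {
  hsort :> lmodType R[i] ;
  (* the real part of the inner product *)
  hip : hsort -> hsort -> R ;
  hip_semi : semi_inner hip ;
  hipJ : forall (c : R[i]) x y, hip (c *: x) y = hip x (c^* *: y) ;
  hip_eq0 : forall x, hip x x = 0 -> x = 0 ;
  hone : hsort ;
  hone_neq0 : hone <> 0 ;
  hip_complete : forall x : nat -> hsort,
    (forall e : R, 0 < e -> exists n0 : nat, forall n m : nat,
       (n0 <= n)%N -> (n0 <= m)%N -> fnorm hip (x n - x m) < e) ->
    exists l : hsort, forall e : R, 0 < e -> exists n0 : nat, forall n : nat,
       (n0 <= n)%N -> fnorm hip (x n - l) <= e }.

Section BoundedOperators.
Variables (R : realType) (E : hilbert R).
Local Notation ip := (@hip R E).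
Local Notation nrm := (fnorm ip).
Local Notation hE := (hip_semi E).

Lemma hip_ext (x y : E) : (forall z, ip x z = ip y z) -> x = y.
Proof.
move=> h; apply/eqP; rewrite -subr_eq0; apply/eqP/hip_eq0.
by rewrite formDl ?(formNl hE) ?h ?subrr //; exact: hE.
Qed.

Lemma fnorm_eq0 (x : E) : nrm x = 0 -> x = 0.
Proof. by move=> h; apply: hip_eq0; rewrite -(fnorm_sqr hE) h expr0n. Qed.

Lemma fnormZC (c : R[i]) (x : E) : nrm (c *: x) = Normc.normc c * nrm x.
Proof.
rewrite /fnorm hipJ scalerA.
have -> : c^* * c = ((Normc.normc c ^+ 2)%:C)%C.
  case: c => a b; rewrite /= sqr_sqrtr ?addr_ge0 ?sqr_ge0 //.
  by apply/eqP; rewrite eq_complex /=; apply/andP; split; apply/eqP; ring.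
rewrite (formZr hE) sqrtrM ?sqr_ge0 // sqrtr_sqr ger0_norm //.
by case: c => a b; exact: sqrtr_ge0.
Qed.

Definition adjoint_pair (f g : E -> E) := forall x y, ip (f x) y = ip x (g y).
Definition bounded_by (M : R) (f : E -> E) :=
  0 <= M /\ forall x, nrm (f x) <= M * nrm x.
(* [hip] is only a real form, for which antilinear maps also have adjoints: complex
   homogeneity has to be required separately. *)
Definition homogeneous (f : E -> E) := forall (c : R[i]) x, f (c *: x) = c *: f x.
Definition adjointable (f : E -> E) :=
  homogeneous f /\ exists g, adjoint_pair f g /\ exists M, bounded_by M f.

Lemma adjoint_sym f g : adjoint_pair f g -> adjoint_pair g f.
Proof. by move=> h x y; rewrite (formC hE) -h (formC hE). Qed.

(** Divide [|g y|^2 = ip (f (g y)) y] by [|g y|], after Cauchy-Schwarz. *)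
Lemma adjoint_bounded M f g : adjoint_pair f g -> bounded_by M f -> bounded_by M g.
Proof.
move=> h [M0 b]; split => // y; have [->|n0] := eqVneq (nrm (g y)) 0.
  by rewrite mulr_ge0 // fnorm_ge0.
have n1 : 0 < nrm (g y) by rewrite lt_neqAle eq_sym n0 fnorm_ge0.
rewrite -(ler_pM2l n1) -expr2 (fnorm_sqr hE) -h.
apply: le_trans (form_CS hE _ _) _.
apply: le_trans (ler_wpM2r (fnorm_ge0 _ _) (b _)) _.
by rewrite mulrCA mulrA.
Qed.

(** Nondegeneracy turns the existence of an adjoint into additivity; this is why [adjointable] asks
    only for homogeneity. *)
Lemma adjoint_additive f g : adjoint_pair f g -> {morph f : x y / x + y}.
Proof.
by move=> h x y; apply: hip_ext => z; rewrite h !(formDl hE) !h.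
Qed.

Lemma adjoint_homogeneous f g : adjoint_pair f g -> homogeneous f -> homogeneous g.
Proof.
move=> h hf c x; apply: hip_ext => z.
by rewrite hipJ !(adjoint_sym h) hipJ hf.
Qed.

Record bop := Bop { bfun :> E -> E ; bopP : adjointable bfun }.

HB.instance Definition _ := gen_eqMixin bop.
HB.instance Definition _ := gen_choiceMixin bop.

Lemma bop_ext (f g : bop) : (forall x, f x = g x) -> f = g.
Proof.
case: f g => [f hf] [g hg] /= /funext h.
by rewrite h in hf *; congr Bop; exact: Prop_irrelevance.
Qed.

Definition adj (f : bop) : E -> E := projT1 (cid (bopP f).2).
Lemma adjP (f : bop) : adjoint_pair f (adj f).
Proof. by rewrite /adj; case: cid => g []. Qed.
Lemma bop_bounded (f : bop) : exists M, bounded_by M f.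
Proof. by case: (bopP f) => _ [g []]. Qed.

Lemma bopZ (f : bop) c x : f (c *: x) = c *: f x.
Proof. by case: (bopP f). Qed.
Lemma bopD (f : bop) x y : f (x + y) = f x + f y.
Proof. exact: adjoint_additive (@adjP f) x y. Qed.

Lemma adjointable_adj f : adjointable (adj f).
Proof.
split; first by apply: adjoint_homogeneous (@adjP f) _; case: (bopP f).
have [M b] := bop_bounded f; exists f; split; first exact/adjoint_sym/adjP.
by exists M; apply: adjoint_bounded b; exact: adjP.
Qed.
Definition bop_star f := Bop (adjointable_adj f).

Lemma bop_starP (f : bop) x y : ip (f x) y = ip x (bop_star f y).
Proof. exact: adjP. Qed.

Lemma bop_star_eq (f g : bop) : adjoint_pair f g -> bop_star f = g.
Proof.
move=> h; apply: bop_ext => y; apply: hip_ext => z.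
by rewrite (formC hE) -bop_starP h (formC hE).
Qed.

Lemma bop_starK : involutive bop_star.
Proof. by move=> f; apply/bop_star_eq/adjoint_sym => x y; rewrite -bop_starP. Qed.

(** Sum, opposite and scalar multiple are all instances of [c f + g], so that one proof covers
    them. *)
Lemma adjointable_lin (c : R[i]) (f g : bop) : adjointable (fun x => c *: f x + g x).
Proof.
split; first by move=> d x; rewrite !bopZ scalerDr !scalerA mulrC.
exists (fun x => c^* *: bop_star f x + bop_star g x); split => [x y|].
  rewrite (formDl hE) (formDr hE) hipJ -bopZ -!bop_starP; congr (_ + _).
have [M [M0 hM]] := bop_bounded f; have [L [L0 hL]] := bop_bounded g.
have n0 : 0 <= Normc.normc c by case: c => a b; exact: sqrtr_ge0.
exists (Normc.normc c * M + L); split => [|x]; first by rewrite addr_ge0 ?mulr_ge0.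
apply: le_trans (fnormD hE _ _) _; rewrite fnormZC mulrDl lerD // -mulrA.
exact: ler_wpM2l.
Qed.

Lemma adjointable_id : adjointable id.
Proof.
split => //; exists id; split => //; exists 1.
by split => // x; rewrite mul1r.
Qed.

Lemma adjointable_comp (f g : bop) : adjointable (f \o g).
Proof.
split; first by move=> c x; rewrite /= !bopZ.
exists (bop_star g \o bop_star f); split => [x y|]; first by rewrite /= !bop_starP.
have [M [M0 hM]] := bop_bounded f; have [L [L0 hL]] := bop_bounded g.
exists (M * L); split => [|x]; first by rewrite mulr_ge0.
by apply: le_trans (hM _) _; rewrite -mulrA ler_wpM2l.
Qed.

Lemma adjointable0 : adjointable (fun=> 0).
Proof.
split; first by move=> c x; rewrite scaler0.
exists (fun=> 0); split => [x y|]; first by rewrite (form0l hE) (form0r hE).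
by exists 0; split => // x; rewrite (fnorm0 hE) mul0r.
Qed.

Definition bop0 := Bop adjointable0.
Definition bop1 := Bop adjointable_id.
Definition bop_lin c f g := Bop (adjointable_lin c f g).
Definition bop_add f g := bop_lin 1 f g.
Definition bop_opp f := bop_lin (-1) f bop0.
Definition bop_scale c f := bop_lin c f bop0.
Definition bop_mul f g := Bop (adjointable_comp f g).

Lemma bop_addA : associative bop_add.
Proof. by move=> f g k; apply: bop_ext => x; rewrite /= !scale1r addrA. Qed.
Lemma bop_addC : commutative bop_add.
Proof. by move=> f g; apply: bop_ext => x; rewrite /= !scale1r addrC. Qed.
Lemma bop_add0 : left_id bop0 bop_add.
Proof. by move=> f; apply: bop_ext => x; rewrite /= scaler0 add0r. Qed.
Lemma bop_addN : left_inverse bop0 bop_opp bop_add.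
Proof. by move=> f; apply: bop_ext => x; rewrite /= scale1r scaleN1r addr0 addNr. Qed.
HB.instance Definition _ :=
  GRing.isZmodule.Build bop bop_addA bop_addC bop_add0 bop_addN.

Lemma bop_mulA : associative bop_mul.
Proof. by move=> f g k; apply: bop_ext. Qed.
Lemma bop_mul1 : left_id bop1 bop_mul.
Proof. by move=> f; apply: bop_ext. Qed.
Lemma bop_mulr1 : right_id bop1 bop_mul.
Proof. by move=> f; apply: bop_ext. Qed.
Lemma bop_mulDl : left_distributive bop_mul +%R.
Proof. by move=> f g k; apply: bop_ext. Qed.
Lemma bop_mulDr : right_distributive bop_mul +%R.
Proof. by move=> f g k; apply: bop_ext => x; rewrite /= bopD bopZ. Qed.
Lemma bop_1neq0 : bop1 != 0 :> bop.
Proof.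
by apply/eqP => h; apply: (@hone_neq0 _ E); rewrite -[hone E]/(bop1 (hone E)) h.
Qed.
HB.instance Definition _ := GRing.Zmodule_isNzRing.Build bop
  bop_mulA bop_mul1 bop_mulr1 bop_mulDl bop_mulDr bop_1neq0.

Lemma bop_scaleA a b (f : bop) : bop_scale a (bop_scale b f) = bop_scale (a * b) f.
Proof. by apply: bop_ext => x; rewrite /= !addr0 scalerA. Qed.
Lemma bop_scale1 : left_id 1 bop_scale.
Proof. by move=> f; apply: bop_ext => x; rewrite /= addr0 scale1r. Qed.
Lemma bop_scaleDr : right_distributive bop_scale +%R.
Proof. by move=> c f g; apply: bop_ext => x; rewrite /= !addr0 !scale1r scalerDr. Qed.
Lemma bop_scaleDl f : {morph bop_scale^~ f : a b / a + b >-> a + b}.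
Proof. by move=> a b; apply: bop_ext => x; rewrite /= !addr0 !scale1r scalerDl. Qed.
HB.instance Definition _ := GRing.Zmodule_isLmodule.Build R[i] bop
  bop_scaleA bop_scale1 bop_scaleDr bop_scaleDl.

Lemma bop_scaleAl (c : R[i]) (f g : bop) : c *: (f * g) = (c *: f) * g.
Proof. by apply: bop_ext. Qed.
HB.instance Definition _ := GRing.Lmodule_isLalgebra.Build R[i] bop bop_scaleAl.

Lemma bop_scaleAr (c : R[i]) (f g : bop) : c *: (f * g) = f * (c *: g).
Proof. by apply: bop_ext => x; rewrite /= !addr0 bopZ. Qed.
HB.instance Definition _ := GRing.Lalgebra_isAlgebra.Build R[i] bop bop_scaleAr.

Lemma bopDE (f g : bop) x : (f + g) x = f x + g x.
Proof. by rewrite /= scale1r. Qed.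
Lemma bopZE (c : R[i]) (f : bop) x : (c *: f) x = c *: f x.
Proof. by rewrite /= addr0. Qed.
Lemma bopNE (f : bop) x : (- f) x = - f x.
Proof. by rewrite /= addr0 scaleN1r. Qed.
Lemma bopBE (f g : bop) x : (f - g) x = f x - g x.
Proof. by rewrite bopDE bopNE. Qed.
Lemma bop_sumE (I : Type) (r : seq I) (P : pred I) (f : I -> bop) x :
  (\sum_(i <- r | P i) f i) x = \sum_(i <- r | P i) f i x.
Proof. by elim/big_rec2: _ => // i a b _ <-; rewrite bopDE. Qed.

Definition bop_norm (f : bop) : R := inf [set M | bounded_by M f].

Lemma bop_norm_has_inf (f : bop) : has_inf [set M | bounded_by M f].
Proof.
split; first by have [M b] := bop_bounded f; exists M.
by exists 0 => M [].
Qed.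

Lemma bop_norm_le M (f : bop) : bounded_by M f -> bop_norm f <= M.
Proof. by move=> b; apply: ge_inf => //; case: (bop_norm_has_inf f). Qed.

(** The infimum is attained: every bound is at least [|f x| / |x|] for each nonzero [x], hence so is
    the infimum. *)
Lemma bop_norm_bounded (f : bop) : bounded_by (bop_norm f) f.
Proof.
split; first by apply: lb_le_inf; [case: (bop_norm_has_inf f) | move=> M []].
move=> x; have [x0|x0] := eqVneq (nrm x) 0.
  by have [M [_ /(_ x)]] := bop_bounded f; rewrite x0 !mulr0.
have x1 : 0 < nrm x by rewrite lt_neqAle eq_sym x0 fnorm_ge0.
rewrite -ler_pdivrMr //; apply: lb_le_inf; first by case: (bop_norm_has_inf f).
by move=> M [_ b]; rewrite ler_pdivrMr.
Qed.

Lemma bop_norm_ge0 f : 0 <= bop_norm f.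
Proof. by case: (bop_norm_bounded f). Qed.
Lemma bop_normP (f : bop) x : nrm (f x) <= bop_norm f * nrm x.
Proof. by case: (bop_norm_bounded f). Qed.

Lemma bop_norm_star f : bop_norm (bop_star f) <= bop_norm f.
Proof.
apply: bop_norm_le; apply: adjoint_bounded (bop_norm_bounded f).
exact: bop_starP.
Qed.

Lemma bop_starD : {morph bop_star : f g / f + g}.
Proof.
move=> f g; apply: bop_star_eq => x y.
by rewrite !bopDE (formDl hE) (formDr hE) !bop_starP.
Qed.
Lemma bop_starZ (c : R[i]) (f : bop) : bop_star (c *: f) = c^* *: bop_star f.
Proof.
by apply: bop_star_eq => x y; rewrite !bopZE hipJ bop_starP bopZ.
Qed.
Lemma bop_starN (f : bop) : bop_star (- f) = - bop_star f.
Proof. by rewrite -scaleN1r bop_starZ rmorphN rmorph1 scaleN1r. Qed.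
Lemma bop_starM (f g : bop) : bop_star (f * g) = bop_star g * bop_star f.
Proof. by apply: bop_star_eq => x y; rewrite /= !bop_starP. Qed.
Lemma bop_norm_eq0 (f : bop) : bop_norm f = 0 -> f = 0.
Proof.
move=> h; apply: bop_ext => x; apply: fnorm_eq0; apply/eqP.
by rewrite eq_le fnorm_ge0 andbT; have := bop_normP f x; rewrite h mul0r.
Qed.
Lemma bop_normD (f g : bop) : bop_norm (f + g) <= bop_norm f + bop_norm g.
Proof.
apply: bop_norm_le; split; first by rewrite addr_ge0 ?bop_norm_ge0.
move=> x; rewrite bopDE mulrDl; apply: le_trans (fnormD hE _ _) _.
by rewrite lerD ?bop_normP.
Qed.
Lemma normc_ge0 (c : R[i]) : 0 <= Normc.normc c.
Proof. by case: c => a b; exact: sqrtr_ge0. Qed.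
Lemma bop_normZ_le (c : R[i]) (f : bop) : bop_norm (c *: f) <= Normc.normc c * bop_norm f.
Proof.
apply: bop_norm_le; split; first by rewrite mulr_ge0 ?bop_norm_ge0 ?normc_ge0.
by move=> x; rewrite bopZE fnormZC -mulrA ler_wpM2l ?normc_ge0 ?bop_normP.
Qed.
Lemma bop_normZ (c : R[i]) (f : bop) : bop_norm (c *: f) = Normc.normc c * bop_norm f.
Proof.
apply/eqP; rewrite eq_le bop_normZ_le /=.
have [->|c0] := eqVneq c 0; first by rewrite Normc.normc0 mul0r bop_norm_ge0.
have n0 : 0 < Normc.normc c.
  rewrite lt_neqAle normc_ge0 andbT eq_sym; apply/eqP => h.
  by move/eqP: c0; apply; exact: Normc.eq0_normc.
have := bop_normZ_le c^-1 (c *: f).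
by rewrite scalerA mulVf // scale1r Normc.normcV mulrC ler_pdivlMr // mulrC.
Qed.
Lemma bop_normM (f g : bop) : bop_norm (f * g) <= bop_norm f * bop_norm g.
Proof.
apply: bop_norm_le; split; first by rewrite mulr_ge0 ?bop_norm_ge0.
move=> x; apply: le_trans (bop_normP f (g x)) _.
by rewrite -mulrA ler_wpM2l ?bop_norm_ge0 ?bop_normP.
Qed.
Lemma bop_norm_starM (f : bop) : bop_norm (bop_star f * f) = bop_norm f ^+ 2.
Proof.
apply/eqP; rewrite eq_le; apply/andP; split.
  by apply: le_trans (bop_normM _ _) _; rewrite expr2 ler_wpM2r ?bop_norm_ge0 ?bop_norm_star.
(* Since [|f x|^2 = ip x (f^* f x)], the square root of the norm of f^* f is a bound for [f]. *)
rewrite -[X in _ <= X]sqr_sqrtr ?bop_norm_ge0 // ler_sqr ?nnegrE ?sqrtr_ge0 ?bop_norm_ge0 //.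
apply: bop_norm_le; split; first exact: sqrtr_ge0.
move=> x; rewrite -ler_sqr ?nnegrE ?mulr_ge0 ?sqrtr_ge0 ?fnorm_ge0 //.
rewrite exprMn (sqr_sqrtr (bop_norm_ge0 _)) !(fnorm_sqr hE) bop_starP (formC hE).
apply: le_trans (form_CS hE _ _) _.
apply: le_trans (ler_wpM2r (fnorm_ge0 _ _) (bop_normP (bop_star f * f) x)) _.
by rewrite -mulrA -expr2 (fnorm_sqr hE).
Qed.

(** The adjoints of a Cauchy sequence are Cauchy too, so both sequences converge pointwise. The two
    limits are adjoint to each other, which makes the limit an element of the algebra. *)
Lemma bop_complete (f : nat -> bop) :
    (forall e : R, 0 < e -> exists n0 : nat, forall n m : nat,
       (n0 <= n)%N -> (n0 <= m)%N -> bop_norm (f n - f m) < e) ->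
    exists l : bop, bop_norm (f n - l) @[n --> \oo] --> (0 : R).
Proof.
move=> hf.
have lim (g : nat -> bop) : (forall e : R, 0 < e -> exists n0 : nat, forall n m : nat,
    (n0 <= n)%N -> (n0 <= m)%N -> bop_norm (g n - g m) < e) ->
  forall x, exists l, forall e : R, 0 < e -> exists n0 : nat, forall n : nat,
       (n0 <= n)%N -> nrm (g n x - l) <= e.
  move=> hg x; apply: hip_complete => e e0.
  have x1 : 0 < nrm x + 1 by rewrite ltr_wpDl ?fnorm_ge0.
  have [n0 h] := hg (e / (nrm x + 1)) (divr_gt0 e0 x1).
  exists n0 => n m hn hm; rewrite -bopBE.
  apply: le_lt_trans (bop_normP _ _) _.
  apply: (@le_lt_trans _ _ (bop_norm (g n - g m) * (nrm x + 1))).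
    by rewrite ler_wpM2l ?bop_norm_ge0 // lerDl.
  by rewrite -ltr_pdivlMr // h.
have hs : forall e : R, 0 < e -> exists n0 : nat, forall n m : nat,
    (n0 <= n)%N -> (n0 <= m)%N -> bop_norm (bop_star (f n) - bop_star (f m)) < e.
  move=> e e0; have [n0 h] := hf e e0; exists n0 => n m hn hm.
  apply: le_lt_trans (h n m hn hm).
  have -> : bop_star (f n) - bop_star (f m) = bop_star (f n - f m).
    by rewrite bop_starD bop_starN.
  exact: bop_norm_star.
have {hs} /choice [g hg] := lim _ hs.
have /choice [l hl] := lim f hf.
have eq0 (x : R) : (forall e : R, 0 < e -> `|x| <= e) -> x = 0.
  move=> h; apply/eqP/negPn/negP => x0.
  have := h (`|x| / 2); rewrite divr_gt0 ?normr_gt0 // => /(_ isT).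
  by rewrite ler_pdivlMr // ger_pMr ?normr_gt0 //; lra.
have tend (u : nat -> E) (a y : E) : (forall e : R, 0 < e -> exists n0 : nat,
     forall n : nat, (n0 <= n)%N -> nrm (u n - a) <= e) ->
   forall e : R, 0 < e -> exists n0 : nat, forall n : nat, (n0 <= n)%N ->
     `|ip (u n) y - ip a y| <= e.
  move=> hu e e0; have y1 : 0 < nrm y + 1 by rewrite ltr_wpDl ?fnorm_ge0.
  have [n0 h] := hu (e / (nrm y + 1)) (divr_gt0 e0 y1).
  exists n0 => n hn; have {}h := h n hn.
  have h1 : nrm (u n - a) * nrm y <= e.
    apply: (@le_trans _ _ (nrm (u n - a) * (nrm y + 1))).
      by rewrite ler_wpM2l ?fnorm_ge0 // lerDl.
    by rewrite -ler_pdivlMr.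
  rewrite ler_norml; apply/andP; split.
    have := form_CS hE (a - u n) y; rewrite (fnormB hE).
    by rewrite (formDl hE) (formNl hE) => h2; lra.
  have := form_CS hE (u n - a) y.
  by rewrite (formDl hE) (formNl hE) => h2; lra.
have lg : adjoint_pair l g.
  move=> x y; apply/eqP; rewrite -subr_eq0; apply/eqP/eq0 => e e0.
  have e2 : 0 < e / 2 by rewrite divr_gt0.
  have [n0 h0] := tend _ _ y (hl x) _ e2; have [n1 h1] := tend _ _ x (hg y) _ e2.
  have := h0 (maxn n0 n1) (leq_maxl _ _); have := h1 (maxn n0 n1) (leq_maxr _ _).
  rewrite (formC hE _ x) -bop_starP (formC hE _ x).
  rewrite !ler_norml => /andP[a b] /andP[c d]; apply/andP; split; lra.
have lh : homogeneous l.
  move=> c x; apply/eqP; rewrite -subr_eq0; apply/eqP/fnorm_eq0.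
  apply: eq0 => e e0; rewrite ger0_norm ?fnorm_ge0 //.
  have c1 : 0 < Normc.normc c + 1 by rewrite ltr_wpDl ?normc_ge0.
  have e2 : 0 < e / 2 by rewrite divr_gt0.
  have [n0 h0] := hl (c *: x) _ e2.
  have [n1 h1] := hl x _ (divr_gt0 e2 c1).
  have {}h0 := h0 (maxn n0 n1) (leq_maxl _ _).
  have {}h1 := h1 (maxn n0 n1) (leq_maxr _ _).
  set n := maxn n0 n1 in h0 h1.
  have -> : l (c *: x) - c *: l x = (l (c *: x) - f n (c *: x)) + c *: (f n x - l x).
    by rewrite bopZ scalerBr addrA subrK.
  apply: le_trans (fnormD hE _ _) _; rewrite fnormZC (fnormB hE (l _)).
  have : Normc.normc c * nrm (f n x - l x) <= e / 2.
    apply: (@le_trans _ _ ((Normc.normc c + 1) * nrm (f n x - l x))).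
      by rewrite ler_wpM2r ?fnorm_ge0 // lerDl.
    by rewrite mulrC -ler_pdivlMr.
  by move=> h2; lra.
have near_l e : 0 < e -> exists n0 : nat, forall n, (n0 <= n)%N -> forall x,
    nrm (f n x - l x) <= e * nrm x.
  (* The index at which [f m x] is close to [l x] depends on [x], but it enters only through the
     arbitrarily small [d]; the final bound is uniform in [x]. *)
  move=> e0; have [n0 h] := hf e e0; exists n0 => n hn x.
  apply/ler_addgt0Pr => d d0; have [n1 h1] := hl x d d0.
  have := h1 (maxn n0 n1) (leq_maxr _ _) => {}h1.
  have {}h := ltW (h n (maxn n0 n1) hn (leq_maxl _ _)).
  set m := maxn n0 n1 in h h1.
  have -> : f n x - l x = (f n - f m) x + (f m x - l x) by rewrite bopBE addrA subrK.
  apply: le_trans (fnormD hE _ _) _; rewrite lerD //.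
  by apply: le_trans (bop_normP _ _) _; rewrite ler_wpM2r ?fnorm_ge0.
have lb : adjointable l.
  split => //; exists g; split => //.
  have [n h] := near_l 1 ltr01; exists (1 + bop_norm (f n)).
  split => [|x]; first by rewrite addr_ge0 ?bop_norm_ge0.
  have -> : l x = (l x - f n x) + f n x by rewrite subrK.
  apply: le_trans (fnormD hE _ _) _; rewrite (fnormB hE) mulrDl lerD ?bop_normP //.
  exact: h.
exists (Bop lb); apply/cvgrPdist_le => e e0.
have [n0 h] := near_l e e0; exists n0 => // n hn /=.
rewrite sub0r normrN ger0_norm ?bop_norm_ge0 //.
apply: bop_norm_le; split; first exact: ltW.
by move=> x; rewrite bopBE; exact: h.
Qed.

Definition bop_cstar : cstarAlgType R :=
  @CStarAlgType R bop bop_star bop_norm bop_starK bop_starD bop_starZ bop_starM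
    bop_norm_eq0 bop_normD bop_normZ bop_normM bop_norm_starM bop_complete.

End BoundedOperators.

(** * Temperley-Lieb shifts on words *)

(** Tensors will be functions on words of all lengths at once; tuples only index the finite sums
    over words of one length. *)
Lemma sum_tuple0 (G : nmodType) (L : finType) (f : seq L -> G) :
  \sum_(w : 0.-tuple L) f w = f [::].
Proof.
rewrite (eq_bigr (fun=> f [::])) => [|w _]; last by rewrite (tuple0 w).
by rewrite sumr_const card_tuple expn0.
Qed.

Lemma sum_tupleS (G : nmodType) (L : finType) n (f : seq L -> G) :
  \sum_(w : n.+1.-tuple L) f w = \sum_i \sum_(w : n.-tuple L) f (i :: w).
Proof.
rewrite pair_big /= (reindex (fun p : L * n.-tuple L => [tuple of p.1 :: p.2])) //=.
exists (fun w => (thead w, [tuple of behead w])) => [[i w]|w] _ /=.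
  by congr pair; apply: val_inj.
by rewrite [RHS]tuple_eta; apply: val_inj.
Qed.

Lemma sum_tuple_cat (G : nmodType) (L : finType) n m (f : seq L -> G) :
  \sum_(w : (n + m).-tuple L) f w =
  \sum_(u : n.-tuple L) \sum_(v : m.-tuple L) f (u ++ v).
Proof.
elim: n f => [|n IH] f.
  by rewrite (sum_tuple0 (fun u => \sum_(v : m.-tuple L) f (u ++ v))).
rewrite sum_tupleS (sum_tupleS _ (fun u => \sum_(v : m.-tuple L) f (u ++ v))).
by apply: eq_bigr => i _; exact: (IH (fun w => f (i :: w))).
Qed.

Local Notation "r *r v" := ((r%:C)%C *: v) (at level 40).

Section RealScaling.
Variables (R : realType) (V : lmodType R[i]).
Implicit Types (a b : R) (v : V).
Lemma rscaleA a b v : a *r (b *r v) = (a * b) *r v.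
Proof. by rewrite scalerA rmorphM. Qed.
Lemma rscaleDl a b v : (a + b) *r v = a *r v + b *r v.
Proof. by rewrite rmorphD scalerDl. Qed.
Lemma rscaleNl a v : (- a) *r v = - (a *r v).
Proof. by rewrite rmorphN scaleNr. Qed.
Lemma rscale1 v : 1 *r v = v.
Proof. by rewrite rmorph1 scale1r. Qed.
Lemma rscale0 v : 0 *r v = 0.
Proof. by rewrite rmorph0 scale0r. Qed.
Lemma rscale_suml (I : Type) (r : seq I) (P : pred I) (f : I -> R) v :
  (\sum_(i <- r | P i) f i) *r v = \sum_(i <- r | P i) f i *r v.
Proof. by rewrite rmorph_sum scaler_suml. Qed.
End RealScaling.

(** Here F^2 = [eps] Id, and F^*F is diagonal with the entries [lam i ^+ 2] in reverse order, so
    that [lam2_sum] computes its trace. *)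
Record deformation (R : realType) (N : nat) := Deformation {
  lam : 'I_N -> R ;
  eps : R ;
  qpar : R ;
  lam_rev : forall i, lam i * lam (rev_ord i) = eps ;
  eps2 : eps ^+ 2 = 1 ;
  qpar_gt0 : 0 < qpar ;
  qpar_lt1 : qpar < 1 ;
  lam2_sum : \sum_i lam i ^+ 2 = qpar + qpar^-1 }.

Section TemperleyLieb.
Variables (R : realType) (N : nat) (d : deformation R N).
Local Notation C := R[i].
Local Notation I := 'I_N.
Local Notation bar := (@rev_ord N).
Local Notation lam := (lam d).
Local Notation q := (qpar d).

(* the ratio of consecutive quantum dimensions *)
Definition phi (n : nat) : R := q * (1 - (q ^+ 2) ^+ n) / (1 - (q ^+ 2) ^+ n.+1).

Lemma q2_gt0 : 0 < q ^+ 2.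
Proof. by rewrite exprn_gt0 // qpar_gt0. Qed.
Lemma q2_lt1 : q ^+ 2 < 1.
Proof. by rewrite exprn_ilt1 ?qpar_lt1 // ltW // qpar_gt0. Qed.
Lemma q2n_lt1 n : (q ^+ 2) ^+ n.+1 < 1.
Proof. by rewrite exprn_ilt1 ?q2_lt1 // ltW // q2_gt0. Qed.

Lemma phi0 : phi 0 = 0.
Proof. by rewrite /phi expr0 subrr mulr0 mul0r. Qed.

Lemma phi_ge0 n : 0 <= phi n.
Proof.
case: n => [|n]; first by rewrite phi0.
have h m : 0 <= 1 - (q ^+ 2) ^+ m.+1 by rewrite subr_ge0 ltW // q2n_lt1.
by rewrite /phi divr_ge0 ?mulr_ge0 ?h // ltW // qpar_gt0.
Qed.

Lemma phi_le n : phi n <= q.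
Proof.
rewrite /phi -mulrA ger_pMr ?qpar_gt0 // ler_pdivrMr ?subr_gt0 ?q2n_lt1 // mul1r.
rewrite lerD2l lerN2 (exprS (q ^+ 2)) ger_pMl; first exact: ltW q2_lt1.
exact: exprn_gt0 q2_gt0.
Qed.

(** This is [n+2] = [2] [n+1] - [n] for quantum integers, divided by [n+2]. *)
Lemma phi_rec n : phi n.+1 * (q + q^-1 - phi n) = 1.
Proof.
rewrite /phi.
have q0 : q != 0 by rewrite gt_eqF // qpar_gt0.
have h1 : 1 - (q ^+ 2) ^+ n.+1 != 0 by rewrite gt_eqF // subr_gt0 q2n_lt1.
have h2 : 1 - (q ^+ 2) ^+ n.+2 != 0 by rewrite gt_eqF // subr_gt0 q2n_lt1.
move: h1 h2; rewrite !(exprS (q ^+ 2)); set x := (q ^+ 2) ^+ n => h1 h2.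
by field; rewrite q0 h1 h2.
Qed.

Lemma lam_neq0 i : lam i != 0.
Proof.
apply/eqP => h; have := eps2 d; rewrite -(lam_rev d i) h mul0r expr0n /= => /eqP.
by rewrite eq_sym oner_eq0.
Qed.

Lemma lam_bar2 i : lam (bar i) ^+ 2 * lam i ^+ 2 = 1.
Proof. by rewrite -exprMn mulrC lam_rev eps2. Qed.

Lemma lam2_sum_bar : \sum_i lam (bar i) ^+ 2 = q + q^-1.
Proof.
rewrite -(lam2_sum d) [RHS](reindex_inj (@rev_ord_inj N)) /=.
by apply: eq_bigr.
Qed.

Section Shift.
Variable V : lmodType C.
Implicit Types (xi zeta : seq I -> V) (w : seq I).

Definition unshift (i : I) xi : seq I -> V := fun w => xi (i :: w).

(* The compression of the creation operator [e_j (x) _] to the spaces H_n,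
   through its commutation relation with [unshift] (Wenzl's recursion). *)
Fixpoint shift_at w (j : I) xi : V :=
  if w is i :: w' then
    (if i == j then xi w' else 0)
    - (phi (size w') * lam (bar i) * lam (bar j)) *r
        shift_at w' (bar i) (unshift (bar j) xi)
  else 0.
Definition shift j xi : seq I -> V := fun w => shift_at w j xi.
Arguments shift : simpl never.
Arguments unshift : simpl never.

Lemma shift_cons i j xi w :
  shift j xi (i :: w) = (if i == j then xi w else 0)
    - (phi (size w) * lam (bar i) * lam (bar j)) *r shift (bar i) (unshift (bar j) xi) w.
Proof. by []. Qed.

Lemma unshift_is_linear i : linear (unshift i).
Proof. by []. Qed.
HB.instance Definition _ i :=
  GRing.isLinear.Build C (seq I -> V) (seq I -> V) _ (unshift i) (unshift_is_linear i).

Lemma shift_is_linear j : linear (shift j).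
Proof.
move=> c xi zeta; apply/funext => w; elim: w j xi zeta => [|i w IH] j xi zeta.
  by rewrite /GRing.add /GRing.scale /= scaler0 addr0.
rewrite [RHS]/(c *: shift j xi (i :: w) + shift j zeta (i :: w)) !shift_cons.
have -> : shift (bar i) (unshift (bar j) (c *: xi + zeta)) w =
    c *: shift (bar i) (unshift (bar j) xi) w + shift (bar i) (unshift (bar j) zeta) w.
  exact: IH.
rewrite [(c *: xi + zeta) w]/(c *: xi w + zeta w).
rewrite !scalerDr !scalerN !scalerA (mulrC c).
by case: eqP => _; rewrite ?scaler0 ?add0r ?opprD //= addrACA.
Qed.
HB.instance Definition _ j :=
  GRing.isLinear.Build C (seq I -> V) (seq I -> V) _ (shift j) (shift_is_linear j).

(** The weight [lam (bar a)] is the coefficient of e_a (x) e_(bar a) in T. As [p] and [r] are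
    arbitrary words, every homogeneous component of [xi] is placed in its H_n. *)
Definition inH xi := forall p r, \sum_a lam (bar a) *r xi (p ++ [:: a, bar a & r]) = 0.

Lemma inH_unshift i xi : inH xi -> inH (unshift i xi).
Proof. by move=> h p r; exact: (h (i :: p)). Qed.

Lemma sum_fun (J : Type) (s : seq J) (P : pred J) (f : J -> seq I -> V) w :
  (\sum_(a <- s | P a) f a) w = \sum_(a <- s | P a) f a w.
Proof. by elim/big_rec2: _ => // i x y _ <-. Qed.

Lemma sum_delta (k : I) (f : I -> V) : \sum_i (if k == i then f i else 0) = f k.
Proof. by rewrite -big_mkcond (big_pred1 k) // => i; rewrite eq_sym. Qed.

(** The first summands of [shift_cons] restore [xi]; the corrections add up to a shift of the
    contraction of [xi] at its first two letters, which vanishes. The word is nonempty because every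
    shift is zero in degree 0. *)
Lemma shift_unshift_cons xi k w : inH xi ->
  \sum_i shift i (unshift i xi) (k :: w) = xi (k :: w).
Proof.
move=> h; under eq_bigr do rewrite shift_cons.
rewrite big_split /= sum_delta -[RHS]addr0; congr (_ + _).
rewrite sumrN; apply/eqP; rewrite oppr_eq0; apply/eqP.
have -> : \sum_i (phi (size w) * lam (bar k) * lam (bar i)) *r
    shift (bar k) (unshift (bar i) (unshift i xi)) w =
  (phi (size w) * lam (bar k)) *r shift (bar k)
    (\sum_i lam (bar i) *r unshift (bar i) (unshift i xi)) w.
  rewrite linear_sum sum_fun scaler_sumr; apply: eq_bigr => i _.
  by rewrite linearZ /= -rscaleA.
have -> : \sum_i lam (bar i) *r unshift (bar i) (unshift i xi) = 0.
  by apply/funext => u; rewrite sum_fun; exact: (h [::]).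
by rewrite linear0 scaler0.
Qed.

Lemma phi_shift_unshift xi w : inH xi ->
  phi (size w) *r (\sum_i shift i (unshift i xi) w) = phi (size w) *r xi w.
Proof.
case: w => [|k w] h; first by rewrite phi0 !rscale0.
by rewrite shift_unshift_cons.
Qed.

(** This is where the values of [phi] matter: contracting the first two letters leaves the factor
    [1 - phi n.+1 * (q + q^-1 - phi n)], zero by [phi_rec]. A contraction further right leaves the
    first letter alone and is treated by induction on [p]. *)
Lemma inH_shift j xi : inH xi -> inH (shift j xi).
Proof.
move=> h p r; elim: p j xi h => [|k p IH] j xi h.
  rewrite /= ; set eta := unshift (bar j) xi.
  have hh : inH eta by exact: inH_unshift.
  under eq_bigr => a _.
    rewrite !shift_cons eqxx rev_ordK scalerBr [unshift _ _ _]/(eta r) -/eta.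
    rewrite [size (_ :: _)]/= rscaleA.
    over.
  rewrite sumrB.
  have -> : \sum_a lam (bar a) *r (if a == j then xi (bar a :: r) else 0) =
     lam (bar j) *r eta r.
    rewrite (bigD1 j) //= eqxx big1 ?addr0 // => a /negPf ->; exact: scaler0.
  have -> : \sum_a (lam (bar a) * (phi (size r).+1 * lam (bar a) * lam (bar j))) *r
      (eta r - (phi (size r) * lam a * lam a) *r shift a (unshift a eta) r) =
     (phi (size r).+1 * lam (bar j) * (q + q^-1)) *r eta r
     - (phi (size r).+1 * lam (bar j)) *r
         (phi (size r) *r (\sum_a shift a (unshift a eta) r)).
    rewrite -lam2_sum_bar mulr_sumr rscale_suml !scaler_sumr -sumrB.
    apply: eq_bigr => a _; rewrite scalerBr !rscaleA.
    congr (_ *r _ - _ *r _); first by ring.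
    by have := lam_bar2 a => h2; rewrite -[RHS]mul1r -h2; ring.
  rewrite phi_shift_unshift // rscaleA -!scalerBl -!rmorphB.
  have -> : lam (bar j) - (phi (size r).+1 * lam (bar j) * (q + q^-1) -
     phi (size r).+1 * lam (bar j) * phi (size r)) =
     lam (bar j) * (1 - phi (size r).+1 * (q + q^-1 - phi (size r))) by ring.
  by rewrite phi_rec subrr mulr0 rscale0.
under eq_bigr => a _.
  rewrite cat_cons shift_cons size_cat /= scalerBr.
  over.
rewrite sumrB [X in _ - X](_ : _ = 0).
  rewrite subr0; case: eqP => _; first exact: h.
  by rewrite big1 // => a _; rewrite scaler0.
under eq_bigr => a _ do rewrite rscaleA mulrC -rscaleA.
by rewrite -scaler_sumr (IH (bar k) (unshift (bar j) xi) (inH_unshift _ h)) scaler0.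
Qed.

Lemma shift_local0 n j xi : (forall w, size w = n -> xi w = 0) ->
  forall w, size w = n.+1 -> shift j xi w = 0.
Proof.
elim: n j xi => [|n IH] j xi h [|i w] //= [] sw; rewrite shift_cons.
  by rewrite h // sw phi0 !mul0r rscale0 if_same subr0.
rewrite h // if_same IH ?scaler0 ?subr0 // => u su.
by apply: h; rewrite /= su.
Qed.

(** The correction in [shift] ends up paired with contractions of [zeta], which vanish. The values
    lie in an arbitrary space with a form, so that the lemma serves each leg of a two-legged
    vector. *)
Lemma shift_adjoint (B : V -> V -> R) (hB : semi_inner B) n j xi zeta : inH zeta ->
  \sum_(w : n.+1.-tuple I) B (shift j xi w) (zeta w) =
  \sum_(w : n.-tuple I) B (xi w) (zeta (j :: w)).
Proof.
elim: n j xi zeta => [|n IH] j xi zeta h.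
  rewrite (sum_tupleS _ (fun w => B (shift j xi w) (zeta w))).
  rewrite (bigD1 j) //= [X in _ + X]big1 ?addr0 => [|i /negPf ij].
    apply: eq_bigr => w _; rewrite (tuple0 w) shift_cons eqxx /=.
    by rewrite phi0 !mul0r rscale0 subr0.
  rewrite big1 // => w _; rewrite (tuple0 w) shift_cons ij phi0 !mul0r rscale0 subr0.
  by rewrite (form0l hB).
rewrite (sum_tupleS _ (fun w => B (shift j xi w) (zeta w))).
under eq_bigr => i _.
  under eq_bigr => w _ do rewrite shift_cons (formDl hB) (formNl hB) (formZl hB) size_tuple.
  rewrite sumrB -mulr_sumr.
  rewrite (IH (bar i) (unshift (bar j) xi) (unshift i zeta) (inH_unshift i h)).
  over.
rewrite sumrB [X in _ - X](_ : _ = 0) ?subr0.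
  rewrite (bigD1 j) //= [X in _ + X]big1 ?addr0 => [|i /negPf ij].
    by apply: eq_bigr => w _; rewrite eqxx.
  by rewrite big1 // => w _; rewrite ij (form0l hB).
have -> : \sum_i phi n.+1 * lam (bar i) * lam (bar j) *
    (\sum_(w : n.-tuple I) B (unshift (bar j) xi w) (unshift i zeta (bar i :: w))) =
  \sum_(w : n.-tuple I) (phi n.+1 * lam (bar j)) * B (unshift (bar j) xi w)
      (\sum_i lam (bar i) *r zeta [:: i, bar i & w]).
  under eq_bigr do rewrite mulr_sumr.
  rewrite exchange_big /=; apply: eq_bigr => w _.
  rewrite (formC hB) (form_suml hB) mulr_sumr; apply: eq_bigr => i _.
  by rewrite (formZl hB) (formC hB) !mulrA; congr (_ * _); ring.
by rewrite big1 // => w _; rewrite (h [::]) (form0r hB) mulr0.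
Qed.

End Shift.

(** A function of two words is a function of the first one with values in the functions of the
    second. Naturality in the space of values thus makes operators on different legs commute, and
    later carries scalar tensors to [A]-valued ones. *)
Lemma shift_natural (V W : lmodType C) (psi : {linear V -> W}) j (xi : seq I -> V) w :
  psi (shift j xi w) = shift j (fun u => psi (xi u)) w.
Proof.
elim: w j xi => [|i w IH] j xi; first by rewrite /= linear0.
rewrite !shift_cons linearB linearZ IH.
by case: eqP; rewrite ?linear0.
Qed.

End TemperleyLieb.
Arguments shift {R N} d {V} j xi w : simpl never.
Arguments unshift {R N V} i xi w : simpl never.

Section ShiftIdentities.
Variables (R : realType) (N : nat) (d : deformation R N) (V : lmodType R[i]).
Local Notation C := R[i].
Local Notation I := 'I_N.
Local Notation bar := (@rev_ord N).
Local Notation lam := (lam d).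
Local Notation q := (qpar d).
Local Notation phi := (phi d).
Local Notation shift := (shift d).
Local Notation inH := (inH d).
Implicit Types (xi : seq I -> V) (w : seq I).

Definition fun_at w xi : V := xi w.
Lemma fun_at_is_linear w : linear (fun_at w). Proof. by []. Qed.
HB.instance Definition _ w :=
  GRing.isLinear.Build C (seq I -> V) V _ (fun_at w) (fun_at_is_linear w).

Lemma fun_scale (c : C) xi w : (c *: xi) w = c *: xi w.
Proof. by []. Qed.

Lemma shiftZ j (c : C) xi w : shift j (c *: xi) w = c *: shift j xi w.
Proof. by rewrite linearZ. Qed.

Lemma shift_sum (J : Type) (s : seq J) (P : pred J) (f : J -> seq I -> V) j w :
  shift j (\sum_(a <- s | P a) f a) w = \sum_(a <- s | P a) shift j (f a) w.
Proof. by rewrite linear_sum sum_fun. Qed.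

(** The commutation relation turns the sum into q + 1/q minus phi_n times the sum of the S_k D_k,
    which acts as the identity; the inverse of q + 1/q - phi_n is phi_(n+1). *)
Lemma phi_unshift_shift xi w : inH xi ->
  phi (size w).+1 *r (\sum_k lam k ^+ 2 *r shift k xi (k :: w)) = xi w.
Proof.
move=> h.
have -> : \sum_k lam k ^+ 2 *r shift k xi (k :: w) =
    (q + q^-1) *r xi w - phi (size w) *r (\sum_k shift k (unshift k xi) w).
  rewrite -(lam2_sum d) rscale_suml scaler_sumr.
  rewrite [X in _ - X](reindex_inj (@rev_ord_inj N)) /= -sumrB.
  apply: eq_bigr => k _; rewrite shift_cons eqxx scalerBr rscaleA; congr (_ - _ *r _).
  by have := lam_bar2 d k => h2; rewrite -[RHS]mul1r -h2; ring.
rewrite phi_shift_unshift // -scalerBl -rmorphB rscaleA.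
by rewrite phi_rec rscale1.
Qed.

Lemma shift_local n j xi zeta : (forall w, size w = n -> xi w = zeta w) ->
  forall w, size w = n.+1 -> shift j xi w = shift j zeta w.
Proof.
move=> h w sw; apply/eqP; rewrite -subr_eq0; apply/eqP.
have -> : shift j xi w - shift j zeta w = shift j (xi - zeta) w by rewrite linearB.
apply: (@shift_local0 _ _ _ _ n) => // u su.
rewrite [LHS]/(xi u - zeta u) (h u su). exact: subrr.
Qed.

(** Creating the two letters of T is compressed to zero. In coordinates, the first letter leaves a
    shift of [xi] minus the same shift of the left side of [phi_unshift_shift], and these agree one
    degree below. *)
Lemma sum_shift_shift xi w : inH xi ->
  \sum_k lam k *r shift (bar k) (shift k xi) w = 0.
Proof.
case: w => [|i w] h; first by rewrite big1 // => k _; rewrite scaler0.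
under eq_bigr => k _ do rewrite shift_cons rev_ordK scalerBr rscaleA.
rewrite sumrB.
have -> : \sum_k lam k *r (if i == bar k then shift k xi w else 0) =
    lam (bar i) *r shift (bar i) xi w.
  rewrite (bigD1 (bar i)) //= rev_ordK eqxx big1 ?addr0 // => k kn.
  by case: eqP => [ik|_]; [rewrite ik rev_ordK eqxx in kn | exact: scaler0].
have -> : \sum_k (lam k * (phi (size w) * lam (bar i) * lam k)) *r
     shift (bar i) (unshift k (shift k xi)) w =
  lam (bar i) *r shift (bar i) (phi (size w) *r
       \sum_k lam k ^+ 2 *r unshift k (shift k xi)) w.
  rewrite shiftZ shift_sum !scaler_sumr; apply: eq_bigr => k _.
  rewrite shiftZ !rscaleA.
  by congr (_ *r _); ring.
case: w => [|l w]; first by rewrite !scaler0 subrr.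
rewrite -scalerBr; apply/eqP; rewrite scaler_eq0; apply/orP; right.
rewrite subr_eq0; apply/eqP/(@shift_local (size w)) => // u su.
rewrite [RHS]/(_ *: (\sum_k lam k ^+ 2 *r unshift k (shift k xi)) u) sum_fun /=.
by rewrite -su -[LHS]phi_unshift_shift.
Qed.

(** A shift of the first leg only forms linear combinations of values, so it preserves conditions on
    the second leg. *)
Lemma shift_closed (P : V -> Prop) : P 0 ->
  (forall (c : C) x y, P x -> P y -> P (c *: x + y)) ->
  forall j xi, (forall w, P (xi w)) -> forall w, P (shift j xi w).
Proof.
move=> P0 Plin j xi h w; elim: w j xi h => [|i w IH] j xi h //.
rewrite shift_cons addrC -scaleNr; apply: Plin; last by case: eqP.
by apply: IH => u; exact: h.
Qed.

End ShiftIdentities.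

(** * Creation and annihilation on two legs, and the unitarity relations *)

Section TwoLegs.
Variables (R : realType) (N : nat) (d : deformation R N).
Local Notation C := R[i].
Local Notation I := 'I_N.
Local Notation bar := (@rev_ord N).
Local Notation lam := (lam d).
Local Notation eps := (eps d).
Local Notation phi := (phi d).
Local Notation shift := (shift d).
Local Notation inH := (inH d).
Local Notation sg i := (Num.sg (lam i)).

Lemma sg_lam2 i : sg i * sg i = 1.
Proof. by rewrite -expr2 sqr_sg lam_neq0. Qed.

Lemma sg_eps : Num.sg eps = eps.
Proof.
have /eqP := eps2 d; rewrite sqrf_eq1 => /orP[] /eqP ->; first by rewrite sgr1.
by rewrite sgrN1.
Qed.

Lemma sg_bar i : sg (bar i) = eps * sg i.
Proof.
rewrite -[LHS]mul1r -(sg_lam2 i) mulrAC -[sg i * sg (bar i)]sgrM.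
by rewrite lam_rev sg_eps.
Qed.

Section Operators.
Variable V : lmodType C.
Local Notation X := (seq I -> seq I -> V).
Implicit Types (x y : X) (w : seq I).

Definition create (i j : I) x : X := shift i (fun u => shift j (x u)).
Definition annihilate (i j : I) x : X := fun w w' => x (i :: w) (j :: w').
Definition degree_scale (c : nat -> R) x : X := fun w w' => c (size w) *r x w w'.

Lemma createE i j x : create i j x = fun w => shift j (shift i x w).
Proof.
apply/funext => w; apply/esym.
exact: (@shift_natural _ _ d _ _ (shift j : {linear (seq I -> V) -> (seq I -> V)})).
Qed.

Lemma create_is_linear i j : linear (create i j).
Proof.
move=> c x y.
transitivity (shift i (c *: (fun u => shift j (x u)) + (fun u => shift j (y u)))).
  by congr (shift i _); apply/funext => u; exact: linearP.
exact: linearP.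
Qed.
HB.instance Definition _ i j :=
  GRing.isLinear.Build C X X _ (create i j) (create_is_linear i j).

Lemma annihilate_is_linear i j : linear (annihilate i j).
Proof. by []. Qed.
HB.instance Definition _ i j :=
  GRing.isLinear.Build C X X _ (annihilate i j) (annihilate_is_linear i j).

Lemma degree_scale_is_linear c : linear (degree_scale c).
Proof.
move=> a x y; apply/funext => w; apply/funext => w'.
rewrite [RHS]/(a *: (c (size w) *r x w w') + c (size w) *r y w w').
by rewrite /degree_scale [(a *: x + y) w w']/(a *: x w w' + y w w') scalerDr !scalerA mulrC.
Qed.
HB.instance Definition _ c :=
  GRing.isLinear.Build C X X _ (degree_scale c) (degree_scale_is_linear c).

Lemma degree_scaleM b c x :
  degree_scale b (degree_scale c x) = degree_scale (fun n => b n * c n) x.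
Proof. by apply/funext => w; apply/funext => w'; rewrite /degree_scale rscaleA. Qed.

Lemma annihilate_scale c i j x :
  annihilate i j (degree_scale c x) = degree_scale (c \o succn) (annihilate i j x).
Proof. by []. Qed.

Lemma create_scale c i j x :
  create i j (degree_scale c x) = degree_scale (c \o predn) (create i j x).
Proof.
apply/funext => -[|k w]; first by apply/funext => w'; rewrite /degree_scale scaler0.
transitivity (shift i ((c (size w))%:C%C *: (fun u => shift j (x u))) (k :: w)).
  apply: (@shift_local _ _ _ _ (size w)) => // u su.
  transitivity (shift j ((c (size w))%:C%C *: x u)); last exact: linearZ.
  by congr (shift j _); apply/funext => w'; rewrite /degree_scale su.
exact: shiftZ.
Qed.

(* The vectors of the sum of the H_n (x) H_n, with no summability condition. *)
Definition fock x :=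
  [/\ forall w w', size w <> size w' -> x w w' = 0, inH x & forall w, inH (x w)].

Lemma inH0 (W : lmodType C) : inH (0 : seq I -> W).
Proof. by move=> p r; rewrite big1 // => a _; rewrite scaler0. Qed.

Lemma inH_lin (W : lmodType C) (c : C) (xi zeta : seq I -> W) :
  inH xi -> inH zeta -> inH (c *: xi + zeta).
Proof.
move=> hx hz p r.
transitivity (c *: (\sum_a lam (bar a) *r xi (p ++ [:: a, bar a & r]))
  + \sum_a lam (bar a) *r zeta (p ++ [:: a, bar a & r])).
  rewrite scaler_sumr -big_split; apply: eq_bigr => a _ /=.
  rewrite [(c *: xi + zeta) _]/(c *: xi _ + zeta _) scalerDr !scalerA.
  by rewrite (mulrC c).
by rewrite hx hz scaler0 addr0.
Qed.

Lemma inH_comp (W W' : lmodType C) (psi : {linear W -> W'}) (xi : seq I -> W) :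
  inH xi -> inH (fun w => psi (xi w)).
Proof.
move=> h p r; transitivity (psi (\sum_a lam (bar a) *r xi (p ++ [:: a, bar a & r]))).
  by rewrite linear_sum; apply: eq_bigr => a _; rewrite linearZ.
by rewrite h linear0.
Qed.

Lemma fock0 : fock 0.
Proof. by split => //; [exact: inH0 | move=> w; exact: inH0]. Qed.

Lemma fock_lin (c : C) x y : fock x -> fock y -> fock (c *: x + y).
Proof.
move=> [x1 x2 x3] [y1 y2 y3]; split.
- move=> w w' h; rewrite [LHS]/(c *: x w w' + y w w') x1 // y1 // scaler0.
  exact: addr0.
- exact: inH_lin.
- by move=> w; apply: inH_lin.
Qed.

Lemma fock_scale c x : fock x -> fock (degree_scale c x).
Proof.
move=> [x1 x2 x3]; split.
- by move=> w w' h; rewrite /degree_scale x1 // scaler0.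
- move=> p r.
  transitivity ((c (size p + size r).+2)%:C%C *:
     \sum_a lam (bar a) *r x (p ++ [:: a, bar a & r])); last by rewrite x2 scaler0.
  rewrite scaler_sumr; apply: eq_bigr => a _; apply/funext => w'.
  rewrite [LHS]/(_ *: (_ *: _)) /degree_scale size_cat /= !addnS scalerA mulrC.
  by rewrite -scalerA.
- move=> w; have -> : degree_scale c x w = (c (size w))%:C%C *: x w + 0.
    by rewrite addr0.
  by apply: inH_lin => //; exact: inH0.
Qed.

Lemma fock_create i j x : fock x -> fock (create i j x).
Proof.
move=> [x1 x2 x3]; split.
- move=> [|k w] w' h //.
  transitivity (shift i (fun u => shift j (x u) w') (k :: w)).
    exact: (@shift_natural _ _ d _ _ (fun_at w') i (fun u => shift j (x u)) (k :: w)).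
  apply: (@shift_local0 _ _ _ _ (size w)) => // u su.
  case: w' h => [|l w'] h //.
  apply: (@shift_local0 _ _ _ _ (size w')) => // v sv.
  by apply: x1 => e; apply: h; rewrite /= -su -sv e.
- by apply: inH_shift; exact: (@inH_comp _ _ (shift j)).
- move=> w; apply: (@shift_closed _ _ d _ (fun f : seq I -> V => inH f)).
  + exact: inH0.
  + by move=> c f g; exact: inH_lin.
  + by move=> u; exact: inH_shift.
Qed.

Lemma fock_annihilate i j x : fock x -> fock (annihilate i j x).
Proof.
move=> [x1 x2 x3]; split.
- by move=> w w' h; apply: x1 => /= -[].
- move=> p r; apply/funext => w'.
  have := congr1 (fun f => f (j :: w')) (x2 (i :: p) r).
  by rewrite /= !sum_fun.
- by move=> w; apply: inH_unshift; exact: x3.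
Qed.

End Operators.
Section Unitarity.
Variable V : lmodType C.
Local Notation X := (seq I -> seq I -> V).
Implicit Types (x y : X) (w : seq I).

(** Both [up] and [down] carry the square root of [phi] at the larger of the two degrees involved,
    which makes them adjoint. As [degree_scale] reads the degree of the result, the index is raised
    by one in [down]. *)
Definition up (i j : I) x : X := degree_scale (fun n => Num.sqrt (phi n)) (create i j x).
Definition down (i j : I) x : X :=
  degree_scale (fun n => Num.sqrt (phi n.+1)) (annihilate i j x).
Arguments up : simpl never.
Arguments down : simpl never.

Lemma up_is_linear i j : linear (up i j).
Proof.
move=> c x y; transitivity (degree_scale (fun n => Num.sqrt (phi n))
  (c *: create i j x + create i j y)); last exact: degree_scale_is_linear.
by congr degree_scale; exact: create_is_linear.
Qed.
HB.instance Definition _ i j :=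
  GRing.isLinear.Build C X X _ (up i j) (up_is_linear i j).
Lemma down_is_linear i j : linear (down i j).
Proof.
move=> c x y; transitivity (degree_scale (fun n => Num.sqrt (phi n.+1))
  (c *: annihilate i j x + annihilate i j y)); last exact: degree_scale_is_linear.
by congr degree_scale; exact: annihilate_is_linear.
Qed.
HB.instance Definition _ i j :=
  GRing.isLinear.Build C X X _ (down i j) (down_is_linear i j).

Lemma fock_up i j x : fock x -> fock (up i j x).
Proof. by move=> h; exact/fock_scale/fock_create. Qed.
Lemma fock_down i j x : fock x -> fock (down i j x).
Proof. by move=> h; exact/fock_scale/fock_annihilate. Qed.

Lemma sqrt_phi2 n : Num.sqrt (phi n) * Num.sqrt (phi n) = phi n.
Proof. by rewrite -expr2 sqr_sqrtr // phi_ge0. Qed.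

Lemma sum_fun2 (J : Type) (s : seq J) (P : pred J) (f : J -> X) w w' :
  (\sum_(a <- s | P a) f a) w w' = \sum_(a <- s | P a) f a w w'.
Proof. by elim/big_rec2: _ => // i x y _ <-. Qed.

Lemma up_upE a b i j x w w' :
  up a b (up i j x) w w' = (Num.sqrt (phi (size w)) * Num.sqrt (phi (size w).-1)) *r
    create a b (create i j x) w w'.
Proof. by rewrite /up create_scale degree_scaleM. Qed.

Lemma up_downE a b i j x w w' :
  up a b (down i j x) w w' = phi (size w) *r create a b (annihilate i j x) w w'.
Proof.
rewrite /up /down create_scale degree_scaleM /degree_scale /=.
by case: w => [|k w]; [rewrite !scaler0 | rewrite sqrt_phi2].
Qed.

Lemma down_upE a b i j x w w' :
  down a b (up i j x) w w' = phi (size w).+1 *r annihilate a b (create i j x) w w'.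
Proof.
by rewrite /up /down annihilate_scale degree_scaleM /degree_scale /= sqrt_phi2.
Qed.

Lemma down_downE a b i j x w w' :
  down a b (down i j x) w w' =
  (Num.sqrt (phi (size w).+1) * Num.sqrt (phi (size w).+2)) *r
    annihilate a b (annihilate i j x) w w'.
Proof. by rewrite /down annihilate_scale degree_scaleM. Qed.

Lemma upE i j x w w' :
  up i j x w w' = Num.sqrt (phi (size w)) *r create i j x w w'.
Proof. by []. Qed.
Lemma downE i j x w w' :
  down i j x w w' = Num.sqrt (phi (size w).+1) *r x (i :: w) (j :: w').
Proof. by []. Qed.

(** Unitarity requires sums of products of two generators over an index of one leg. Two creations,
    or two annihilations, give a contraction with T and vanish; the mixed products collapse on the
    summed leg and leave an operator on the other one. *)
Lemma sum_up_up b j x w w' : fock x ->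
  \sum_k lam k *r up (bar k) b (up k j x) w w' = 0.
Proof.
move=> [_ x2 _]; under eq_bigr => k _ do rewrite up_upE rscaleA mulrC -rscaleA.
rewrite -scaler_sumr.
have -> : \sum_k lam k *r create (bar k) b (create k j x) w w' =
   shift b (\sum_k lam k *r shift (bar k) (shift k (fun u => shift j (x u))) w) w'.
  rewrite shift_sum; apply: eq_bigr => k _; rewrite shiftZ.
  by rewrite [create (bar k) b _]createE.
rewrite sum_shift_shift; last exact: (@inH_comp _ _ (shift j)).
by rewrite linear0 scaler0.
Qed.

Lemma sum_down_down a b x w w' : fock x ->
  \sum_k lam k *r down k a (down (bar k) b x) w w' = 0.
Proof.
move=> [_ x2 _]; under eq_bigr => k _ do rewrite down_downE rscaleA mulrC -rscaleA.
rewrite -scaler_sumr (reindex_inj (@rev_ord_inj N)) /=.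
have := congr1 (fun f => f [:: b, a & w']) (x2 [::] w); rewrite sum_fun /= => h.
under eq_bigr => k _ do rewrite rev_ordK.
by rewrite [X in _ *: X]h scaler0.
Qed.

Lemma sum_up_down a b x w w' : fock x ->
  \sum_k up k a (down k b x) w w' = phi (size w) *r shift a (unshift b (x w)) w'.
Proof.
move=> [_ x2 _]; under eq_bigr do rewrite up_downE.
rewrite -scaler_sumr -!shiftZ.
transitivity (shift a (phi (size w) *r
    \sum_k shift k (unshift k (fun u => unshift b (x u))) w) w').
  rewrite shiftZ shift_sum; congr (_ *: _); apply: eq_bigr => k _.
  by rewrite createE.
by rewrite phi_shift_unshift //; exact: (@inH_comp _ _ (@unshift R N V b)).
Qed.

Lemma sum_down_up a j x w w' : fock x ->
  \sum_k lam k ^+ 2 *r down k a (up k j x) w w' = unshift a (shift j (x w)) w'.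
Proof.
move=> [_ x2 _]; under eq_bigr => k _ do rewrite down_upE rscaleA mulrC -rscaleA.
rewrite -scaler_sumr.
have h : inH (fun u => shift j (x u)) by exact: (@inH_comp _ _ (shift j)).
have := congr1 (fun f => f (a :: w')) (phi_unshift_shift w h).
by rewrite fun_scale sum_fun.
Qed.

(** The sums over the second leg follow in the same way, once naturality has exchanged the legs. *)
Lemma sum_up_up2 a i x w w' : fock x ->
  \sum_k lam (bar k) *r up a k (up i (bar k) x) w w' = 0.
Proof.
move=> [_ _ x3]; under eq_bigr => k _ do rewrite up_upE rscaleA mulrC -rscaleA.
rewrite -scaler_sumr (reindex_inj (@rev_ord_inj N)) /=.
under eq_bigr => k _ do rewrite rev_ordK.
have h : inH (shift a (shift i x) w).
  by apply: (@shift_closed _ _ d _ (fun f : seq I -> V => inH f));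
    [exact: inH0 | move=> c f g; exact: inH_lin | move=> u;
     apply: (@shift_closed _ _ d _ (fun f : seq I -> V => inH f));
     [exact: inH0 | move=> c f g; exact: inH_lin |]].
rewrite -[RHS](scaler0 _ (Num.sqrt (phi (size w)) * Num.sqrt (phi (size w).-1))%:C%C).
congr (_ *: _); rewrite -[RHS](sum_shift_shift w' h); apply: eq_bigr => k _.
congr (_ *: _); rewrite createE; congr (shift (bar k) _ w').
rewrite createE.
by rewrite -(@shift_natural _ _ d _ _ (shift k) a (shift i x) w).
Qed.

Lemma sum_down_down2 a b x w w' : fock x ->
  \sum_k lam (bar k) *r down a (bar k) (down b k x) w w' = 0.
Proof.
move=> [_ _ x3]; under eq_bigr => k _ do rewrite down_downE rscaleA mulrC -rscaleA.
by rewrite -scaler_sumr [X in _ *: X](x3 [:: b, a & w] [::] w') scaler0.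
Qed.

Lemma inH_shift2 a x w : (forall u, inH (x u)) -> inH (shift a x w).
Proof.
move=> h; apply: (@shift_closed _ _ d _ (fun f : seq I -> V => inH f)) => //.
  exact: inH0.
by move=> c f g; exact: inH_lin.
Qed.

(** The scaling reads the length of the first word whereas the sum collapses on the second one,
    hence the condition on the lengths. *)
Lemma sum_up_down2 a b x w w' : fock x -> size w = size w' ->
  \sum_k up a k (down b k x) w w' = phi (size w) *r shift a (unshift b x) w w'.
Proof.
move=> [_ _ x3] sw; under eq_bigr do rewrite up_downE.
rewrite -scaler_sumr sw -phi_shift_unshift; last first.
  by apply: inH_shift2 => u; exact: x3.
congr (_ *: _); apply: eq_bigr => k _; rewrite createE; congr (shift k _ w').
by rewrite -(@shift_natural _ _ d _ _ (@unshift R N V k) a (unshift b x) w).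
Qed.

Lemma sum_down_up2 a b x w w' : fock x -> size w = size w' ->
  \sum_k lam k ^+ 2 *r down a k (up b k x) w w' = unshift a (shift b x) w w'.
Proof.
move=> [_ _ x3] sw; under eq_bigr => k _ do rewrite down_upE rscaleA mulrC -rscaleA.
rewrite -scaler_sumr sw -[RHS](@phi_unshift_shift _ _ d); last exact: inH_shift2.
congr (_ *: _); apply: eq_bigr => k _; congr (_ *: _).
by rewrite /annihilate createE.
Qed.

(* Left multiplication by u_ij on L^2(O_F^+), in the coordinates that make the inner
   product standard: the first leg of H_n (x) H_n is rescaled by the square root of the
   modular matrix and degree n by that of the quantum dimension. *)
Definition vop (i j : I) x : X :=
  (sg i * lam i) *r up i j x + (sg i * eps * lam (bar j)) *r down (bar i) (bar j) x.

Lemma vop_is_linear i j : linear (vop i j).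
Proof.
move=> c x y; rewrite /vop up_is_linear down_is_linear !scalerDr addrACA !scalerA.
by rewrite !(mulrC c).
Qed.
HB.instance Definition _ i j :=
  GRing.isLinear.Build C X X _ (vop i j) (vop_is_linear i j).

Lemma vopE i j x w w' : vop i j x w w' = (sg i * lam i) *r up i j x w w'
  + (sg i * eps * lam (bar j)) *r down (bar i) (bar j) x w w'.
Proof. by []. Qed.

Lemma fock_vop i j x : fock x -> fock (vop i j x).
Proof.
move=> h; apply: fock_lin; first exact: fock_up.
by rewrite -[_ *: _]addr0; apply: fock_lin; [exact: fock_down | exact: fock0].
Qed.

Lemma linear2 (f : {linear X -> X}) (a b : C) x y w w' :
  f (a *: x + b *: y) w w' = a *: f x w w' + b *: f y w w'.
Proof. by rewrite linearD !linearZ_LR. Qed.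

Lemma vop_vopE a b i j x w w' : vop a b (vop i j x) w w' =
  (sg a * sg i * lam a * lam i) *r up a b (up i j x) w w'
  + (sg a * sg i * lam a * eps * lam (bar j)) *r
       up a b (down (bar i) (bar j) x) w w'
  + ((sg a * sg i * eps * lam (bar b) * lam i) *r
       down (bar a) (bar b) (up i j x) w w'
  + (sg a * sg i * lam (bar b) * lam (bar j)) *r
       down (bar a) (bar b) (down (bar i) (bar j) x) w w').
Proof.
rewrite vopE.
have lu : up a b (vop i j x) w w' = (sg i * lam i) *r up a b (up i j x) w w'
  + (sg i * eps * lam (bar j)) *r up a b (down (bar i) (bar j) x) w w'.
  exact: (linear2 (up a b)).
have ld : down (bar a) (bar b) (vop i j x) w w' =
  (sg i * lam i) *r down (bar a) (bar b) (up i j x) w w'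
  + (sg i * eps * lam (bar j)) *r down (bar a) (bar b) (down (bar i) (bar j) x) w w'.
  exact: (linear2 (down (bar a) (bar b))).
rewrite lu ld !scalerDr !rscaleA; congr (_ *r _ + _ *r _ + (_ *r _ + _ *r _)); try ring.
by rewrite -[RHS]mul1r -(eps2 d); ring.
Qed.

Lemma sg_barM k : sg (bar k) * sg k = eps.
Proof. by rewrite sg_bar -mulrA sg_lam2 mulr1. Qed.

Lemma sum4 (J : finType) (a b c e : C) (f g k l : J -> V) :
  \sum_i (a *: f i + (b *: g i + (c *: k i + e *: l i))) =
  a *: (\sum_i f i) + (b *: (\sum_i g i) + (c *: (\sum_i k i) + e *: (\sum_i l i))).
Proof. by rewrite !big_split /= !scaler_sumr. Qed.

(** What survives is a multiple of D_i S_j and one of S_i' D_j' on the second leg. The commutation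
    relation cancels the latter against the correction in the former, and leaves the Kronecker
    symbol. *)
Lemma sum_vop_vop i j x w w' : fock x ->
  \sum_k lam k *r vop (bar k) (bar i) (vop k j x) w w' =
  if i == j then lam i *r x w w' else 0.
Proof.
move=> h; have [sw|sw] := eqVneq (size w) (size w'); last first.
  have x0 : x w w' = 0 by case: h => h _ _; apply: h; apply/eqP.
  rewrite x0 scaler0 if_same big1 // => k _.
  have [hv _ _] := fock_vop (bar k) (bar i) (fock_vop k j h).
  by rewrite hv ?scaler0 //; exact/eqP.
have e k : lam k *r vop (bar k) (bar i) (vop k j x) w w' =
  1 *: (lam k *r up (bar k) (bar i) (up k j x) w w')
  + ((eps * lam (bar j)) *r up (bar k) (bar i) (down (bar k) (bar j) x) w w'
  + (lam i *r (lam k ^+ 2 *r down k i (up k j x) w w')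
  + (eps * lam i * lam (bar j)) *r (lam k *r down k i (down (bar k) (bar j) x) w w'))).
  rewrite scale1r vop_vopE !rev_ordK sg_barM !scalerDr !rscaleA -addrA.
  have he := eps2 d; have hk := lam_rev d k.
  by congr (_ *r _ + (_ *r _ + (_ *r _ + _ *r _))); ring: hk he.
under eq_bigr do rewrite e.
rewrite sum4 scale1r sum_up_up // sum_down_down // sum_down_up //.
rewrite scaler0 addr0 add0r.
rewrite (reindex_inj (@rev_ord_inj N)) /=; under eq_bigr do rewrite rev_ordK.
rewrite sum_up_down // rscaleA [unshift i _ _]shift_cons scalerBr rscaleA sw.
have -> : lam i * (phi (size w') * lam (bar i) * lam (bar j)) =
   eps * lam (bar j) * phi (size w') by rewrite -(lam_rev d i); ring.
rewrite addrC -addrA addNr addr0.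
by case: eqP; rewrite ?scaler0.
Qed.

Lemma sum_vop_vop2 i j x w w' : fock x ->
  \sum_k lam (bar k) *r vop i k (vop (bar j) (bar k) x) w w' =
  if i == j then lam (bar j) *r x w w' else 0.
Proof.
move=> h; have [sw|sw] := eqVneq (size w) (size w'); last first.
  have x0 : x w w' = 0 by case: h => h _ _; apply: h; apply/eqP.
  rewrite x0 scaler0 if_same big1 // => k _.
  have [hv _ _] := fock_vop i k (fock_vop (bar j) (bar k) h).
  by rewrite hv ?scaler0 //; exact/eqP.
have e k : lam (bar k) *r vop i k (vop (bar j) (bar k) x) w w' =
  (eps * sg i * sg j * lam i * lam (bar j)) *r
     (lam (bar k) *r up i k (up (bar j) (bar k) x) w w')
  + ((eps * sg i * sg j * lam i) *r up i k (down j k x) w w'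
  + ((sg i * sg j * lam (bar j)) *r
      (lam (bar k) ^+ 2 *r down (bar i) (bar k) (up (bar j) (bar k) x) w w')
  + (sg i * sg j) *r (lam (bar k) *r down (bar i) (bar k) (down j k x) w w'))).
  rewrite vop_vopE !rev_ordK sg_bar !scalerDr !rscaleA -addrA.
  have he := eps2 d; have hk := lam_rev d k.
  by congr (_ *r _ + (_ *r _ + (_ *r _ + _ *r _))); ring: hk he.
under eq_bigr do rewrite e.
rewrite sum4 sum_up_up2 // sum_down_down2 //.
rewrite sum_up_down2 // !scaler0 addr0 add0r.
have -> : \sum_k lam (bar k) ^+ 2 *r down (bar i) (bar k) (up (bar j) (bar k) x) w w' =
   \sum_k lam k ^+ 2 *r down (bar i) k (up (bar j) k x) w w'.
  by rewrite [RHS](reindex_inj (@rev_ord_inj N)).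
have es : unshift (bar i) (shift (bar j) x) w w' = (if i == j then x w w' else 0)
     - (phi (size w) * lam i * lam j) *r shift i (unshift j x) w w'.
  rewrite [unshift _ _ _]shift_cons !rev_ordK (inj_eq (@rev_ord_inj N)).
  by case: eqP.
rewrite sum_down_up2 // es scalerBr !rscaleA.
have -> : eps * sg i * sg j * lam i * phi (size w) =
   sg i * sg j * lam (bar j) * (phi (size w) * lam i * lam j).
  by rewrite -(lam_rev d j); ring.
rewrite addrC subrK; case: eqP => [->|_]; last exact: scaler0.
by rewrite sg_lam2 mul1r.
Qed.

End Unitarity.
End TwoLegs.
Arguments create {R N} d {V} i j x w _ : simpl never.
Arguments annihilate {R N V} i j x w w' : simpl never.
Arguments up {R N} d {V} i j x w _ : simpl never.
Arguments down {R N} d {V} i j x w _ : simpl never.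
Arguments vop {R N} d {V} i j x w _ : simpl never.

(** * The Fock space *)

Section ComplexForm.
Variable R : realType.
Local Notation C := R[i].

Definition rip (a b : C) : R := complex.Re a * complex.Re b + complex.Im a * complex.Im b.

Lemma rip_semi : semi_inner rip.
Proof.
split.
- by move=> [a b] [c e]; rewrite /rip /=; ring.
- by move=> [a b] [c e] [f g]; rewrite /rip /=; ring.
- by move=> r [a b] [c e]; rewrite /rip /=; ring.
- by move=> [a b]; rewrite /rip /= addr_ge0 // -expr2 sqr_ge0.
Qed.

Lemma ripJ (c a b : C) : rip (c *: a) b = rip a (c^* *: b).
Proof. by case: c a b => [c1 c2] [a1 a2] [b1 b2]; rewrite /rip /=; ring. Qed.

Lemma rip_eq0 a : rip a a = 0 -> a = 0.
Proof.
case: a => a b /eqP; rewrite /rip /= -!expr2 paddr_eq0 ?sqr_ge0 // !sqrf_eq0.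
by move=> /andP[/eqP -> /eqP ->].
Qed.

End ComplexForm.

Section GradedForm.
Variables (R : realType) (N : nat) (d : deformation R N).
Local Notation C := R[i].
Local Notation I := 'I_N.
Local Notation X := (seq I -> seq I -> C).
Local Notation phi := (phi d).
Local Notation fock := (fock d).
Local Notation rip := (@rip R).
Implicit Types (x y : X).

Lemma sum_semi (V W : lmodType C) (J : finType) (B : W -> W -> R) (f : J -> V -> W) :
  (forall i, linear (f i)) -> semi_inner B ->
  semi_inner (fun x y : V => \sum_i B (f i x) (f i y)).
Proof.
move=> hf hB; split.
- by move=> x y; apply: eq_bigr => i _; rewrite (formC hB).
- move=> x y z; rewrite -big_split; apply: eq_bigr => i _ /=.
  have -> : f i (x + y) = f i x + f i y by have := hf i 1 x y; rewrite !scale1r.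
  by rewrite (formDl hB).
- move=> r x y; rewrite mulr_sumr; apply: eq_bigr => i _.
  have f0 : f i 0 = 0.
    have := hf i 1 0 0; rewrite !scale1r addr0 => h.
    by apply/eqP; rewrite -(subrr (f i 0)) {2}h addrK.
  have -> : f i (r%:C%C *: x) = r%:C%C *: f i x by have := hf i (r%:C%C) x 0; rewrite f0 !addr0.
  by rewrite (formZl hB).
- by move=> x; apply: sumr_ge0 => i _; exact: form_ge0.
Qed.

Definition ipn (n : nat) x y : R :=
  \sum_(w : n.-tuple I) \sum_(w' : n.-tuple I) rip (x w w') (y w w').

(** Truncation to degrees below [M]: estimates are proved for these finite sums and then pass to the
    limit. *)
Definition ipT (M : nat) x y : R := \sum_(n < M) ipn n x y.

Lemma ip_leg_semi n :
  semi_inner (fun f g : seq I -> C => \sum_(w' : n.-tuple I) rip (f w') (g w')).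
Proof.
have hl (w : n.-tuple I) : linear (fun h : seq I -> C => h w : C) by [].
exact: sum_semi hl (rip_semi R).
Qed.

Lemma ipn_semi n : semi_inner (ipn n).
Proof.
have hl (w : n.-tuple I) : linear (fun h : X => h w : seq I -> C) by [].
exact: sum_semi hl (ip_leg_semi n).
Qed.

Lemma ipT_semi M : semi_inner (ipT M).
Proof.
split.
- by move=> x y; apply: eq_bigr => n _; rewrite (formC (ipn_semi n)).
- by move=> x y z; rewrite -big_split; apply: eq_bigr => n _; rewrite (formDl (ipn_semi n)).
- by move=> r x y; rewrite mulr_sumr; apply: eq_bigr => n _; rewrite (formZl (ipn_semi n)).
- by move=> x; apply: sumr_ge0 => n _; rewrite (form_ge0 (ipn_semi n)).
Qed.

Lemma ipnJ n (c : C) x y : ipn n (c *: x) y = ipn n x (c^* *: y).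
Proof. by apply: eq_bigr => w _; apply: eq_bigr => w' _; exact: ripJ. Qed.

Lemma ipTJ M (c : C) x y : ipT M (c *: x) y = ipT M x (c^* *: y).
Proof. by apply: eq_bigr => n _; exact: ipnJ. Qed.

Lemma ipn_scale n c x y : ipn n (degree_scale c x) y = c n * ipn n x y.
Proof.
rewrite /ipn mulr_sumr; apply: eq_bigr => w _; rewrite mulr_sumr.
by apply: eq_bigr => w' _; rewrite /degree_scale size_tuple (formZl (rip_semi R)).
Qed.

Lemma ipnS n x y : ipn n.+1 x y = \sum_i \sum_j ipn n (annihilate i j x) (annihilate i j y).
Proof.
rewrite /ipn (sum_tupleS _ (fun w => \sum_(w' : n.+1.-tuple I) rip (x w w') (y w w'))).
apply: eq_bigr => i _.
under eq_bigr => w _ do rewrite (sum_tupleS _ (fun w' => rip (x (i :: w) w') (y (i :: w) w'))).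
by rewrite exchange_big.
Qed.

Lemma ipn_create n i j x y : fock y ->
  ipn n.+1 (create d i j x) y = ipn n x (annihilate i j y).
Proof.
move=> [_ y2 y3]; rewrite /ipn.
transitivity (\sum_(w : n.-tuple I) \sum_(w' : n.+1.-tuple I)
    rip (shift d j (x w) w') (y (i :: w) w')).
  exact: (shift_adjoint (ip_leg_semi n.+1)).
apply: eq_bigr => w _; apply: (shift_adjoint (rip_semi R)); exact: y3.
Qed.

Lemma ipn_annihilate n i j x : ipn n (annihilate i j x) (annihilate i j x) <= ipn n.+1 x x.
Proof.
rewrite ipnS (bigD1 i) //= (bigD1 j) //= -addrA lerDl addr_ge0 //.
  by apply: sumr_ge0 => l _; rewrite (form_ge0 (ipn_semi n)).
by apply: sumr_ge0 => k _; apply: sumr_ge0 => l _; rewrite (form_ge0 (ipn_semi n)).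
Qed.

Lemma fnorm_le (V : lmodType C) (B B' : V -> V -> R) (x y : V) : semi_inner B' ->
  (B x x <= B' y y) -> fnorm B x <= fnorm B' y.
Proof. by move=> h h'; rewrite /fnorm ler_sqrt // form_ge0. Qed.

(** The adjoint [annihilate] is a contraction, as it selects part of the coordinates. *)
Lemma ipn_create_le n i j x : fock x ->
  ipn n.+1 (create d i j x) (create d i j x) <= ipn n x x.
Proof.
move=> hx; have hn := ipn_semi n; have hn1 := ipn_semi n.+1.
rewrite -(fnorm_sqr hn1) -(fnorm_sqr hn) ler_sqr ?nnegrE ?fnorm_ge0 //.
set y := create d i j x; have [->|y0] := eqVneq (fnorm (ipn n.+1) y) 0.
  exact: fnorm_ge0.
have y1 : 0 < fnorm (ipn n.+1) y by rewrite lt_neqAle eq_sym y0 fnorm_ge0.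
rewrite -(ler_pM2r y1) -expr2 (fnorm_sqr hn1) {1}/y ipn_create; last exact: fock_create.
apply: le_trans (form_CS hn _ _) _; rewrite ler_wpM2l ?fnorm_ge0 //.
by apply: fnorm_le => //; exact: ipn_annihilate.
Qed.

Lemma phi_le1 n : phi n <= 1.
Proof. exact: le_trans (phi_le d n) (ltW (qpar_lt1 d)). Qed.

Lemma ipn_up n i j x y : fock y -> ipn n.+1 (up d i j x) y = ipn n x (down d i j y).
Proof.
move=> hy; rewrite ipn_scale ipn_create //.
by rewrite [RHS](formC (ipn_semi n)) ipn_scale (formC (ipn_semi n)).
Qed.

Lemma ipn_up0 i j x y : ipn 0 (up d i j x) y = 0.
Proof. by rewrite ipn_scale phi0 sqrtr0 mul0r. Qed.

Lemma ipn_scale_le n c x : 0 <= c n <= 1 -> ipn n (degree_scale c x) (degree_scale c x) <= ipn n x x.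
Proof.
move=> /andP[c0 c1]; rewrite ipn_scale (formC (ipn_semi n)) ipn_scale mulrA.
by rewrite ler_piMl ?(form_ge0 (ipn_semi n)) // mulr_ile1.
Qed.

Lemma sqrt_phi01 n : 0 <= Num.sqrt (phi n) <= 1.
Proof.
rewrite sqrtr_ge0 -[X in _ <= X]sqrtr1 ler_sqrt //; exact: phi_le1.
Qed.

Lemma ipn_up_le n i j x : fock x -> ipn n.+1 (up d i j x) (up d i j x) <= ipn n x x.
Proof.
move=> hx; apply: le_trans (ipn_create_le n i j hx).
by apply: ipn_scale_le; exact: sqrt_phi01.
Qed.

Lemma ipn_down_le n i j x : ipn n (down d i j x) (down d i j x) <= ipn n.+1 x x.
Proof.
apply: le_trans (ipn_annihilate n i j x).
by apply: ipn_scale_le; exact: sqrt_phi01.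
Qed.

Lemma ipTS M x y : ipT M.+1 x y = ipn 0 x y + \sum_(n < M) ipn n.+1 x y.
Proof. by rewrite /ipT big_ord_recl. Qed.

(** The truncations differ by the one degree that [up] adds; the difference disappears in the
    limit. *)
Lemma ipT_up M i j x y : fock y -> ipT M.+1 (up d i j x) y = ipT M x (down d i j y).
Proof.
move=> hy; rewrite ipTS ipn_up0 add0r; apply: eq_bigr => n _; exact: ipn_up.
Qed.

Lemma ipT_le M M' x : (M <= M')%N -> ipT M x x <= ipT M' x x.
Proof.
move=> /subnK <-; rewrite addnC; elim: (_ - _)%N => [|k IH]; first by rewrite addn0.
apply: le_trans IH _; rewrite addnS [ipT _.+1 _ _]/ipT big_ord_recr /= lerDl.
exact: (form_ge0 (ipn_semi _)).
Qed.

Lemma ipT_up_le M i j x : fock x -> ipT M (up d i j x) (up d i j x) <= ipT M x x.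
Proof.
case: M => [|M] hx; first by rewrite /ipT !big_ord0.
rewrite ipTS ipn_up0 add0r; apply: le_trans (ipT_le x (leqnSn M)).
by apply: ler_sum => n _; exact: ipn_up_le.
Qed.

Lemma ipT_down_le M i j x : ipT M (down d i j x) (down d i j x) <= ipT M.+1 x x.
Proof.
rewrite ipTS; apply: le_trans (_ : \sum_(n < M) ipn n.+1 x x <= _); last first.
  by rewrite lerDr (form_ge0 (ipn_semi 0)).
by apply: ler_sum => n _; exact: ipn_down_le.
Qed.

Definition sqsum x := exists K : R, forall M, ipT M x x <= K.

Lemma sqsum0 : sqsum 0.
Proof. by exists 0 => M; rewrite (form0l (ipT_semi M)). Qed.

Lemma ipTZ2 M (c : C) x : ipT M (c *: x) (c *: x) = Normc.normc c ^+ 2 * ipT M x x.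
Proof.
rewrite ipTJ scalerA -(formZr (ipT_semi M)); congr (ipT M x (_ *: x)).
case: c => a b; rewrite /= sqr_sqrtr ?addr_ge0 ?sqr_ge0 //.
by apply/eqP; rewrite eq_complex /=; apply/andP; split; apply/eqP; ring.
Qed.

Lemma sqsum_lin (c : C) x y : sqsum x -> sqsum y -> sqsum (c *: x + y).
Proof.
move=> [K hK] [L hL]; exists ((Num.sqrt (Normc.normc c ^+ 2 * K) + Num.sqrt L) ^+ 2) => M.
have hM := ipT_semi M.
have L0 : 0 <= L by apply: le_trans (hL 0%N); rewrite (form_ge0 (ipT_semi 0)).
have K0 : 0 <= K by apply: le_trans (hK 0%N); rewrite (form_ge0 (ipT_semi 0)).
rewrite -(fnorm_sqr hM) ler_sqr ?nnegrE ?fnorm_ge0 ?addr_ge0 ?sqrtr_ge0 //.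
apply: le_trans (fnormD hM _ _) _; apply: lerD; last first.
  exact: ler_wsqrtr.
by apply: ler_wsqrtr; rewrite ipTZ2 ler_wpM2l ?sqr_ge0.
Qed.

Definition fock_l2 : {pred X} := fun x => `[< fock x /\ sqsum x >].

Lemma fock_l2_submod : submod_closed fock_l2.
Proof.
split; first by apply/asboolP; split; [exact: fock0 | exact: sqsum0].
move=> c x y /asboolP[x1 x2] /asboolP[y1 y2]; apply/asboolP; split.
  exact: fock_lin.
exact: sqsum_lin.
Qed.
HB.instance Definition _ := GRing.isSubmodClosed.Build C X fock_l2 fock_l2_submod.

Record fockv := Fockv { fval :> X ; fockvP : fval \in fock_l2 }.
HB.instance Definition _ := [isSub for fval].
HB.instance Definition _ := [Choice of fockv by <:].
HB.instance Definition _ := [SubChoice_isSubLmodule of fockv by <:].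

Lemma fval_fock (x : fockv) : fock x.
Proof. by case: x => x /= /asboolP[]. Qed.
Lemma fval_sqsum (x : fockv) : sqsum x.
Proof. by case: x => x /= /asboolP[]. Qed.
Lemma fvalD (x y : fockv) : fval (x + y) = fval x + fval y. Proof. by []. Qed.
Lemma fvalZ c (x : fockv) : fval (c *: x) = c *: fval x. Proof. by []. Qed.
Lemma fval_inj : injective fval. Proof. exact: val_inj. Qed.

Lemma ipT_cvg_diag x : sqsum x -> cvgn (fun M => ipT M x x).
Proof.
move=> [K hK]; apply: nondecreasing_is_cvgn.
  by move=> M M' h; exact: ipT_le.
by exists K => _ [M _ <-]; exact: hK.
Qed.

(** Polarization reduces this to the diagonal case, where the truncations are monotone and
    bounded. *)
Lemma ipT_cvg x y : sqsum x -> sqsum y -> cvgn (fun M => ipT M x y).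
Proof.
move=> hx hy; have hxy : sqsum (x + y) by rewrite -[x]scale1r; exact: sqsum_lin.
have -> : (fun M => ipT M x y) = (fun M => 2^-1 * (ipT M (x + y) (x + y) - ipT M x x - ipT M y y)).
  apply/funext => M; have h := ipT_semi M.
  by rewrite (formDl h) !(formDr h) (formC h y x); field.
apply: is_cvgMr; apply: is_cvgB; last exact: ipT_cvg_diag.
by apply: is_cvgB; exact: ipT_cvg_diag.
Qed.

Definition fip (x y : fockv) : R := limn (fun M => ipT M x y).

Lemma fip_cvg (x y : fockv) : ipT M x y @[M --> \oo] --> fip x y.
Proof. by apply: ipT_cvg; exact: fval_sqsum. Qed.

Lemma fip_eq (x y : fockv) (l : R) : ipT M x y @[M --> \oo] --> l -> fip x y = l.
Proof. by move=> h; apply: cvg_lim. Qed.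

Lemma fip_semi : semi_inner fip.
Proof.
split.
- move=> x y; rewrite /fip; under eq_fun => M do rewrite (formC (ipT_semi M)).
  by [].
- move=> x y z; apply: fip_eq.
  under eq_fun => M do rewrite fvalD (formDl (ipT_semi M)).
  by apply: cvgD; exact: fip_cvg.
- move=> r x y; apply: fip_eq.
  under eq_fun => M do rewrite fvalZ (formZl (ipT_semi M)).
  by apply: cvgMr; exact: fip_cvg.
- move=> x; apply: limr_ge; first by apply: ipT_cvg; exact: fval_sqsum.
  by apply: nearW => M; rewrite (form_ge0 (ipT_semi M)).
Qed.

Lemma fipJ (c : C) (x y : fockv) : fip (c *: x) y = fip x (c^* *: y).
Proof.
rewrite /fip; under eq_fun => M do rewrite fvalZ ipTJ.
by [].
Qed.

Lemma ipT_le_fip M (x : fockv) : ipT M x x <= fip x x.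
Proof.
apply: limr_ge; first by apply: ipT_cvg; exact: fval_sqsum.
by exists M => // M' /= h; exact: ipT_le.
Qed.

Lemma fip_le (K : R) (x : fockv) : (forall M, ipT M x x <= K) -> fip x x <= K.
Proof.
move=> h; apply: limr_le; first by apply: ipT_cvg; exact: fval_sqsum.
exact: nearW.
Qed.

(** Single coordinates are bounded by the norm; this yields definiteness, and the coordinatewise
    limits needed for completeness. *)
Lemma rip_le_ipT x w w' : size w = size w' ->
  rip (x w w') (x w w') <= ipT (size w).+1 x x.
Proof.
move=> sw; rewrite /ipT big_ord_recr /=; apply: ler_wpDl.
  by apply: sumr_ge0 => n _; rewrite (form_ge0 (ipn_semi n)).
rewrite /ipn (bigD1 (in_tuple w)) //= (bigD1 (tcast (esym sw) (in_tuple w'))) //=.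
rewrite val_tcast -addrA lerDl addr_ge0 //.
  by apply: sumr_ge0 => u _; rewrite (form_ge0 (rip_semi R)).
by apply: sumr_ge0 => v _; apply: sumr_ge0 => u _; rewrite (form_ge0 (rip_semi R)).
Qed.

Lemma fip_eq0 (x : fockv) : fip x x = 0 -> x = 0.
Proof.
move=> h; apply: fval_inj; apply/funext => w; apply/funext => w'.
have [sw|sw] := eqVneq (size w) (size w'); last first.
  by have [-> //] := fval_fock x; exact/eqP.
apply: rip_eq0; apply/eqP; rewrite eq_le (form_ge0 (rip_semi R)) andbT -h.
exact: le_trans (rip_le_ipT _ sw) (ipT_le_fip _ _).
Qed.

End GradedForm.
Arguments fip {R N} d x y.

Section FockSpace.
Variables (R : realType) (N : nat) (d : deformation R N).
Local Notation C := R[i].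
Local Notation I := 'I_N.
Local Notation bar := (@rev_ord N).
Local Notation X := (seq I -> seq I -> C).
Local Notation lam := (lam d).
Local Notation eps := (eps d).
Local Notation sg i := (Num.sg (lam i)).
Local Notation E := (fockv d).
Local Notation fip := (fip d).

Lemma cvg_bigsum (J : Type) (s : seq J) (P : pred J) (f : J -> nat -> R) (l : J -> R) :
  (forall j, f j n @[n --> \oo] --> l j) ->
  (\sum_(j <- s | P j) f j n) @[n --> \oo] --> \sum_(j <- s | P j) l j.
Proof.
move=> h; elim: s => [|j s IH].
  by under eq_fun do rewrite big_nil; rewrite big_nil; exact: cvg_cst.
rewrite big_cons; under eq_fun do rewrite big_cons.
by case: (P j) => //; exact: cvgD.
Qed.

Lemma cauchy_real_cvg (u : nat -> R) :
  (forall e : R, 0 < e -> exists n0 : nat, forall n m : nat,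
     (n0 <= n)%N -> (n0 <= m)%N -> `|u n - u m| < e) -> cvgn u.
Proof.
move=> h; apply/cauchy_cvgP/cauchy_exP => e e0; have [n0 hn] := h e e0.
by exists (u n0); exists n0 => // m /= hm; apply: hn.
Qed.

Lemma Re_rscale (r : R) (z : C) : complex.Re (r%:C%C *: z) = r * complex.Re z.
Proof. by case: z => a b; rewrite /=; ring. Qed.
Lemma Im_rscale (r : R) (z : C) : complex.Im (r%:C%C *: z) = r * complex.Im z.
Proof. by case: z => a b; rewrite /=; ring. Qed.
Lemma Re_sum (J : Type) (s : seq J) (P : pred J) (f : J -> C) :
  complex.Re (\sum_(j <- s | P j) f j) = \sum_(j <- s | P j) complex.Re (f j).
Proof. by elim/big_rec2: _ => // j a b _ <-; case: (f j) b => ? ? []. Qed.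
Lemma Im_sum (J : Type) (s : seq J) (P : pred J) (f : J -> C) :
  complex.Im (\sum_(j <- s | P j) f j) = \sum_(j <- s | P j) complex.Im (f j).
Proof. by elim/big_rec2: _ => // j a b _ <-; case: (f j) b => ? ? []. Qed.

Definition pointwise_cvg (x : nat -> X) (l : X) := forall w w',
  complex.Re (x n w w') @[n --> \oo] --> complex.Re (l w w') /\
  complex.Im (x n w w') @[n --> \oo] --> complex.Im (l w w').

Lemma pointwise_lin0 (x : nat -> X) (l : X) (J : finType) (c : J -> R) (w w' : J -> seq I) :
  pointwise_cvg x l -> (forall n, \sum_a c a *r x n (w a) (w' a) = 0) ->
  \sum_a c a *r l (w a) (w' a) = 0.
Proof.
move=> hl hx; apply/eqP; rewrite eq_complex; apply/andP; split; apply/eqP.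
  rewrite Re_sum; under eq_bigr do rewrite Re_rscale.
  have h : (\sum_a c a * complex.Re (x n (w a) (w' a))) @[n --> \oo] -->
     \sum_a c a * complex.Re (l (w a) (w' a)).
    by apply: cvg_bigsum => a; apply: cvgMr; case: (hl (w a) (w' a)).
  rewrite -(cvg_lim _ h) //; apply: cvg_lim => //.
  have -> : (fun n => \sum_a c a * complex.Re (x n (w a) (w' a))) = fun=> 0.
    apply/funext => n; rewrite -[RHS]/(complex.Re (0 : C)) -(hx n) Re_sum.
    by apply: eq_bigr => a _; rewrite Re_rscale.
  exact: cvg_cst.
rewrite Im_sum; under eq_bigr do rewrite Im_rscale.
have h : (\sum_a c a * complex.Im (x n (w a) (w' a))) @[n --> \oo] -->
   \sum_a c a * complex.Im (l (w a) (w' a)).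
  by apply: cvg_bigsum => a; apply: cvgMr; case: (hl (w a) (w' a)).
rewrite -(cvg_lim _ h) //; apply: cvg_lim => //.
have -> : (fun n => \sum_a c a * complex.Im (x n (w a) (w' a))) = fun=> 0.
  apply/funext => n; rewrite -[RHS]/(complex.Im (0 : C)) -(hx n) Im_sum.
  by apply: eq_bigr => a _; rewrite Im_rscale.
exact: cvg_cst.
Qed.

Lemma fock_limit (x : nat -> X) (l : X) : pointwise_cvg x l ->
  (forall n, fock d (x n)) -> fock d l.
Proof.
move=> hl hx; split.
- move=> w w' sw.
  have := @pointwise_lin0 x l unit (fun=> 1) (fun=> w) (fun=> w') hl.
  rewrite (big_pred1 tt) => [|[] //]; rewrite scale1r; apply => n.
  by rewrite big1 // => _ _; case: (hx n) => h _ _; rewrite h ?scaler0.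
- move=> p r; apply/funext => w'; rewrite sum_fun.
  apply: (@pointwise_lin0 x l I (fun a => lam (bar a)) (fun a => p ++ [:: a, bar a & r]) (fun=> w')) => // n.
  case: (hx n) => _ h _; have := congr1 (fun f => f w') (h p r).
  by rewrite sum_fun.
- move=> w p r.
  apply: (@pointwise_lin0 x l I (fun a => lam (bar a)) (fun=> w) (fun a => p ++ [:: a, bar a & r])) => // n.
  by case: (hx n) => _ _ h; exact: h.
Qed.

Lemma ipT_limit (x : nat -> X) (l y : X) M : pointwise_cvg x l ->
  ipT M (y - x n) (y - x n) @[n --> \oo] --> ipT M (y - l) (y - l).
Proof.
move=> hl; rewrite /ipT /ipn; apply: cvg_bigsum => n; apply: cvg_bigsum => w.
apply: cvg_bigsum => w'; rewrite /rip.
have eR (a b : C) : complex.Re (a - b) = complex.Re a - complex.Re b.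
  by case: a b => ? ? [].
have eI (a b : C) : complex.Im (a - b) = complex.Im a - complex.Im b.
  by case: a b => ? ? [].
have [h1 h2] := hl w w'.
under eq_fun => m do rewrite [(y - x m) w w']/(y w w' - x m w w') eR eI.
rewrite [(y - l) w w']/(y w w' - l w w') eR eI.
by apply: cvgD; apply: cvgM; apply: cvgB => //; exact: cvg_cst.
Qed.

(** The limit is formed coordinate by coordinate. Each condition in [fock] is a linear equation in
    finitely many coordinates and survives the limit. *)
Lemma fip_complete (x : nat -> E) :
    (forall e : R, 0 < e -> exists n0 : nat, forall n m : nat,
       (n0 <= n)%N -> (n0 <= m)%N -> fnorm fip (x n - x m) < e) ->
    exists l : E, forall e : R, 0 < e -> exists n0 : nat, forall n : nat,
       (n0 <= n)%N -> fnorm fip (x n - l) <= e.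
Proof.
move=> hx.
have hfip := fip_semi d.
have pt w w' e : 0 < e -> exists n0 : nat, forall n m : nat, (n0 <= n)%N -> (n0 <= m)%N ->
    rip (x n w w' - x m w w') (x n w w' - x m w w') < e ^+ 2.
  move=> e0; have [n0 h] := hx e e0; exists n0 => n m hn hm.
  have [sw|sw] := eqVneq (size w) (size w'); last first.
    have [hn0 _ _] := fval_fock (x n); have [hm0 _ _] := fval_fock (x m).
    rewrite hn0 ?hm0 ?subrr; try exact/eqP.
    by rewrite (form0l (rip_semi R)) exprn_gt0.
  apply: le_lt_trans (_ : fip (x n - x m) (x n - x m) < _).
    by apply: le_trans (ipT_le_fip (size w).+1 _); exact: (rip_le_ipT (fval (x n - x m)) sw).
  rewrite -(fnorm_sqr hfip) ltr_sqr ?nnegrE ?fnorm_ge0 ?ltW //; exact: h.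
have RI (a b : C) (e : R) : 0 < e -> rip (a - b) (a - b) < e ^+ 2 ->
    `|complex.Re a - complex.Re b| < e /\ `|complex.Im a - complex.Im b| < e.
  case: a b => a1 a2 [b1 b2] e0; rewrite /rip /= -!expr2 => h.
  have a0 := sqr_ge0 (a1 - b1); have b0 := sqr_ge0 (a2 - b2).
  have e1 := ltW e0.
  by split; rewrite -ltr_sqr ?nnegrE ?normr_ge0 // real_normK ?num_real //; lra.
pose l : X := fun w w' => Complex (limn (fun n => complex.Re (x n w w')))
   (limn (fun n => complex.Im (x n w w'))).
have hl : pointwise_cvg (fun n => fval (x n)) l.
  move=> w w'; split; apply: cauchy_real_cvg => e e0; have [n0 h] := pt w w' e e0;
    exists n0 => n m hn hm; have [] := RI _ _ _ e0 (h n m hn hm); done.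
have fl : fock d l by apply: fock_limit hl _ => n; exact: fval_fock.
(* For a fixed truncation the Cauchy bound passes to the limit in [m]; it does not depend on [M],
   which gives both square summability and convergence in norm. *)
have close e : 0 < e -> exists n0 : nat, forall n, (n0 <= n)%N -> forall M,
    ipT M (fval (x n) - l) (fval (x n) - l) <= e ^+ 2.
  move=> e0; have [n0 h] := hx e e0; exists n0 => n hn M.
  have hlim := @ipT_limit _ _ (fval (x n)) M hl.
  rewrite -(cvg_lim _ hlim) //; apply: limr_le; first by apply/cvg_ex; eexists; exact: hlim.
  exists n0 => // m /= hm.
  apply: le_trans (ipT_le_fip M (x n - x m)) _.
  rewrite -(fnorm_sqr hfip) ler_sqr ?nnegrE ?fnorm_ge0 ?ltW //; exact: h.
have sl : sqsum l.
  have [n0 h] := close 1 ltr01.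
  have hd : sqsum (fval (x n0) - l) by exists (1 ^+ 2); exact: h.
  have -> : l = -1 *: (fval (x n0) - l) + fval (x n0) by rewrite scaleN1r opprB subrK.
  by apply: sqsum_lin => //; exact: fval_sqsum.
have pl : l \in fock_l2 d by apply/asboolP.
exists (Fockv pl) => e e0; have [n0 h] := close e e0; exists n0 => n hn.
have e1 := ltW e0; rewrite -ler_sqr ?nnegrE ?fnorm_ge0 // (fnorm_sqr hfip).
by apply: fip_le => M; exact: h.
Qed.

Definition vacuum_fun : X := fun w w' => if (w == [::]) && (w' == [::]) then 1 else 0.

Lemma vacuum_in : vacuum_fun \in fock_l2 d.
Proof.
apply/asboolP; split.
  split.
  - by move=> [|? ?] [|? ?].
  - move=> p r; apply/funext => w'; rewrite sum_fun big1 // => a _.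
    by case: p => [|b p]; exact: scaler0.
  - move=> [|b w] p r; rewrite big1 // => a _; last exact: scaler0.
    by case: p => [|b p]; exact: scaler0.
exists 1 => -[|M]; first by rewrite /ipT big_ord0.
rewrite ipTS [X in _ + X]big1 ?addr0 => [|n _]; last first.
  rewrite (ipnS _ (vacuum_fun)) big1 // => i _; rewrite big1 // => j _.
  have -> : annihilate i j vacuum_fun = 0 by [].
  by rewrite (form0l (ipn_semi R N n)).
rewrite /ipn (sum_tuple0 (fun w => \sum_(w' : 0.-tuple I) rip (vacuum_fun w w') (vacuum_fun w w'))).
rewrite (sum_tuple0 (fun w' => rip (vacuum_fun [::] w') (vacuum_fun [::] w'))).
by rewrite /rip /= mulr1 mulr0 addr0.
Qed.
Definition vacuum : E := Fockv vacuum_in.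

Lemma vacuum_neq0 : vacuum <> 0.
Proof.
move=> /(congr1 (fun x : E => fval x [::] [::])) /= /eqP.
by rewrite oner_eq0.
Qed.

Definition fock_hilbert : hilbert R :=
  @Hilbert R E fip (fip_semi d) (@fipJ R N d) (@fip_eq0 R N d) vacuum vacuum_neq0 fip_complete.

Lemma fip_vacuum (x : E) : fip vacuum x = complex.Re (fval x [::] [::]).
Proof.
apply: fip_eq; rewrite -cvg_shiftS.
have -> : (fun n => ipT n.+1 vacuum x) = fun=> complex.Re (fval x [::] [::]).
  apply/funext => M; rewrite ipTS [X in _ + X]big1 ?addr0 => [|n _]; last first.
    rewrite ipnS big1 // => i _; rewrite big1 // => j _.
    have -> : annihilate i j vacuum = 0 by [].
    by rewrite (form0l (ipn_semi R N n)).
  rewrite /ipn (sum_tuple0 (fun w => \sum_(w' : 0.-tuple I) rip (fval vacuum w w') (fval x w w'))).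
  rewrite (sum_tuple0 (fun w' => rip (fval vacuum [::] w') (fval x [::] w'))).
  by rewrite /rip /= mul1r mul0r addr0.
exact: cvg_cst.
Qed.

Lemma up_in i j (x : E) : up d i j x \in fock_l2 d.
Proof.
apply/asboolP; split; first exact/fock_up/fval_fock.
have [K hK] := fval_sqsum x; exists K => M.
by apply: le_trans (hK M); apply: ipT_up_le; exact: fval_fock.
Qed.
Lemma down_in i j (x : E) : down d i j x \in fock_l2 d.
Proof.
apply/asboolP; split; first exact/fock_down/fval_fock.
have [K hK] := fval_sqsum x; exists K => M.
by apply: le_trans (hK M.+1); exact: ipT_down_le.
Qed.
Definition fup i j (x : E) : E := Fockv (up_in i j x).
Definition fdown i j (x : E) : E := Fockv (down_in i j x).

Lemma fup_adjoint i j : @adjoint_pair R fock_hilbert (fup i j) (fdown i j).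
Proof.
move=> x y; apply: fip_eq; rewrite -cvg_shiftS.
have -> : (fun n => ipT n.+1 (fup i j x) y) = fun n => ipT n x (fdown i j y).
  by apply/funext => n; apply: ipT_up; exact: fval_fock.
exact: fip_cvg.
Qed.

Lemma fup_adjointable i j : @adjointable R fock_hilbert (fup i j).
Proof.
split.
  by move=> c x; apply: fval_inj; rewrite /= linearZ.
exists (fdown i j); split; first exact: fup_adjoint.
exists 1; split => // x; rewrite mul1r; apply: (fnorm_le (fip_semi d)).
apply: fip_le => M; apply: le_trans (ipT_le_fip M x).
by apply: ipT_up_le; exact: fval_fock.
Qed.

Definition up_op i j : bop fock_hilbert := Bop (fup_adjointable i j).

Lemma down_opE i j (x : E) : bop_star (up_op i j) x = fdown i j x.
Proof.
apply: (@hip_ext R fock_hilbert) => z.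
rewrite (formC (hip_semi _)) -bop_starP [RHS](formC (hip_semi _)).
exact: fup_adjoint.
Qed.

Definition v_op i j : bop fock_hilbert :=
  (sg i * lam i) *r up_op i j + (sg i * eps * lam (bar j)) *r bop_star (up_op (bar i) (bar j)).

Lemma v_opE i j (x : E) : fval (v_op i j x) = vop d i j x.
Proof.
rewrite /v_op bopDE fvalD; congr (_ + _); rewrite bopZE fvalZ //.
by rewrite down_opE.
Qed.

(** This is u = F u^c F^-1 for the model, and it turns both unitarity relations into sums of
    products of two [vop]. *)
Lemma v_op_star i j : bop_star (v_op i j) = (eps * lam i * lam (bar j)) *r v_op (bar i) (bar j).
Proof.
rewrite /v_op bop_starD !bop_starZ bop_starK !rev_ordK addrC.
have cr (r : R) : (r%:C%C : C)^* = r%:C%C by exact: conjc_real.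
rewrite !cr scalerDr !rscaleA sg_bar.
have he := eps2 d; have hi := lam_rev d i; have hj := lam_rev d j.
have -> : eps * lam i * lam (bar j) * (eps * sg i * lam (bar i)) =
    sg i * eps * lam (bar j) by ring: he hi.
have -> // : eps * lam i * lam (bar j) * (eps * sg i * eps * lam j) = sg i * lam i.
by ring: he hj.
Qed.

Definition v_mx : 'M[bop_cstar fock_hilbert]_N := \matrix_(i, j) v_op i j.

End FockSpace.

(** * The Haar state *)

Lemma antidiag_entry (R : realType) (N : nat) (lam : 'I_N -> R) (i j : 'I_N) :
  (\sum_(i < N) lam i *: delta_mx i (rev_ord i)) i j = lam i * (j == rev_ord i)%:R.
Proof.
rewrite summxE (bigD1 i) //= big1 ?addr0 => [|k /negPf ki].
  by rewrite !mxE eqxx.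
by rewrite !mxE eq_sym ki mulr0.
Qed.

Section FreeOrthogonalRelations.
Variables (R : realType) (N : nat) (d : deformation R N).
Local Notation bar := (@rev_ord N).
Local Notation lam := (lam d).
Local Notation eps := (eps d).
Local Notation E := (fockv d).

Definition Fmx : 'M[R]_N := \sum_(i < N) lam i *: delta_mx i (bar i).

Lemma FmxE i j : Fmx i j = lam i * (j == bar i)%:R.
Proof. exact: antidiag_entry. Qed.

Lemma Fmx2 : Fmx *m Fmx = eps%:M.
Proof.
apply/matrixP => i j; rewrite !mxE (bigD1 (bar i)) //= big1 => [|k ki].
  rewrite !FmxE eqxx mulr1 rev_ordK addr0 mulrA lam_rev eq_sym.
  by case: eqP; rewrite ?mulr1n ?mulr0n ?mulr1 ?mulr0.
by rewrite !FmxE (negPf ki) mulr0 mul0r.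
Qed.

Lemma invFmx : invmx Fmx = eps *: Fmx.
Proof.
have h : (eps *: Fmx) *m Fmx = 1%:M.
  rewrite -scalemxAl Fmx2; apply/matrixP => i j; rewrite !mxE.
  by case: eqP; rewrite ?mulr1n ?mulr0n ?mulr0 // -expr2 eps2.
have [_ hu] := mulmx1_unit h.
by rewrite -[RHS]mulmx1 -(mulmxV hu) mulmxA h mul1mx.
Qed.

Lemma OF_conj (A : cstarAlgType R) (u : 'M[A]_N) i j :
  (scal_mx A Fmx *m conj_mx u *m scal_mx A (invmx Fmx)) i j =
  (eps * lam i * lam (bar j)) *r star (u (bar i) (bar j)).
Proof.
rewrite invFmx mxE (bigD1 (bar j)) //= big1 ?addr0 => [|k kj].
  rewrite mxE (bigD1 (bar i)) //= big1 ?addr0 => [|k ki].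
    rewrite !mxE !FmxE rev_ordK !eqxx !mulr1.
    rewrite mulr_algl -scalerAl mulr_algr rscaleA.
    by congr (_ *r _); ring.
  by rewrite !mxE FmxE (negPf ki) mulr0 rmorph0 scale0r mul0r.
rewrite [X in _ * X]mxE [X in real_complex _ X]mxE FmxE.
have -> : (j == bar k) = false.
  by apply/negbTE/eqP => e; move/eqP: kj; apply; rewrite e rev_ordK.
by rewrite !mulr0 rmorph0 scale0r mulr0.
Qed.

Local Notation B := (bop_cstar (fock_hilbert d)).
Local Notation v := (v_mx d).

Lemma fval_sum (J : Type) (s : seq J) (P : pred J) (f : J -> E) w w' :
  fval (\sum_(a <- s | P a) f a) w w' = \sum_(a <- s | P a) fval (f a) w w'.
Proof. by elim/big_rec2: _ => // a x y _ <-. Qed.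

Lemma v_OF : @OF_relations R N Fmx B v.
Proof.
have he := eps2 d.
split.
- apply/matrixP => i j; rewrite !mxE.
  apply: bop_ext => x; apply: fval_inj; apply/funext => w; apply/funext => w'.
  have -> : (\sum_k (conj_mx v)^T i k * v k j : bop (fock_hilbert d)) x =
    \sum_k (eps * lam k * lam (bar i)) *r v_op d (bar k) (bar i) (v_op d k j x).
    rewrite bop_sumE; apply: eq_bigr => k _; rewrite !mxE.
    by rewrite -[LHS]/(bop_star (v_op d k i) (v_op d k j x)) v_op_star bopZE.
  transitivity ((eps * lam (bar i)) *r
     \sum_k lam k *r vop d (bar k) (bar i) (vop d k j x) w w').
    rewrite fval_sum scaler_sumr.
    apply: eq_bigr => k _; rewrite fvalZ v_opE v_opE [LHS]/(_ *: _) rscaleA.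
    by rewrite mulrAC.
  rewrite sum_vop_vop; last exact: fval_fock.
  case: eqP => [->|_] /=; last by rewrite scaler0.
  by rewrite rscaleA -mulrA (mulrC (lam _)) lam_rev -expr2 he rscale1.
- apply/matrixP => i j; rewrite !mxE.
  apply: bop_ext => x; apply: fval_inj; apply/funext => w; apply/funext => w'.
  have -> : (\sum_k v i k * (conj_mx v)^T k j : bop (fock_hilbert d)) x =
    \sum_k (eps * lam j * lam (bar k)) *r v_op d i k (v_op d (bar j) (bar k) x).
    rewrite bop_sumE; apply: eq_bigr => k _; rewrite !mxE.
    by rewrite -[LHS]/(v_op d i k (bop_star (v_op d j k) x)) v_op_star bopZE bopZ.
  transitivity ((eps * lam j) *r
     \sum_k lam (bar k) *r vop d i k (vop d (bar j) (bar k) x) w w').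
    rewrite fval_sum scaler_sumr.
    apply: eq_bigr => k _; rewrite fvalZ v_opE v_opE [LHS]/(_ *: _) rscaleA.
    by [].
  rewrite sum_vop_vop2; last exact: fval_fock.
  case: eqP => _ /=; last by rewrite scaler0.
  by rewrite rscaleA -mulrA lam_rev -expr2 he rscale1.
- apply/matrixP => i j; rewrite OF_conj !mxE.
  rewrite -[star _]/(bop_star (v_op d (bar i) (bar j))) v_op_star !rev_ordK rscaleA.
  have hi := lam_rev d i; have hj := lam_rev d j.
  have -> : eps * lam i * lam (bar j) * (eps * lam (bar i) * lam j) = 1.
    by ring: he hi hj.
  by rewrite rscale1.
Qed.

End FreeOrthogonalRelations.

(** * The coaction on words and its compatibility with the shifts *)

Section Coaction.
Variables (R : realType) (N : nat) (d : deformation R N).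
Variables (A : cstarAlgType R) (u : 'M[A]_N).
Hypothesis hu : OF_relations (Fmx d) u.
Local Notation C := R[i].
Local Notation I := 'I_N.
Local Notation bar := (@rev_ord N).
Local Notation lam := (lam d).
Local Notation eps := (eps d).
Local Notation phi := (phi d).
Local Notation shift := (shift d).

Lemma u_conj i j : u i j = (eps * lam i * lam (bar j)) *r star (u (bar i) (bar j)).
Proof. by case: hu => _ _ h; rewrite {1}h OF_conj. Qed.

Lemma u_star i j : star (u i j) = (eps * lam i * lam (bar j)) *r u (bar i) (bar j).
Proof.
rewrite (u_conj (bar i) (bar j)) !rev_ordK rscaleA.
have he := eps2 d; have hi := lam_rev d i; have hj := lam_rev d j.
have -> : eps * lam i * lam (bar j) * (eps * lam (bar i) * lam j) = 1.
  by ring: he hi hj.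
by rewrite rscale1.
Qed.

Lemma u_unitary1 i j : \sum_k star (u k i) * u k j = if i == j then 1 else 0.
Proof.
case: hu => /matrixP /(_ i j) + _ _; rewrite !mxE.
by under eq_bigr do rewrite !mxE; move=> ->; case: eqP.
Qed.
Lemma u_unitary2 i j : \sum_k u i k * star (u j k) = if i == j then 1 else 0.
Proof.
case: hu => _ /matrixP /(_ i j) + _; rewrite !mxE.
by under eq_bigr do rewrite !mxE; move=> ->; case: eqP.
Qed.

(** Together with [u_cap], this says that T and T^* are invariant under the tensor square of u. *)
Lemma u_cup i k : \sum_l lam (bar l) *r (u i l * u k (bar l)) =
  lam k *r (if i == bar k then 1 else 0).
Proof.
rewrite -u_unitary2 scaler_sumr; apply: eq_bigr => l _.
rewrite (u_conj k (bar l)) !rev_ordK -scalerAr rscaleA.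
have he := eps2 d; have hl := lam_rev d l.
by have -> : lam (bar l) * (eps * lam k * lam l) = lam k by ring: he hl.
Qed.

Lemma u_cap j l : \sum_k lam (bar k) *r (u k j * u (bar k) l) =
  lam (bar j) *r (if bar j == l then 1 else 0).
Proof.
rewrite -u_unitary1 scaler_sumr [RHS](reindex_inj (@rev_ord_inj N)) /=.
apply: eq_bigr => k _; rewrite (u_conj k j) -scalerAl rscaleA.
have he := eps2 d; have hl := lam_rev d k.
by have -> : lam (bar k) * (eps * lam k * lam (bar j)) = lam (bar j) by ring: he hl.
Qed.

(* The coaction e_w |-> sum_w' u_(w', w) e_w' on words, as an A-valued function. *)
Fixpoint coact_at w (eta : seq I -> C) : A :=
  if w is k :: w' then \sum_l u k l * coact_at w' (unshift l eta) else (eta [::])%:A.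
Definition coact (eta : seq I -> C) : seq I -> A := fun w => coact_at w eta.
Arguments coact : simpl never.

Lemma coact_cons k w eta : coact eta (k :: w) = \sum_l u k l * coact (unshift l eta) w.
Proof. by []. Qed.

Lemma coact_is_linear : linear coact.
Proof.
move=> c eta zeta; apply/funext => w.
rewrite [RHS]/(c *: coact eta w + coact zeta w).
elim: w eta zeta => [|k w IH] eta zeta.
  transitivity ((c * eta [::] + zeta [::]) *: (1 : A)) => //.
  by rewrite scalerDl -scalerA.
rewrite !coact_cons.
transitivity (\sum_l (c *: (u k l * coact (unshift l eta) w) +
  u k l * coact (unshift l zeta) w)); last by rewrite big_split scaler_sumr.
apply: eq_bigr => l _.
have -> : coact (unshift l (c *: eta + zeta)) w =
    c *: coact (unshift l eta) w + coact (unshift l zeta) w by exact: IH.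
by rewrite mulrDr scalerAr.
Qed.
HB.instance Definition _ :=
  GRing.isLinear.Build C (seq I -> C) (seq I -> A) _ coact coact_is_linear.

Lemma coact_lin2 a b eta zeta w :
  coact (a *: eta + b *: zeta) w = a *: coact eta w + b *: coact zeta w.
Proof. by rewrite linearD !linearZ_LR. Qed.

Lemma coact_local eta zeta w : (forall v, size v = size w -> eta v = zeta v) ->
  coact eta w = coact zeta w.
Proof.
elim: w eta zeta => [|k w IH] eta zeta h; first by rewrite /coact /= h.
rewrite !coact_cons; apply: eq_bigr => l _; congr (_ * _); apply: IH => v sv.
by apply: h; rewrite /= sv.
Qed.

Lemma coact_unshift j eta w :
  \sum_k lam (bar k) *r (u k j * coact eta (bar k :: w)) =
  lam (bar j) *r coact (unshift (bar j) eta) w.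
Proof.
under eq_bigr => k _ do rewrite coact_cons mulr_sumr scaler_sumr.
rewrite exchange_big /=.
under eq_bigr => l _.
  under eq_bigr => k _ do rewrite mulrA scalerAl.
  rewrite -mulr_suml u_cap -scalerAl.
  over.
rewrite -scaler_sumr; congr (_ *: _).
rewrite (bigD1 (bar j)) //= eqxx mul1r big1 ?addr0 // => l.
by rewrite eq_sym => /negPf ->; rewrite mul0r.
Qed.

Definition lmul (a b : A) : A := a * b.
Lemma lmul_is_linear a : linear (lmul a).
Proof. by move=> c x y; rewrite /lmul mulrDr scalerAr. Qed.
HB.instance Definition _ a := GRing.isLinear.Build C A A _ (lmul a) (lmul_is_linear a).

(** The compressed creation is built from insertions of a letter and from T, and T is invariant. The
    invariance is used on both sides of the induction: through [coact_unshift] on the left, through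
    [u_cup] on the right. *)
Lemma coact_shift j eta w : \sum_k u k j * shift k (coact eta) w = coact (shift j eta) w.
Proof.
elim: w j eta => [|i w IH] j eta.
  by rewrite /coact /= scale0r big1 // => k _; rewrite mulr0.
set zeta := unshift (bar j) eta.
transitivity (u i j * coact eta w -
   (phi (size w) * lam (bar i) * lam (bar j)) *r shift (bar i) (coact zeta) w).
  under eq_bigr => k _ do rewrite shift_cons mulrBr.
  rewrite sumrB; congr (_ - _).
    rewrite (bigD1 i) //= eqxx big1 ?addr0 // => k.
    by rewrite eq_sym => /negPf ->; rewrite mulr0.
  transitivity ((phi (size w) * lam (bar i)) *r shift (bar i)
    (\sum_k lam (bar k) *r (fun v => lmul (u k j) (coact eta (bar k :: v)))) w).
    rewrite shift_sum scaler_sumr; apply: eq_bigr => k _.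
    rewrite shiftZ -(@shift_natural _ _ d _ _ (lmul (u k j))) rscaleA.
    by rewrite /lmul scalerAr.
  rewrite -(rscaleA (phi (size w) * lam (bar i))); congr (_ *: _).
  rewrite -shiftZ; congr (shift _ _ w).
  by apply/funext => v; rewrite sum_fun; exact: coact_unshift.
rewrite coact_cons.
transitivity (\sum_l u i l * ((if l == j then coact eta w else 0)
   - (phi (size w) * lam (bar l) * lam (bar j)) *r coact (shift (bar l) zeta) w)); last first.
  apply: eq_bigr => l _; congr (_ * _); apply/esym.
  transitivity (coact ((if l == j then 1 else 0) *: eta +
    (- (phi (size w) * lam (bar l) * lam (bar j)))%:C%C *: shift (bar l) zeta) w).
    apply: coact_local => v sv; rewrite [LHS]shift_cons sv rmorphN scaleNr.
    by case: eqP => _; rewrite ?scale1r ?scale0r.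
  rewrite coact_lin2 rmorphN scaleNr.
  by case: eqP => _; rewrite ?scale1r ?scale0r.
under [RHS]eq_bigr => l _ do rewrite mulrBr.
rewrite sumrB; congr (_ - _).
  rewrite (bigD1 j) //= eqxx big1 ?addr0 // => l /negPf ->; exact: mulr0.
transitivity ((phi (size w) * lam (bar j)) *r
   \sum_k \sum_l (lam (bar l) *r (u i l * u k (bar l))) * shift k (coact zeta) w).
  transitivity ((phi (size w) * lam (bar j)) *r (lam (bar i) *r shift (bar i) (coact zeta) w)).
    by rewrite rscaleA mulrAC.
  congr (_ *: _); under [RHS]eq_bigr => k _ do rewrite -mulr_suml u_cup -scalerAl.
  rewrite (bigD1 (bar i)) //= rev_ordK eqxx mul1r big1 ?addr0 // => k ki.
  have -> : (i == bar k) = false.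
    by apply/negbTE/eqP => e; move/eqP: ki; apply; rewrite e rev_ordK.
  by rewrite mul0r scaler0.
rewrite exchange_big scaler_sumr; apply: eq_bigr => l _ /=.
rewrite -IH -scalerAr scaler_sumr mulr_sumr [RHS]scaler_sumr.
apply: eq_bigr => k _; rewrite -(scalerAl (lam (bar l))%:C%C) rscaleA mulrA.
by congr (_ *r _); ring.
Qed.

End Coaction.

(** * Identification of the Haar state with the vacuum state *)

Section HaarState.
Variables (R : realType) (N : nat) (d : deformation R N).
Variables (A : cstarAlgType R) (u : 'M[A]_N).
Hypothesis hu : OF_relations (Fmx d) u.
Local Notation C := R[i].
Local Notation I := 'I_N.
Local Notation bar := (@rev_ord N).
Local Notation lam := (lam d).
Local Notation eps := (eps d).
Local Notation phi := (phi d).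
Local Notation shift := (shift d).
Local Notation sg i := (Num.sg (lam i)).
Local Notation E := (fockv d).
Local Notation B := (bop_cstar (fock_hilbert d)).
Local Notation coact := (coact u).

Lemma create_natural (V W : lmodType C) (psi : {linear V -> W}) i j
    (x : seq I -> seq I -> V) w w' :
  create d i j (fun v v' => psi (x v v')) w w' = psi (create d i j x w w').
Proof.
transitivity (shift i (fun v => psi (shift j (x v) w')) w).
  transitivity (fun_at w' (create d i j (fun v v' => psi (x v v')) w)) => //.
  rewrite (@shift_natural _ _ d _ _ (fun_at w')); congr (shift i _ w).
  by apply/funext => v; exact: (esym (@shift_natural _ _ d _ _ psi j (x v) w')).
rewrite -(@shift_natural _ _ d _ _ psi i (fun v => shift j (x v) w')); congr (psi _).
rewrite -[RHS]/(fun_at w' (create d i j x w)).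
by rewrite (@shift_natural _ _ d _ _ (fun_at w')).
Qed.

Lemma vop_natural (V W : lmodType C) (psi : {linear V -> W}) i j
    (x : seq I -> seq I -> V) w w' :
  vop d i j (fun v v' => psi (x v v')) w w' = psi (vop d i j x w w').
Proof.
have lin (a b c e : C) y z : psi (a *: (b *: y) + c *: (e *: z)) =
    a *: (b *: psi y) + c *: (e *: psi z) by rewrite (linearD psi) !(linearZ_LR psi).
rewrite !vopE !upE !downE lin; congr (_ + _).
by congr (_ *: (_ *: _)); exact: create_natural.
Qed.

Definition coact2 (x : seq I -> seq I -> C) : seq I -> seq I -> A := fun w => coact (x w).

(** The coaction acts on the second leg only, and the sum over [k] is the one in Delta(u_ij). The
    creation part is intertwined by [coact_shift], the annihilation part by [coact_unshift]. *)
Lemma coact2_vop i j x w w' :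
  \sum_k u k j * vop d i k (coact2 x) w w' = coact2 (vop d i j x) w w'.
Proof.
have -> : coact2 (vop d i j x) w w' =
  (sg i * lam i) *r (Num.sqrt (phi (size w)) *r coact (create d i j x w) w') +
  (sg i * eps * lam (bar j)) *r (Num.sqrt (phi (size w).+1) *r
    coact (unshift (bar j) (x (bar i :: w))) w').
  rewrite !rscaleA -coact_lin2; congr (coact _ w').
  apply/funext => v; rewrite vopE upE downE.
  by rewrite [RHS]/(_ *: _ + _ *: _) -!rscaleA.
under eq_bigr => k _ do rewrite vopE upE downE mulrDr.
rewrite big_split /=; congr (_ + _).
  rewrite rscaleA createE -(coact_shift hu) scaler_sumr; apply: eq_bigr => k _.
  rewrite rscaleA -scalerAr createE; congr (_ *: (_ * shift k _ w')).
  exact/esym/(@shift_natural _ _ d _ _ coact).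
transitivity ((sg i * eps * Num.sqrt (phi (size w).+1)) *r
   \sum_k lam (bar k) *r (u k j * coact (x (bar i :: w)) (bar k :: w'))).
  rewrite scaler_sumr; apply: eq_bigr => k _; rewrite !rscaleA -scalerAr.
  by congr (_ *r _); ring.
rewrite (coact_unshift hu) !rscaleA.
by congr (_ *r _); ring.
Qed.

Definition vword (l : seq (I * I)) : seq I -> seq I -> C :=
  foldr (fun e x => vop d e.1 e.2 x) (@vacuum_fun R N) l.

Definition monl (T : nzRingType) (z : 'M[T]_N) (l : seq (I * I)) : T :=
  \prod_(e <- l) z e.1 e.2.

Lemma coact_vacuum w w' : vacuum_fun R w w' *: (1 : A) = coact2 (@vacuum_fun R N) w w'.
Proof.
rewrite /coact2; case: w' => [|k w'] //.
rewrite coact_cons big1 => [|l _].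
  by rewrite /vacuum_fun andbF scale0r.
have -> : unshift l (vacuum_fun R w) = 0.
  by apply/funext => v; rewrite /unshift /vacuum_fun andbF.
by rewrite (linear0 coact) mulr0.
Qed.

Definition scal1 (a : A) (c : C) : A := c *: a.
Lemma scal1_is_linear a : linear (scal1 a).
Proof. by move=> c x y; rewrite /scal1 scalerDl scalerA. Qed.
HB.instance Definition _ a := GRing.isLinear.Build C C A _ (scal1 a) (scal1_is_linear a).

Lemma vword_coact n (s t : seq I) w w' : size s = n -> size t = n ->
  \sum_(r : n.-tuple I) vword (zip s r) w w' *: monl u (zip r t) =
  coact2 (vword (zip s t)) w w'.
Proof.
elim: n s t w w' => [|n IH] [|i s] [|j t] // w w'.
  move=> _ _; rewrite (sum_tuple0 (fun r => vword (zip [::] r) w w' *: monl u (zip r [::]))).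
  by rewrite /monl big_nil; exact: coact_vacuum.
move=> [ss] [st].
rewrite (sum_tupleS _ (fun r => vword (zip (i :: s) r) w w' *: monl u (zip r (j :: t)))).
rewrite -[RHS]coact2_vop; apply: eq_bigr => k _.
have -> : coact2 (vword (zip s t)) =
   \sum_(r : n.-tuple I) (fun v v' => scal1 (monl u (zip r t)) (vword (zip s r) v v')).
  by apply/funext => v; apply/funext => v'; rewrite -IH // sum_fun2.
rewrite linear_sum sum_fun2 mulr_sumr; apply: eq_bigr => r _.
transitivity (u k j * scal1 (monl u (zip r t)) (vop d i k (vword (zip s r)) w w')); last first.
  by congr (_ * _); apply/esym/vop_natural.
rewrite /scal1 -scalerAr; congr (_ *: _).
by rewrite /monl big_cons.
Qed.

Variables (h : {scalar A}) (hh : is_haar_state u h).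
Variables (rep : {lrmorphism A -> B}).
Hypotheses (rep_star : is_star_morphism rep)
  (rep_u : forall i j, rep (u i j) = v_mx d i j).

Definition vac_vec (a : A) : E := (rep a : bop (fock_hilbert d)) (vacuum d).
Definition vac_state (a : A) : C := fval (vac_vec a) [::] [::].

Lemma vac_vecM a b : vac_vec (a * b) = (rep a : bop (fock_hilbert d)) (vac_vec b).
Proof. by rewrite /vac_vec rmorphM. Qed.

Lemma vac_vec_linear : linear vac_vec.
Proof.
move=> c a b; rewrite /vac_vec linearP.
by rewrite -[LHS]/(((c *: rep a + rep b) : bop (fock_hilbert d)) (vacuum d)) bopDE bopZE.
Qed.
HB.instance Definition _ := GRing.isLinear.Build C A E _ vac_vec vac_vec_linear.

Lemma vac_state_linear : linear (vac_state : A -> C).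
Proof. by move=> c a b; rewrite /vac_state linearP. Qed.
HB.instance Definition _ := GRing.isLinear.Build C A C _ vac_state vac_state_linear.

Lemma vac_vec_monl l : fval (vac_vec (monl u l)) = vword l.
Proof.
rewrite /monl; elim: l => [|e l IH].
  by rewrite big_nil /vac_vec rmorph1.
rewrite big_cons vac_vecM rep_u mxE v_opE IH.
by [].
Qed.

(** Unstarred monomials suffice, since by [u_star] a starred generator is a multiple of a
    generator. *)
Lemma star_monomial_monl n (s t : n.-tuple I) :
  star_monomial u [tuple of nseq n false] s t = monl u (zip s t).
Proof.
rewrite /star_monomial /monl (eq_bigr (fun l => u (tnth s l) (tnth t l))); last first.
  by move=> l _; rewrite tnth_nseq.
elim: n s t => [|n IH] s t; first by rewrite big_ord0 (tuple0 s) (tuple0 t) /= big_nil.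
case/tupleP: s => a s; case/tupleP: t => b t.
rewrite big_ord_recl !tnth0 /= big_cons /= -IH; congr (_ * _).
by apply: eq_bigr => l _; rewrite !tnthS.
Qed.

(* Both states are invariant, and pairing the two invariance equations equates them. *)
Lemma haar_monl n (s t : n.-tuple I) :
  h (monl u (zip s t)) = vac_state (monl u (zip s t)).
Proof.
have [[h1 _] hinv] := hh.
have [e1 _] := hinv n [tuple of nseq n false] s t.
have {}e1 : \sum_(r : n.-tuple I) h (monl u (zip r t)) *: monl u (zip s r)
   = (h (monl u (zip s t)))%:A.
  rewrite -star_monomial_monl -e1; apply: eq_bigr => r _.
  by rewrite !star_monomial_monl.
have /(_ [::] [::]) e2 := @vword_coact n s t _ _ (size_tuple s) (size_tuple t).
have {}e2 : \sum_(r : n.-tuple I) vac_state (monl u (zip s r)) *: monl u (zip r t) =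
   (vac_state (monl u (zip s t)))%:A.
  rewrite {2}/vac_state vac_vec_monl -[RHS]e2; apply: eq_bigr => r _.
  by rewrite /vac_state vac_vec_monl.
have v1 : vac_state 1 = 1 by rewrite /vac_state /vac_vec rmorph1.
have scv (c : C) a : vac_state (c *: a) = c * vac_state a by rewrite linearZ.
have sch (c : C) a : h (c *: a) = c * h a by rewrite linearZ.
transitivity (\sum_(r : n.-tuple I) h (monl u (zip r t)) * vac_state (monl u (zip s r))).
  have := congr1 vac_state e1; rewrite linear_sum scv v1 mulr1 => <-.
  by apply: eq_bigr => r _; exact: scv.
have := congr1 h e2; rewrite linear_sum sch h1 mulr1 => <-.
by apply: eq_bigr => r _; rewrite sch mulrC.
Qed.

Definition monl_span (a : A) := exists s : seq (C * seq (I * I)),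
  a = \sum_(p <- s) p.1 *: monl u p.2.

Lemma monl_spanD a b : monl_span a -> monl_span b -> monl_span (a + b).
Proof. by move=> [s ->] [t ->]; exists (s ++ t); rewrite big_cat. Qed.
Lemma monl_spanZ c a : monl_span a -> monl_span (c *: a).
Proof.
move=> [s ->]; exists [seq (c * p.1, p.2) | p <- s].
by rewrite big_map scaler_sumr; apply: eq_bigr => p _; rewrite scalerA.
Qed.
Lemma monl_span_u i j a : monl_span a -> monl_span (u i j * a).
Proof.
move=> [s ->]; exists [seq (p.1, (i, j) :: p.2) | p <- s].
rewrite big_map mulr_sumr; apply: eq_bigr => p _.
by rewrite -scalerAr /monl big_cons.
Qed.

Lemma star1 : star (1 : A) = 1.
Proof. by rewrite -[LHS]mulr1 -{2}[1](@starK R A) -starM mulr1 starK. Qed.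

(** Multiplication by [a] and by [star a] are treated together, on arbitrary elements of the span,
    so that products and adjoints pass through the induction. *)
Lemma Pol_stable a : Pol u a -> forall c, monl_span c ->
  monl_span (a * c) /\ monl_span (star a * c).
Proof.
elim=> {a} [i j|||||] .
- move=> c hc; split; first exact: monl_span_u.
  by rewrite (u_star hu) -scalerAl; apply/monl_spanZ/monl_span_u.
- by move=> c hc; rewrite star1 mul1r.
- move=> a b _ ha _ hb c hc; have [a1 a2] := ha c hc; have [b1 b2] := hb c hc.
  by rewrite starD !mulrDl; split; exact: monl_spanD.
- move=> e a _ ha c hc; have [a1 a2] := ha c hc.
  by rewrite starZ -!scalerAl; split; exact: monl_spanZ.
- move=> a b _ ha _ hb c hc; rewrite starM -!mulrA; split.
    by have [b1 _] := hb c hc; have [] := ha _ b1.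
  by have [_ a2] := ha c hc; have [_] := hb _ a2.
- by move=> a _ ha c hc; have [a1 a2] := ha c hc; rewrite starK.
Qed.

Lemma Pol_monl a : Pol u a -> monl_span a.
Proof.
move=> ha; rewrite -[a]mulr1; apply: (Pol_stable ha _).1.
by exists [:: (1, [::])]; rewrite big_seq1 scale1r /monl big_nil.
Qed.

Lemma haar_vac a : Pol u a -> h a = vac_state a.
Proof.
move=> /Pol_monl [s ->]; rewrite !linear_sum; apply: eq_bigr => p _ /=.
rewrite !linearZ /=; congr (_ * _); case: p => c l /=.
have e : l = zip (map_tuple fst (in_tuple l)) (map_tuple snd (in_tuple l)).
  by rewrite /=; elim: l => [|[i j] l IH] //=; rewrite -IH.
by rewrite e; exact: haar_monl.
Qed.

(** By [haar_vac], [h (star a * a)] is the vacuum expectation of rep(a)^* rep(a); moving the adjoint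
    across the form gives a squared norm. *)
Lemma l2norm_vac a : Pol u a -> l2norm h a = fnorm (fip d) (vac_vec a).
Proof.
move=> ha; rewrite /l2norm haar_vac; last by apply: Pol_mul => //; exact: Pol_star.
rewrite /vac_state vac_vecM rep_star -fip_vacuum.
rewrite /fnorm; congr (Num.sqrt _).
exact: (esym (@bop_starP R (fock_hilbert d) (rep a) (vacuum d) (vac_vec a))).
Qed.

End HaarState.

(** * Words without cancellation *)

Section ReducedWords.
Variables (R : realType) (N : nat) (d : deformation R N).
Local Notation C := R[i].
Local Notation I := 'I_N.
Local Notation L := ('I_N * 'I_N)%type.
Local Notation bar := (@rev_ord N).
Local Notation X := (seq I -> seq I -> C).
Local Notation lam := (lam d).
Local Notation eps := (eps d).
Local Notation q := (qpar d).
Local Notation phi := (phi d).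
Local Notation shift := (shift d).
Local Notation create := (create d).
Local Notation fock := (fock d).
Local Notation sg i := (Num.sg (lam i)).
Implicit Types (x y : X) (e : L) (l : seq L).

Definition raise e x : X := (sg e.1 * lam e.1) *r create e.1 e.2 x.
Definition lower e x : X :=
  (sg e.1 * eps * lam (bar e.2)) *r annihilate (bar e.1) (bar e.2) x.
(** Between consecutive letters of a word, this says that the basis tensors of both legs are killed
    by the contractions with T. *)
Definition reduced : rel L := fun e e' => (e'.1 != bar e.1) && (e'.2 != bar e.2).

Lemma raise_is_linear e : linear (raise e).
Proof.
move=> c x y; rewrite /raise create_is_linear scalerDr !scalerA; congr (_ *: _ + _).
by rewrite mulrC.
Qed.
HB.instance Definition _ e := GRing.isLinear.Build C X X _ (raise e) (raise_is_linear e).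
Lemma lower_is_linear e : linear (lower e).
Proof.
move=> c x y; rewrite /lower annihilate_is_linear scalerDr !scalerA; congr (_ *: _ + _).
by rewrite mulrC.
Qed.
HB.instance Definition _ e := GRing.isLinear.Build C X X _ (lower e) (lower_is_linear e).

Lemma degree_scaleZ c (a : C) x : degree_scale c (a *: x) = a *: degree_scale c x.
Proof. by rewrite linearZ. Qed.

Lemma raise_scale e c x : raise e (degree_scale c x) = degree_scale (c \o predn) (raise e x).
Proof. by rewrite /raise create_scale degree_scaleZ. Qed.
Lemma lower_scale e c x : lower e (degree_scale c x) = degree_scale (c \o succn) (lower e x).
Proof. by rewrite /lower annihilate_scale degree_scaleZ. Qed.

Lemma fockZ (a : C) x : fock x -> fock (a *: x).
Proof. by move=> h; rewrite -[_ *: _]addr0; apply: fock_lin => //; exact: fock0. Qed.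
Lemma fock_raise e x : fock x -> fock (raise e x).
Proof. by move=> h; exact/fockZ/fock_create. Qed.
Lemma fock_lower e x : fock x -> fock (lower e x).
Proof. by move=> h; exact/fockZ/fock_annihilate. Qed.

Lemma vopRL i j x : vop d i j x =
  degree_scale (fun n => Num.sqrt (phi n)) (raise (i, j) x) +
  degree_scale (fun n => Num.sqrt (phi n.+1)) (lower (i, j) x).
Proof.
apply/funext => w; apply/funext => w'.
rewrite vopE upE downE /raise /lower !degree_scaleZ.
by rewrite [RHS]/(_ *: _ + _ *: _).
Qed.

(** Without cancellation the Kronecker symbol of the commutation relation is zero on each leg, and
    each leg contributes a factor [- phi]. The operators exchange their types while the letters keep
    their order. *)
Lemma lower_raise e e' x : reduced e e' -> fock x ->
  lower e (raise e' x) = degree_scale (fun n => phi n ^+ 2) (raise e (lower e' x)).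
Proof.
case: e e' => [i j] [i' j'] /andP[/= /negPf ni /negPf nj] hx.
have h1 := fock_lower (i, j) (fock_raise (i', j') hx).
have h2 := fock_scale (fun n => phi n ^+ 2) (fock_raise (i, j) (fock_lower (i', j') hx)).
apply/funext => w; apply/funext => w'.
have [sw|sw] := eqVneq (size w) (size w'); last first.
  have [e1 _ _] := h1; have [e2 _ _] := h2; move/eqP: sw => sw.
  by rewrite (e1 _ _ sw) (e2 _ _ sw).
have cre : annihilate (bar i) (bar j) (create i' j' x) w w' =
  (phi (size w) ^+ 2 * (lam i * lam (bar i') * lam j * lam (bar j'))) *r
    create i j (annihilate (bar i') (bar j') x) w w'.
  transitivity (((if bar i == i' then shift j' (x w) else 0) -
     (phi (size w) * lam (bar (bar i)) * lam (bar i')) *r shift (bar (bar i))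
       (unshift (bar i') (fun u => shift j' (x u))) w) (bar j :: w')) => //.
  rewrite rev_ordK [bar i == i']eq_sym ni sub0r.
  transitivity (- ((phi (size w) * lam i * lam (bar i')) *r
     shift i (fun u => shift j' (x (bar i' :: u)) (bar j :: w')) w)).
    congr (- (_ *: _)).
    exact: (@shift_natural _ _ d _ _ (fun_at (bar j :: w')) i
      (fun u => shift j' (x (bar i' :: u))) w).
  have -> : (fun u => shift j' (x (bar i' :: u)) (bar j :: w')) =
     (- (phi (size w') * lam j * lam (bar j'))) *r
       (fun u => shift j (unshift (bar j') (x (bar i' :: u))) w').
    apply/funext => u; rewrite shift_cons rev_ordK [bar j == j']eq_sym nj sub0r.
    exact: (esym (rscaleNl _ _)).
  rewrite shiftZ rscaleNl scalerN opprK rscaleA.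
  congr (_ *: _); first by congr (_%:C)%C; rewrite sw; ring.
  rewrite -[RHS]/(fun_at w' (create i j (annihilate (bar i') (bar j') x) w)).
  by rewrite (@shift_natural _ _ d _ _ (fun_at w')).
transitivity ((sg i * eps * lam (bar j)) *r ((sg i' * lam i') *r
  annihilate (bar i) (bar j) (create i' j' x) w w')) => //.
transitivity ((phi (size w) ^+ 2) *r ((sg i * lam i) *r ((sg i' * eps * lam (bar j')) *r
  create i j (annihilate (bar i') (bar j') x) w w'))); last first.
  by congr (_ *: (_ *: _)); rewrite /lower /= linearZ.
rewrite cre !rscaleA.
have he := eps2 d; have hi := lam_rev d i'; have hj := lam_rev d j.
by congr (_ *r _); ring: he hi hj.
Qed.

Definition raises l x : X := foldr raise x l.
Definition lowers l x : X := foldr lower x l.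
Definition vseq l x : X := foldr (fun e y => vop d e.1 e.2 y) x l.

(* The factor picked up when a [lower] crosses p consecutive [raise]s. *)
Fixpoint pass (p n : nat) : R := if p is p'.+1 then phi n ^+ 2 * pass p' n.-1 else 1.

Lemma fock_raises l x : fock x -> fock (raises l x).
Proof. by move=> h; elim: l => //= e l; exact: fock_raise. Qed.
Lemma fock_lowers l x : fock x -> fock (lowers l x).
Proof. by move=> h; elim: l => //= e l; exact: fock_lower. Qed.

(** Only the types move: the letters of [e :: l] stay in order, and the last one is now the lowered
    one. *)
Lemma lower_raises e l x : path reduced e l -> fock x ->
  lower e (raises l x) = degree_scale (pass (size l)) (raises (belast e l) (lower (last e l) x)).
Proof.
elim: l e x => [|e' l IH] e x /=.
  move=> _ _; apply/funext => w; apply/funext => w'.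
  by rewrite /degree_scale rscale1.
move=> /andP[r p] hx; rewrite lower_raise //; last exact: fock_raises.
rewrite IH // raise_scale degree_scaleM.
by [].
Qed.

Lemma pass_ge0 p n : 0 <= pass p n.
Proof. by elim: p n => [|p IH] n //=; rewrite mulr_ge0 ?sqr_ge0. Qed.

Lemma pass_le p n : pass p n <= (q ^+ 2) ^+ p.
Proof.
elim: p n => [|p IH] n //=; rewrite (exprS (q ^+ 2)) ler_pM ?sqr_ge0 ?pass_ge0 //.
have q0 := ltW (qpar_gt0 d).
by rewrite ler_sqr ?nnegrE ?phi_ge0 ?phi_le.
Qed.

(** The scalar of the term with [p] creations in a word of length [k], at output degree [n]. A new
    first letter either creates, or annihilates and then crosses the [p] creations behind it. *)
Fixpoint wcoef (k p n : nat) : R :=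
  if k is k'.+1 then
    (if p is p'.+1 then Num.sqrt (phi n) * wcoef k' p' n.-1 else 0)
    + Num.sqrt (phi n.+1) * wcoef k' p n.+1 * pass p n
  else (p == 0)%:R.

Lemma wcoef_gt k p n : (k < p)%N -> wcoef k p n = 0.
Proof.
elim: k p n => [|k IH] [|p] n //= kp; rewrite !IH ?mulr0 ?mul0r ?addr0 //.
exact: ltnW.
Qed.

Lemma degree_scaleD b c x :
  degree_scale b x + degree_scale c x = degree_scale (fun n => b n + c n) x.
Proof.
by apply/funext => w; apply/funext => w'; rewrite /degree_scale rscaleDl.
Qed.

Lemma take_last e l p : (p <= size l)%N ->
  belast e (take p l) = take p (e :: l) /\
  last e (take p l) :: drop p l = drop p (e :: l).
Proof.
elim: p e l => [|p IH] e [|f l] //= h; have [<- <-] := IH f l h.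
by [].
Qed.

(** Of the 2^k products of creations and annihilations, [lower_raises] leaves one shape for each
    number of creations. *)
Lemma vseq_expand l x : sorted reduced l -> fock x ->
  vseq l x = \sum_(p < (size l).+1)
    degree_scale (wcoef (size l) p) (raises (take p l) (lowers (drop p l) x)).
Proof.
move=> + hx; elim: l => [|e l IH] /= hl.
  rewrite big_ord1 /=; apply/funext => w; apply/funext => w'.
  by rewrite /degree_scale rscale1.
rewrite IH; last by case: l hl {IH} => //= f l /andP[].
set T := fun p => raises (take p l) (lowers (drop p l) x).
have hT p : (p <= size l)%N -> vop d e.1 e.2 (degree_scale (wcoef (size l) p) (T p)) =
  degree_scale (fun n => Num.sqrt (phi n) * wcoef (size l) p n.-1)
     (raises (take p.+1 (e :: l)) (lowers (drop p.+1 (e :: l)) x)) +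
  degree_scale (fun n => Num.sqrt (phi n.+1) * wcoef (size l) p n.+1 * pass p n)
     (raises (take p (e :: l)) (lowers (drop p (e :: l)) x)).
  move=> pl; rewrite vopRL -surjective_pairing raise_scale lower_scale !degree_scaleM.
  congr (_ + _); rewrite /T lower_raises //.
  - rewrite degree_scaleM size_take_min (minn_idPl pl).
    by have [-> <-] := take_last e pl.
  - exact: take_path.
  - exact: fock_lowers.
rewrite linear_sum.
rewrite (eq_bigr _ (fun (p : 'I_(size l).+1) _ => hT p (ltn_ord p))) big_split /=.
rewrite [in RHS]big_ord_recl [X in _ = X + _](_ : _ =
  degree_scale (fun n => Num.sqrt (phi n.+1) * wcoef (size l) 0 n.+1 * pass 0 n)
    (raises (take 0 (e :: l)) (lowers (drop 0 (e :: l)) x))); last first.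
  apply: (congr1 (fun c => degree_scale c _)).
  by apply: funext => n; rewrite /= add0r.
(* Each term feeds the terms with [p.+1] and with [p] creations. The second family is extended by
   one index, where [wcoef] vanishes, so that both can be added as in the recursion. *)
transitivity (\sum_(p < (size l).+1) degree_scale (fun n => Num.sqrt (phi n) *
   wcoef (size l) p n.-1) (raises (take p.+1 (e :: l)) (lowers (drop p.+1 (e :: l)) x)) +
 (\sum_(p < (size l).+2) degree_scale (fun n => Num.sqrt (phi n.+1) *
   wcoef (size l) p n.+1 * pass p n) (raises (take p (e :: l)) (lowers (drop p (e :: l)) x)))).
  congr (_ + _); rewrite [in RHS]big_ord_recr [X in _ = _ + X](_ : _ = 0) ?addr0 //.
  apply/funext => w; apply/funext => w'.
  by rewrite /degree_scale wcoef_gt // mulr0 mul0r rscale0.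
rewrite [X in _ + X]big_ord_recl addrCA; congr (_ + _).
rewrite -big_split; apply: eq_bigr => p _ /=.
by rewrite degree_scaleD.
Qed.

End ReducedWords.
Arguments raise {R N} d e x w _ : simpl never.
Arguments lower {R N} d e x w _ : simpl never.

(** * Bounds on the coefficients through Gaussian binomials *)

Section CoefficientBound.
Variables (R : realType) (N : nat) (d : deformation R N).
Local Notation q := (qpar d).
Local Notation Q := (qpar d ^+ 2).
Local Notation phi := (phi d).

Fixpoint gauss_binomial (k p : nat) : R :=
  if k is k'.+1 then (if p is p'.+1 then gauss_binomial k' p' else 0) + Q ^+ p * gauss_binomial k' p
  else (p == 0)%:R.

Definition qfact (n : nat) : R := \prod_(i < n) (1 - Q ^+ i.+1).

Lemma gauss_ge0 k p : 0 <= gauss_binomial k p.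
Proof.
elim: k p => [|k IH] p /=; first by case: eqP.
apply: addr_ge0; first by case: p.
by apply: mulr_ge0 => //; apply: exprn_ge0; exact: sqr_ge0.
Qed.

Lemma qfactS n : qfact n.+1 = qfact n * (1 - Q ^+ n.+1).
Proof. by rewrite /qfact big_ord_recr. Qed.

Lemma gauss_gt k p : (k < p)%N -> gauss_binomial k p = 0.
Proof.
elim: k p => [|k IH] [|p] //= kp; rewrite !IH ?mulr0 ?addr0 //.
exact: ltnW.
Qed.

(** The product formula, cleared of denominators. The induction is on [p + r], since the Pascal rule
    lowers either argument. *)
Lemma gauss_qfact p r : gauss_binomial (p + r) p * (qfact p * qfact r) = qfact (p + r).
Proof.
have : exists n, n = (p + r)%N by exists (p + r)%N.
case=> n; elim: n p r => [|n IH] p r.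
  by case: p => //; case: r => //= _; rewrite /qfact big_ord0 !mul1r.
case: p => [|p].
  case: r => [//|r] [e]; rewrite add0n /= expr0 mul1r add0r.
  have := IH 0%N r e; rewrite add0n qfactS => h.
  by rewrite -[in RHS]h /qfact big_ord0; ring.
case: r => [|r].
  rewrite !addn0 /= => -[e]; rewrite (gauss_gt (ltnSn p)) mulr0 addr0.
  have := IH p 0%N; rewrite addn0 => /(_ e) h.
  by rewrite qfactS -[in RHS]h /qfact big_ord0; ring.
rewrite addnS => -[e].
rewrite -[gauss_binomial _ _]/(gauss_binomial (p + r).+1 p + Q ^+ p.+1 * gauss_binomial (p + r).+1 p.+1).
rewrite -[qfact (_ + r).+1]/(qfact (p + r).+2).
have h1 : gauss_binomial (p + r).+1 p * (qfact p * qfact r.+1) = qfact (p + r).+1.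
  by rewrite -addnS; apply: IH; rewrite addnS -addSn.
have h2 : gauss_binomial (p + r).+1 p.+1 * (qfact p.+1 * qfact r) = qfact (p + r).+1.
  by rewrite -addSn; apply: IH.
rewrite (qfactS (p + r).+1).
transitivity ((gauss_binomial (p + r).+1 p * (qfact p * qfact r.+1)) * (1 - Q ^+ p.+1) +
   (gauss_binomial (p + r).+1 p.+1 * (qfact p.+1 * qfact r)) * (Q ^+ p.+1 * (1 - Q ^+ r.+1))).
  by rewrite !qfactS; ring.
rewrite h1 h2 -mulrDr; congr (_ * _).
have -> : Q ^+ (p + r).+2 = Q ^+ p.+1 * Q ^+ r.+1 by rewrite -exprD addSn addnS.
by ring.
Qed.

(** A lower bound for the infinite product of the 1 - Q^(i+1): one has 1 - x >= exp(- x / (1 - Q))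
    for 0 <= x <= Q, and the Q^(i+1) sum to at most Q / (1 - Q). *)
Definition qfact_inf : R := expR (- (Q / (1 - Q) ^+ 2)).

Lemma qfact_inf_gt0 : 0 < qfact_inf. Proof. exact: expR_gt0. Qed.

Lemma qfact_lb n : qfact_inf <= qfact n.
Proof.
have Q0 := q2_gt0 d; have Q1 := q2_lt1 d.
have Q1' : 0 < 1 - Q by rewrite subr_gt0.
have h m : expR (- ((\sum_(i < m) Q ^+ i.+1) / (1 - Q))) <= qfact m.
  elim: m => [|m IH]; first by rewrite big_ord0 mul0r oppr0 expR0 /qfact big_ord0.
  rewrite big_ord_recr /= mulrDl opprD expRD qfactS ler_pM ?expR_ge0 //.
  rewrite -[X in _ <= X]invrK expRN lef_pV2 ?posrE ?expR_gt0 ?invr_gt0 ?subr_gt0 ?q2n_lt1 //.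
  apply: le_trans (expR_ge1Dx _).
  have x0 : 0 < Q ^+ m.+1 by rewrite exprn_gt0.
  have xQ : Q ^+ m.+1 <= Q by rewrite exprS ger_pMr // exprn_ile1 // ltW.
  have x1 : 0 < 1 - Q ^+ m.+1 by rewrite subr_gt0 q2n_lt1.
  rewrite -[X in X <= _]mul1r ler_pdivrMr //.
  set x := Q ^+ m.+1 in x0 xQ x1 *.
  have e : x / (1 - Q) * (1 - Q) = x by rewrite divfK // gt_eqF.
  have : 0 <= x / (1 - Q) by rewrite divr_ge0 // ltW.
  set y := x / (1 - Q) in e *; move: e; set a := Q in xQ * => e y0.
  have : 0 <= y * (a - x) by rewrite mulr_ge0 // subr_ge0.
  have -> : y * (a - x) = (1 + y) * (1 - x) - 1 by rewrite -e; ring.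
  by rewrite subr_ge0.
apply: le_trans (h n); rewrite ler_expR lerN2 (expr2 (1 - Q)) invfM mulrA.
rewrite ler_pM2r ?invr_gt0 // ler_pdivlMr //.
elim: n {h} => [|n IH]; first by rewrite big_ord0 mul0r ltW.
rewrite big_ord_recl expr1 mulrDl.
have -> : \sum_(i < n) Q ^+ (bump 0 i).+1 = Q * \sum_(i < n) Q ^+ i.+1.
  by rewrite mulr_sumr; apply: eq_bigr => i _; rewrite -exprS.
have := ler_wpM2l (ltW Q0) IH; rewrite mulrA.
by set a := Q; lra.
Qed.

Lemma gauss_le k p : gauss_binomial k p <= qfact_inf ^-2.
Proof.
have [kp|pk] := ltnP k p.
  by rewrite gauss_gt // invr_ge0 sqr_ge0.
rewrite -(subnKC pk); set r := (k - p)%N.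
have q1 : qfact (p + r) <= 1.
  apply: prodr_ile1 => i _; rewrite subr_ge0 ltW ?q2n_lt1 //=.
  by rewrite gerBl exprn_ge0 // sqr_ge0.
rewrite -[X in _ <= X]mul1r ler_pdivlMr ?exprn_gt0 ?qfact_inf_gt0 //.
apply: le_trans q1; rewrite -gauss_qfact ler_wpM2l ?gauss_ge0 //.
by rewrite expr2 ler_pM ?qfact_lb // ltW // qfact_inf_gt0.
Qed.

Lemma wcoef_ge0 k p n : 0 <= wcoef d k p n.
Proof.
elim: k p n => [|k IH] p n /=; first by case: eqP.
apply: addr_ge0; first by case: p => // p; rewrite mulr_ge0 ?sqrtr_ge0.
by rewrite mulr_ge0 ?pass_ge0 // mulr_ge0 ?sqrtr_ge0.
Qed.

(** Each generator costs the square root of some [phi], at most that of q, and crossing [p]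
    creations costs at most Q^p: these are the weights in the Pascal rule. *)
Lemma wcoef_le_gauss k p n : wcoef d k p n <= Num.sqrt q ^+ k * gauss_binomial k p.
Proof.
elim: k p n => [|k IH] p n /=; first by rewrite expr0 mul1r.
have sphi m : Num.sqrt (phi m) <= Num.sqrt q by apply: ler_wsqrtr; exact: phi_le.
rewrite mulrDr lerD //.
  case: p => [|p]; first by rewrite mulr0.
  by rewrite exprS -mulrA ler_pM ?sqrtr_ge0 ?wcoef_ge0.
have -> : Num.sqrt q ^+ k.+1 * (Q ^+ p * gauss_binomial k p) =
   Num.sqrt q * (Num.sqrt q ^+ k * gauss_binomial k p) * Q ^+ p by rewrite exprS; ring.
rewrite ler_pM ?mulr_ge0 ?sqrtr_ge0 ?wcoef_ge0 ?pass_ge0 ?pass_le //.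
by rewrite ler_pM ?sqrtr_ge0 ?wcoef_ge0.
Qed.

Lemma wcoef_le k p n : wcoef d k p n <= Num.sqrt q ^+ k * qfact_inf ^-2.
Proof.
apply: le_trans (wcoef_le_gauss k p n) _.
by rewrite ler_wpM2l ?exprn_ge0 ?sqrtr_ge0 ?gauss_le.
Qed.

(** Only creations contribute, and the product of phi_1, ..., phi_k telescopes to 1 / [k+1]. *)
Lemma wcoef_diag k : wcoef d k k k ^+ 2 * (1 - Q ^+ k.+1) = q ^+ k * (1 - Q).
Proof.
elim: k => [|k IH]; first by rewrite /= expr1n expr0 expr1.
rewrite /= (wcoef_gt _ _ (ltnSn k)) mulr0 mul0r addr0 exprMn sqr_sqrtr ?phi_ge0 //.
rewrite [in X in X * _](_ : phi k.+1 = q * (1 - Q ^+ k.+1) / (1 - Q ^+ k.+2)) //.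
have h1 : 1 - Q ^+ k.+2 != 0 by rewrite gt_eqF // subr_gt0 q2n_lt1.
rewrite mulrAC divfK // -mulrA (mulrC _ (wcoef _ _ _ _ ^+ 2)) IH.
by rewrite mulrA -exprS.
Qed.

Lemma wcoef_diag_ge k : q ^+ k * (1 - Q) <= wcoef d k k k ^+ 2.
Proof.
rewrite -wcoef_diag; apply: ler_piMr; first exact: sqr_ge0.
by rewrite gerBl exprn_ge0 // sqr_ge0.
Qed.

End CoefficientBound.

(** * Norm estimates *)

Section OperatorEstimate.
Variables (R : realType) (N : nat) (d : deformation R N).
Local Notation C := R[i].
Local Notation I := 'I_N.
Local Notation L := ('I_N * 'I_N)%type.
Local Notation bar := (@rev_ord N).
Local Notation X := (seq I -> seq I -> C).
Local Notation lam := (lam d).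
Local Notation eps := (eps d).
Local Notation shift := (shift d).
Local Notation create := (create d).
Local Notation fock := (fock d).
Local Notation sg i := (Num.sg (lam i)).
Local Notation reduced := (@reduced N).
Local Notation ipn := (@ipn R N).
Local Notation ipT := (@ipT R N).
Implicit Types (x y z : X) (e : L) (l : seq L).

Definition creates l x : X := foldr (fun e y => create e.1 e.2 y) x l.
(** A left fold, because taking adjoints reverses the order of the letters in [creates]. *)
Definition annihilates l x : X := foldl (fun y e => annihilate e.1 e.2 y) x l.
Definition lower_bars l x : X :=
  foldr (fun e y => annihilate (bar e.1) (bar e.2) y) x l.
Definition raise_weight l : R := \prod_(e <- l) (sg e.1 * lam e.1).
Definition lower_weight l : R := \prod_(e <- l) (sg e.1 * eps * lam (bar e.2)).

Lemma createZ i j (a : C) x : create i j (a *: x) = a *: create i j x.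
Proof. by rewrite linearZ. Qed.

Lemma raisesE l x : raises d l x = raise_weight l *r creates l x.
Proof.
elim: l => [|e l IH]; first by rewrite /raise_weight big_nil rscale1.
rewrite [LHS]/(raise d e (raises d l x)) IH /raise_weight big_cons.
by rewrite /raise createZ rscaleA.
Qed.

Lemma lowersE l x : lowers d l x = lower_weight l *r lower_bars l x.
Proof.
elim: l => [|e l IH]; first by rewrite /lower_weight big_nil rscale1.
rewrite [LHS]/(lower d e (lowers d l x)) IH /lower_weight big_cons.
rewrite -(rscaleA (sg e.1 * eps * lam (bar e.2))).
by [].
Qed.

Lemma creates_is_linear l : linear (creates l).
Proof.
move=> c x y; elim: l => [|e l IH] //.
rewrite [LHS]/(create _ _ (creates l _)) IH; exact: create_is_linear.
Qed.
HB.instance Definition _ l := GRing.isLinear.Build C X X _ (creates l) (creates_is_linear l).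

Lemma fock_creates l x : fock x -> fock (creates l x).
Proof. by move=> h; elim: l => //= e l; exact: fock_create. Qed.
Lemma fock_lower_bars l x : fock x -> fock (lower_bars l x).
Proof. by move=> h; elim: l => //= e l; exact: fock_annihilate. Qed.

Lemma ipn_creates l n x z : fock z ->
  ipn (size l + n) (creates l x) z = ipn n x (annihilates l z).
Proof.
elim: l z => [|e l IH] z hz //; rewrite addSn ipn_create // IH //.
exact: fock_annihilate.
Qed.

Lemma ipnSp n x y : ipn n.+1 x y =
  \sum_(e : L) ipn n (annihilate e.1 e.2 x) (annihilate e.1 e.2 y).
Proof. by rewrite ipnS pair_big. Qed.

(** Parseval: splitting off [r] letters from each leg only relabels the coordinates. *)
Lemma sum_annihilates r n z :
  \sum_(l : r.-tuple L) ipn n (annihilates l z) (annihilates l z) = ipn (r + n) z z.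
Proof.
elim: r z => [|r IH] z.
  by rewrite (sum_tuple0 (fun l => ipn n (annihilates l z) (annihilates l z))).
rewrite (sum_tupleS _ (fun l => ipn n (annihilates l z) (annihilates l z))).
by rewrite addSn ipnSp; apply: eq_bigr => e _; rewrite -IH.
Qed.

Lemma sum_lower_bars r n y :
  \sum_(l : r.-tuple L) ipn n (lower_bars l y) (lower_bars l y) = ipn (r + n) y y.
Proof.
elim: r n => [|r IH] n.
  by rewrite (sum_tuple0 (fun l => ipn n (lower_bars l y) (lower_bars l y))).
rewrite (sum_tupleS _ (fun l => ipn n (lower_bars l y) (lower_bars l y))).
rewrite exchange_big addSnnS -IH; apply: eq_bigr => l _.
pose b := fun e : L => (bar e.1, bar e.2).
have bb : involutive b by case=> i j; rewrite /b /= !rev_ordK.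
by rewrite ipnSp [RHS](reindex_inj (inv_inj bb)).
Qed.

Lemma creates_small l x w : (size w < size l)%N -> creates l x w = 0.
Proof.
elim: l w => [|e l IH] [|k w] //= h.
apply: (@shift_local0 _ _ _ _ (size w)) => // u su.
by rewrite IH ?su // linear0.
Qed.

Lemma sum_CS (J : finType) (f g : J -> R) :
  \sum_i f i * g i <= Num.sqrt (\sum_i f i ^+ 2) * Num.sqrt (\sum_i g i ^+ 2).
Proof.
have hl (i : J) : linear (fun h : J -> C => h i : C) by [].
have e (a b : R) : rip a%:C%C b%:C%C = a * b by rewrite /rip /= mulr0 addr0.
pose B (x y : J -> C) := \sum_i rip (x i) (y i).
have eB (a b : J -> R) : B (fun i => (a i)%:C%C) (fun i => (b i)%:C%C) = \sum_i a i * b i.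
  by apply: eq_bigr => i _; exact: e.
have := form_CS (sum_semi hl (rip_semi R)) (fun i => (f i)%:C%C) (fun i => (g i)%:C%C).
by rewrite -!/(B _ _) /fnorm -!/(B _ _) !eB.
Qed.

Lemma fnorm_ipnZ n (c : C) x : fnorm (ipn n) (c *: x) = Normc.normc c * fnorm (ipn n) x.
Proof.
have n0 : 0 <= Normc.normc c by case: c => a b; exact: sqrtr_ge0.
have h := ipn_semi R N n.
have -> : fnorm (ipn n) (c *: x) = Num.sqrt (Normc.normc c ^+ 2 * ipn n x x).
  rewrite /fnorm ipnJ scalerA -(formZr h); congr (Num.sqrt (ipn n x (_ *: _))).
  case: c {n0} => a b; rewrite /= sqr_sqrtr ?addr_ge0 ?sqr_ge0 //.
  by apply/eqP; rewrite eq_complex /=; apply/andP; split; apply/eqP; ring.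
by rewrite sqrtrM ?sqr_ge0 // sqrtr_sqr ger0_norm.
Qed.

Definition block p r (b : seq L -> C) y : X :=
  \sum_(l : p.-tuple L) \sum_(l' : r.-tuple L)
     b (l ++ l') *: creates l (lower_bars l' y).

(* The words of creations form a row contraction and those of annihilations a
   column contraction, so the operator norm is at most the Hilbert-Schmidt norm
   of the coefficients. *)
Lemma block_estimate p r n (b : seq L -> C) y : fock y ->
  ipn (p + n) (block p r b y) (block p r b y) <=
  (\sum_(l : p.-tuple L) \sum_(l' : r.-tuple L) Normc.normc (b (l ++ l')) ^+ 2)
    * ipn (r + n) y y.
Proof.
move=> hy; set z := block p r b y.
have hz : fock z.
  rewrite /z /block; elim/big_rec: _ => [|l x _ hx]; first exact: fock0.
  rewrite -[\sum_(_ | _) _]scale1r; apply: fock_lin => //.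
  elim/big_rec: _ => [|l' x' _ hx']; first exact: fock0.
  by apply: fock_lin => //; apply: fock_creates; exact: fock_lower_bars.
have hpn := ipn_semi R N (p + n); have hn := ipn_semi R N n.
pose f (u : p.-tuple L * r.-tuple L) := Normc.normc (b (u.1 ++ u.2)).
pose g (u : p.-tuple L * r.-tuple L) :=
  fnorm (ipn n) (lower_bars u.2 y) * fnorm (ipn n) (annihilates u.1 z).
have le1 : ipn (p + n) z z <= \sum_u f u * g u.
  rewrite {1}/z /block pair_big (form_suml hpn); apply: ler_sum => -[l l'] _ /=.
  have -> : b (l ++ l') *: creates l (lower_bars l' y) =
     creates l (b (l ++ l') *: lower_bars l' y) by rewrite linearZ.
  rewrite -[in X in ipn (X + _)](size_tuple l) ipn_creates //.
  apply: le_trans (form_CS hn _ _) _; rewrite fnorm_ipnZ /f /g /=.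
  by rewrite mulrA.
have e1 : \sum_u f u ^+ 2 =
    \sum_(l : p.-tuple L) \sum_(l' : r.-tuple L) Normc.normc (b (l ++ l')) ^+ 2.
  by rewrite pair_big.
have e2 : \sum_u g u ^+ 2 = ipn (p + n) z z * ipn (r + n) y y.
  rewrite -(sum_lower_bars r n y) -(sum_annihilates p n z) mulr_suml.
  transitivity (\sum_(l : p.-tuple L) \sum_(l' : r.-tuple L) g (l, l') ^+ 2).
    by rewrite pair_big; apply: eq_bigr => -[].
  apply: eq_bigr => l _; rewrite mulr_sumr; apply: eq_bigr => l' _.
  by rewrite /g /= exprMn !(fnorm_sqr hn) mulrC.
have le2 := le_trans le1 (sum_CS f g); rewrite e1 e2 in le2.
set s := (X in _ <= X * _); set a := ipn (p + n) z z in le2 *; set c := ipn _ y y in le2 *.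
have a0 : 0 <= a by exact: form_ge0.
have c0 : 0 <= c by exact: form_ge0 (ipn_semi R N _) _.
have s0 : 0 <= s by apply: sumr_ge0 => l _; apply: sumr_ge0 => l' _; exact: sqr_ge0.
rewrite -/s (sqrtrM _ a0) mulrCA -{1}(sqr_sqrtr a0) expr2 in le2.
(* The norm to be bounded occurs on both sides; cancelling [Num.sqrt a] leaves
   [Num.sqrt a <= Num.sqrt s * Num.sqrt c]. *)
have [->|an] := eqVneq a 0; first by rewrite mulr_ge0.
have sa : 0 < Num.sqrt a by rewrite sqrtr_gt0 lt_neqAle eq_sym an.
rewrite (ler_pM2l sa) in le2.
rewrite -(sqr_sqrtr a0) -(sqr_sqrtr s0) -(sqr_sqrtr c0) -exprMn.
by rewrite ler_sqr ?nnegrE ?mulr_ge0 ?sqrtr_ge0.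
Qed.

(** Degree [r + n] is sent to degree [p + n], so the truncations differ; degrees below [p] receive
    nothing. *)
Lemma block_estimateT p r M (b : seq L -> C) y : fock y ->
  ipT M (block p r b y) (block p r b y) <=
  (\sum_(l : p.-tuple L) \sum_(l' : r.-tuple L) Normc.normc (b (l ++ l')) ^+ 2)
    * ipT (M + r) y y.
Proof.
move=> hy; set z := block p r b y; set s := (X in _ <= X * _).
have s0 : 0 <= s by apply: sumr_ge0 => l _; apply: sumr_ge0 => l' _; exact: sqr_ge0.
have small m : (m < p)%N -> ipn m z z = 0.
  move=> mp; rewrite /ipn big1 // => w _; rewrite big1 // => w' _.
  have -> : z w w' = 0.
    rewrite /z /block sum_fun2 big1 // => l _; rewrite sum_fun2 big1 // => l' _.
    rewrite [LHS]/(_ *: creates _ _ _ _) creates_small ?size_tuple //.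
    exact: scaler0.
  by rewrite (form0l (rip_semi R)).
have [Mp|pM] := leqP M p.
  rewrite {1}/ipT big1 => [|m _].
    by rewrite mulr_ge0 // (form_ge0 (ipT_semi R N _)).
  by apply: small; exact: leq_trans (ltn_ord m) Mp.
rewrite -(subnKC (ltnW pM)); set K := (M - p)%N.
have -> : ipT (p + K) z z = \sum_(n < K) ipn (p + n) z z.
  rewrite /ipT big_split_ord /= big1 ?add0r // => m _; exact: small.
apply: (@le_trans _ _ (s * \sum_(n < K) ipn (r + n) y y)).
  by rewrite mulr_sumr; apply: ler_sum => n _; exact: block_estimate.
apply: ler_wpM2l => //; apply: le_trans (_ : ipT (r + K) y y <= _).
  have -> : ipT (r + K) y y = \sum_(n < r) ipn n y y + \sum_(n < K) ipn (r + n) y y.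
    by rewrite /ipT big_split_ord.
  rewrite lerDr.
  by apply: sumr_ge0 => n _; rewrite (form_ge0 (ipn_semi R N _)).
by apply: ipT_le; rewrite addnC leq_add2r leq_addl.
Qed.

Definition word_vector l : X := fun w w' => ((w == unzip1 l) && (w' == unzip2 l))%:R.

(** Along a word without cancellation each correction looks for the conjugate of the new letter at
    the front and finds none, so the compressed creations simply prepend letters. *)
Lemma creates_vacuum l : sorted reduced l -> creates l (@vacuum_fun R N) = word_vector l.
Proof.
elim: l => [|[i j] l IH] hl.
  by apply/funext => w; apply/funext => w'; rewrite /word_vector /creates /= /vacuum_fun; case: andP.
have hl' : sorted reduced l by case: l hl {IH} => //= f l /andP[].
rewrite [LHS]/(create i j (creates l (@vacuum_fun R N))) IH //.
apply/funext => -[|k w]; apply/funext => w' //.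
have s2 v : shift j (word_vector l v) w' = ((v == unzip1 l) && (w' == j :: unzip2 l))%:R.
  case: w' => [|k' w']; first by rewrite /shift /= andbF.
  rewrite shift_cons (_ : unshift (bar j) (word_vector l v) = 0); last first.
    apply/funext => v'; rewrite /unshift /word_vector.
    case: l hl {IH hl'} => [|[i0 j0] l] /=; first by rewrite andbF.
    by move=> /andP[/andP[_ /= /negPf nj] _]; rewrite eqseq_cons [bar j == j0]eq_sym nj andbF.
  rewrite linear0 scaler0 subr0 /word_vector eqseq_cons.
  by case: (k' == j); rewrite ?andbF.
transitivity (shift i (fun v => shift j (word_vector l v) w') (k :: w)).
  exact: (@shift_natural _ _ d _ _ (fun_at w') i (fun v => shift j (word_vector l v)) (k :: w)).
have -> : (fun v => shift j (word_vector l v) w') =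
  (fun v => ((v == unzip1 l) && (w' == j :: unzip2 l))%:R) by apply/funext.
rewrite shift_cons (_ : unshift (bar i) _ = 0); last first.
  apply/funext => v'; rewrite /unshift.
  case: l hl {IH hl' s2} => [|[i0 j0] l] //=.
  by move=> /andP[/andP[/= /negPf ni _] _]; rewrite eqseq_cons [bar i == i0]eq_sym ni.
rewrite linear0 scaler0 subr0 /word_vector /= eqseq_cons.
by case: (k == i).
Qed.

Lemma sum_tuple_unzip (G : nmodType) n (f : seq I -> seq I -> G) :
  \sum_(w : n.-tuple I) \sum_(w' : n.-tuple I) f w w' =
  \sum_(l : n.-tuple L) f (unzip1 l) (unzip2 l).
Proof.
elim: n f => [|n IH] f.
  rewrite (sum_tuple0 (fun w => \sum_(w' : 0.-tuple I) f w w')) (sum_tuple0 (f [::])).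
  by rewrite (sum_tuple0 (fun l : seq L => f (unzip1 l) (unzip2 l))).
rewrite (sum_tupleS _ (fun w => \sum_(w' : n.+1.-tuple I) f w w')).
rewrite (sum_tupleS _ (fun l : seq L => f (unzip1 l) (unzip2 l))).
transitivity (\sum_i \sum_j \sum_(w : n.-tuple I) \sum_(w' : n.-tuple I) f (i :: w) (j :: w')).
  apply: eq_bigr => i _; rewrite [RHS]exchange_big /=.
  by apply: eq_bigr => w _; rewrite (sum_tupleS _ (f (i :: w))).
rewrite pair_big; apply: eq_bigr => -[i j] _ /=.
exact: (IH (fun w w' => f (i :: w) (j :: w'))).
Qed.

End OperatorEstimate.

(** * From Hilbert-Schmidt norms to the L^2 norm *)

Section SpanEstimate.
Variables (R : realType) (N : nat) (d : deformation R N).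
Local Notation C := R[i].
Local Notation I := 'I_N.
Local Notation L := ('I_N * 'I_N)%type.
Local Notation bar := (@rev_ord N).
Local Notation X := (seq I -> seq I -> C).
Local Notation lam := (lam d).
Local Notation eps := (eps d).
Local Notation q := (qpar d).
Local Notation Q := (qpar d ^+ 2).
Local Notation fock := (fock d).
Local Notation sg i := (Num.sg (lam i)).
Local Notation reduced := (@reduced N).
Local Notation ipn := (@ipn R N).
Local Notation ipT := (@ipT R N).
Local Notation E := (fockv d).
Local Notation vac := (@vacuum_fun R N).
Local Notation raise_weight := (raise_weight d).
Local Notation lower_weight := (lower_weight d).

(** The squared quotient of the coefficients of the letter in [lower] and in [raise], as
    [lam (bar i)] is the inverse of [lam i] up to sign. *)
Definition leg_ratio (e : L) : R := lam (bar e.1) ^+ 2 * lam (bar e.2) ^+ 2.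

Variables (k : nat) (a : seq L -> C) (rho : R).
Hypothesis rho_ge0 : 0 <= rho.
Hypothesis ha : forall l, a l != 0 -> size l = k ->
  sorted reduced l /\ all (fun e => leg_ratio e <= rho ^+ 2) l.

Definition span_op (y : X) : X := \sum_(l : k.-tuple L) a l *: vseq d l y.

Definition block_coef (p : nat) (l : seq L) : C :=
  (raise_weight (take p l) * lower_weight (drop p l))%:C%C * a l.

Lemma degree_scale0 c : degree_scale c 0 = 0 :> X.
Proof. by apply/funext => w; apply/funext => w'; exact: scaler0. Qed.

Lemma degree_scale_sum (J : finType) c (f : J -> X) :
  degree_scale c (\sum_i f i) = \sum_i degree_scale c (f i).
Proof. exact: linear_sum. Qed.

Lemma createsZ l (c : C) (x : X) : creates d l (c *: x) = c *: creates d l x.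
Proof. exact: linearZ_LR. Qed.

Lemma span_op_expand y : fock y -> span_op y =
  \sum_(p < k.+1) degree_scale (wcoef d k p) (block d p (k - p) (block_coef p) y).
Proof.
move=> hy.
have e (l : k.-tuple L) : a l *: vseq d l y = \sum_(p < k.+1)
   degree_scale (wcoef d k p) (a l *: raises d (take p l) (lowers d (drop p l) y)).
  have [->|al] := eqVneq (a l) 0.
    by rewrite scale0r big1 // => p _; rewrite scale0r degree_scale0.
  have [rl _] := ha al (size_tuple l).
  rewrite vseq_expand // scaler_sumr size_tuple; apply: eq_bigr => p _.
  by rewrite degree_scaleZ.
rewrite /span_op; under eq_bigr do rewrite e.
rewrite exchange_big; apply: eq_bigr => p _ /=.
rewrite -degree_scale_sum; congr degree_scale.
have split_sum n r (f : seq L -> X) : (n + r)%N = k ->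
    \sum_(l : k.-tuple L) f l = \sum_(u : n.-tuple L) \sum_(v : r.-tuple L) f (u ++ v).
  by move=> <-; exact: sum_tuple_cat.
rewrite (split_sum p (k - p)%N (fun l => a l *: raises d (take p l) (lowers d (drop p l) y))); last first.
  by rewrite subnKC // -ltnS.
apply: eq_bigr => u _; apply: eq_bigr => v _.
rewrite /block_coef take_size_cat ?size_tuple // drop_size_cat ?size_tuple //.
rewrite raisesE lowersE.
by rewrite createsZ rscaleA scalerA mulrC.
Qed.

(** The squared Hilbert-Schmidt norm of the block made of creations only, to which all other blocks
    are compared. *)
Definition weight2 : R := \sum_(l : k.-tuple L) Normc.normc (a l) ^+ 2 * raise_weight l ^+ 2.

Lemma lower_weight_le l : all (fun e => leg_ratio e <= rho ^+ 2) l ->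
  lower_weight l ^+ 2 <= (rho ^+ size l) ^+ 2 * raise_weight l ^+ 2.
Proof.
elim: l => [|e l IH] /=.
  by rewrite /lower_weight /raise_weight !big_nil expr0 !expr1n mulr1.
move=> /andP[he hl]; rewrite /lower_weight /raise_weight !big_cons (exprS rho).
rewrite -/(lower_weight l) -/(raise_weight l).
have e1 : (sg e.1 * eps * lam (bar e.2) * lower_weight l) ^+ 2 =
   lam (bar e.2) ^+ 2 * lower_weight l ^+ 2.
  have h1 := sg_lam2 d e.1; have h2 := eps2 d.
  by rewrite !exprMn h2 (expr2 (sg _)) h1 !mul1r.
have e2 : (rho * rho ^+ size l) ^+ 2 * (sg e.1 * lam e.1 * raise_weight l) ^+ 2 =
   (rho ^+ 2 * lam e.1 ^+ 2) * ((rho ^+ size l) ^+ 2 * raise_weight l ^+ 2).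
  have h1 := sg_lam2 d e.1.
  by rewrite !exprMn (expr2 (sg _)) h1; ring.
rewrite e1 e2 ler_pM ?sqr_ge0 ?IH //.
have h := lam_bar2 d e.1.
have -> : lam (bar e.2) ^+ 2 = leg_ratio e * lam e.1 ^+ 2.
  by rewrite /leg_ratio mulrAC h mul1r.
by rewrite ler_wpM2r ?sqr_ge0.
Qed.

Lemma normcR (r : R) (z : C) : Normc.normc (r%:C%C * z) ^+ 2 = r ^+ 2 * Normc.normc z ^+ 2.
Proof.
rewrite Normc.normcM exprMn; congr (_ * _).
by rewrite /= expr0n addr0 sqr_sqrtr ?sqr_ge0.
Qed.

Lemma raise_weight_cat l l' : raise_weight (l ++ l') = raise_weight l * raise_weight l'.
Proof. by rewrite /raise_weight big_cat. Qed.

Lemma block_coef_sum p : (p <= k)%N ->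
  \sum_(u : p.-tuple L) \sum_(v : (k - p).-tuple L) Normc.normc (block_coef p (u ++ v)) ^+ 2
  <= (rho ^+ (k - p)) ^+ 2 * weight2.
Proof.
move=> pk.
have split_sum n r (f : seq L -> R) : (n + r)%N = k ->
    \sum_(l : k.-tuple L) f l = \sum_(u : n.-tuple L) \sum_(v : r.-tuple L) f (u ++ v).
  by move=> <-; exact: sum_tuple_cat.
rewrite /weight2 (split_sum p (k - p)%N (fun l => Normc.normc (a l) ^+ 2 * raise_weight l ^+ 2)) ?subnKC //.
rewrite mulr_sumr; apply: ler_sum => u _; rewrite mulr_sumr; apply: ler_sum => v _.
rewrite /block_coef normcR take_size_cat ?size_tuple // drop_size_cat ?size_tuple //.
have [->|al] := eqVneq (a (u ++ v)) 0; first by rewrite Normc.normc0 expr0n !(mulr0, mul0r).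
have suv : size (u ++ v) = k by rewrite size_cat !size_tuple subnKC.
have [_] := ha al suv; rewrite all_cat => /andP[_ hv].
have := lower_weight_le hv; rewrite size_tuple => h.
rewrite [X in _ <= X](_ : _ = raise_weight u ^+ 2 *
   ((rho ^+ (k - p)) ^+ 2 * raise_weight v ^+ 2) * Normc.normc (a (u ++ v)) ^+ 2).
  by rewrite ler_wpM2r ?sqr_ge0 // exprMn ler_wpM2l ?sqr_ge0.
by rewrite raise_weight_cat; ring.
Qed.

Lemma ipT_scale_le M (c : nat -> R) (B : R) x : (forall n, 0 <= c n <= B) ->
  fnorm (ipT M) (degree_scale c x) <= B * fnorm (ipT M) x.
Proof.
move=> hc; have B0 : 0 <= B by have /andP[c0 cB] := hc 0%N; exact: le_trans cB.
have -> : B * fnorm (ipT M) x = Num.sqrt (B ^+ 2 * ipT M x x).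
  by rewrite sqrtrM ?sqr_ge0 // sqrtr_sqr ger0_norm.
apply: ler_wsqrtr; rewrite /ipT mulr_sumr; apply: ler_sum => n _.
have hn := ipn_semi R N n.
rewrite ipn_scale (formC hn) ipn_scale mulrA ler_wpM2r ?(form_ge0 hn) //.
by have /andP[c0 cB] := hc n; rewrite expr2 ler_pM.
Qed.

Lemma weight2_ge0 : 0 <= weight2.
Proof. by apply: sumr_ge0 => l _; rewrite mulr_ge0 ?sqr_ge0. Qed.

Lemma span_op_le M (y : E) : fnorm (ipT M) (span_op y) <=
  (Num.sqrt q ^+ k * qfact_inf d ^-2) * (\sum_(p < k.+1) rho ^+ p)
    * Num.sqrt weight2 * fnorm (fip d) y.
Proof.
have hy := fval_fock y; rewrite span_op_expand //.
apply: le_trans (fnorm_sum (ipT_semi R N M) _ _ _) _.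
(* Blocks are indexed by the number of creations, powers of [rho] by that of annihilations. *)
rewrite mulr_sumr !mulr_suml [X in _ <= X](reindex_inj rev_ord_inj) /=.
apply: ler_sum => p _; rewrite subSS.
apply: le_trans (@ipT_scale_le M _ (Num.sqrt q ^+ k * qfact_inf d ^-2) _ _) _.
  by move=> n; rewrite wcoef_ge0 wcoef_le.
rewrite -!mulrA; apply: ler_wpM2l; first by rewrite exprn_ge0 ?sqrtr_ge0.
apply: ler_wpM2l; first by rewrite invr_ge0 sqr_ge0.
have pk : (p <= k)%N by rewrite -ltnS.
have r0 : 0 <= rho ^+ (k - p) by rewrite exprn_ge0.
have -> : rho ^+ (k - p) * (Num.sqrt weight2 * fnorm (fip d) y) =
    Num.sqrt ((rho ^+ (k - p)) ^+ 2 * weight2 * fip d y y).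
  rewrite sqrtrM ?mulr_ge0 ?sqr_ge0 ?weight2_ge0 // sqrtrM ?sqr_ge0 //.
  by rewrite sqrtr_sqr ger0_norm // mulrA.
apply: ler_wsqrtr; apply: le_trans (block_estimateT _ _ _ _ hy) _.
rewrite ler_pM ?block_coef_sum ?ipT_le_fip //.
  by apply: sumr_ge0 => u _; apply: sumr_ge0 => v _; exact: sqr_ge0.
exact: form_ge0 (ipT_semi R N _) _.
Qed.

Lemma lower_vacuum e : lower d e vac = 0.
Proof.
apply/funext => w; apply/funext => w'.
exact: scaler0.
Qed.

Lemma lowers_vacuum l : l <> [::] -> lowers d l vac = 0.
Proof.
elim: l => [//|e [|f l] IH] _; first exact: lower_vacuum.
by rewrite [LHS]/(lower d e (lowers d (f :: l) vac)) IH // linear0.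
Qed.

(** Annihilations kill the vacuum, so only the term [p = k] remains. *)
Lemma vseq_vacuum (l : k.-tuple L) : a l != 0 ->
  vseq d l vac = degree_scale (wcoef d k k) (raise_weight l *r word_vector R l).
Proof.
move=> al; have [rl _] := ha al (size_tuple l).
have hv : fock vac by exact: fval_fock (vacuum d).
rewrite vseq_expand // big_ord_recr /= size_tuple big1 ?add0r => [|p _].
  rewrite take_oversize ?size_tuple // drop_oversize ?size_tuple //=.
  by rewrite raisesE creates_vacuum.
rewrite lowers_vacuum => [|/(congr1 size)].
  by rewrite raisesE -[X in creates d _ X](scale0r 0) createsZ scale0r scaler0 degree_scale0.
move=> /eqP; rewrite size_drop size_tuple subn_eq0 leqNgt => /negP; apply.
exact: ltn_ord.
Qed.

(** On the vacuum, distinct words reach distinct coordinates of degree [k], where the coefficients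
    can be read off. *)
Lemma weight2_le : q ^+ k * (1 - Q) * weight2 <= ipT k.+1 (span_op vac) (span_op vac).
Proof.
apply: (@le_trans _ _ (ipn k (span_op vac) (span_op vac))); last first.
  rewrite /ipT big_ord_recr /= lerDr.
  by apply: sumr_ge0 => n _; rewrite (form_ge0 (ipn_semi R N n)).
apply: (@le_trans _ _ (wcoef d k k k ^+ 2 * weight2)).
  by rewrite ler_wpM2r ?weight2_ge0 ?wcoef_diag_ge.
rewrite /ipn (sum_tuple_unzip k (fun w w' => rip (span_op vac w w') (span_op vac w w'))).
rewrite /weight2 mulr_sumr; apply: ler_sum => l _.
have -> : span_op vac (unzip1 l) (unzip2 l) =
   (wcoef d k k k * raise_weight l)%:C%C * a l.
  rewrite /span_op sum_fun2 (bigD1 l) //= big1 ?addr0 => [|l' l'l].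
    have [->|al] := eqVneq (a l) 0; first by rewrite scale0r mulr0.
    rewrite vseq_vacuum //.
    transitivity (a l *: (wcoef d k k (size (unzip1 l)) *r
       (raise_weight l *r word_vector R l (unzip1 l) (unzip2 l)))) => //.
    rewrite size_map size_tuple rscaleA /word_vector !eqxx.
    transitivity (a l * ((wcoef d k k k * raise_weight l)%:C%C * 1)) => //.
    by rewrite mulr1 mulrC.
  have [->|al] := eqVneq (a l') 0; first by rewrite scale0r.
  rewrite vseq_vacuum //.
  transitivity (a l' *: (wcoef d k k (size (unzip1 l)) *r
     (raise_weight l' *r word_vector R l' (unzip1 l) (unzip2 l)))) => //.
  rewrite /word_vector.
  have -> : (unzip1 l == unzip1 l') && (unzip2 l == unzip2 l') = false.
    apply/negbTE/negP => /andP[/eqP h1 /eqP h2]; move/eqP: l'l; apply.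
    by apply: val_inj; rewrite /= -(zip_unzip l) -(zip_unzip l') h1 h2.
  by rewrite !scaler0.
have -> z : rip z z = Normc.normc z ^+ 2.
  case: z => x y; rewrite /rip /= sqr_sqrtr ?addr_ge0 ?sqr_ge0 //.
by rewrite normcR exprMn [X in _ <= X]mulrAC -[X in _ <= X]mulrA lexx.
Qed.

(** The upper bound [span_op_le] and the lower bound [weight2_le] are both of order q^(k/2), which
    cancels. *)
Lemma span_op_estimate M (y : E) : fnorm (ipT M) (span_op y) <=
  (qfact_inf d ^-2 / Num.sqrt (1 - Q)) * (\sum_(p < k.+1) rho ^+ p)
    * fnorm (ipT k.+1) (span_op vac) * fnorm (fip d) y.
Proof.
apply: le_trans (span_op_le M y) _.
rewrite ler_wpM2r ?fnorm_ge0 //.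
have Q1 : 0 < 1 - Q by rewrite subr_gt0 q2_lt1.
have s1 : 0 < Num.sqrt (1 - Q) by rewrite sqrtr_gt0.
have q0 := ltW (qpar_gt0 d).
have h : Num.sqrt q ^+ k * Num.sqrt weight2 <=
    (Num.sqrt (1 - Q))^-1 * fnorm (ipT k.+1) (span_op vac).
  rewrite mulrC ler_pdivlMl // -ler_sqr ?nnegrE ?mulr_ge0 ?exprn_ge0 ?sqrtr_ge0 ?fnorm_ge0 //.
  rewrite (fnorm_sqr (ipT_semi R N _)) !exprMn (sqr_sqrtr weight2_ge0) (sqr_sqrtr (ltW Q1)).
  rewrite exprAC sqr_sqrtr // [X in X <= _](_ : _ = q ^+ k * (1 - Q) * weight2) ?weight2_le //.
  by ring.
have s0 : 0 <= \sum_(p < k.+1) rho ^+ p by apply: sumr_ge0 => p _; exact: exprn_ge0.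
have g0 : 0 <= qfact_inf d ^-2 by rewrite invr_ge0 sqr_ge0.
rewrite [X in X <= _](_ : _ = qfact_inf d ^-2 * (\sum_(p < k.+1) rho ^+ p) *
   (Num.sqrt q ^+ k * Num.sqrt weight2)); last by ring.
rewrite [X in _ <= X](_ : _ = qfact_inf d ^-2 * (\sum_(p < k.+1) rho ^+ p) *
   ((Num.sqrt (1 - Q))^-1 * fnorm (ipT k.+1) (span_op vac))); last by ring.
by rewrite ler_wpM2l // mulr_ge0.
Qed.

End SpanEstimate.

(** * Deformation parameters of a canonical matrix *)

Section CanonicalMatrix.
Variables (R : realType) (N : nat) (F : 'M[R]_N).
Local Notation bar := (@rev_ord N).

(** The witness is the smaller root of x^2 - tau x + 1. *)
Lemma quantum_parameter (tau : R) : 2 < tau ->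
  exists q : R, [/\ 0 < q, q < 1 & tau = q + q^-1].
Proof.
move=> t2; have s0 : 0 <= tau ^+ 2 - 4 by nra.
pose s := Num.sqrt (tau ^+ 2 - 4).
have ss : s ^+ 2 = tau ^+ 2 - 4 by rewrite sqr_sqrtr.
have s1 : 0 <= s by exact: sqrtr_ge0.
have st : s < tau by rewrite -ltr_sqr ?nnegrE ?ss //; lra.
pose q := (tau - s) / 2.
have q0 : 0 < q by rewrite /q; lra.
have qq : q * ((tau + s) / 2) = 1.
  rewrite /q; transitivity ((tau ^+ 2 - s ^+ 2) / 4); first by field.
  by rewrite ss; field.
have qv : q^-1 = (tau + s) / 2 by apply: (mulfI (lt0r_neq0 q0)); rewrite qq mulfV // lt0r_neq0.
exists q; split => //; last by rewrite qv /q; field.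
have sp : 0 < s by rewrite sqrtr_gt0; nra.
have : q < q^-1 by rewrite qv /q; lra.
rewrite -(ltr_pM2l q0) divff ?gt_eqF // -expr2 => h.
by rewrite -ltr_sqr ?nnegrE // ?expr1n // ltW.
Qed.

Lemma canonical_deformation : canonical_F F -> ~ kac_type F ->
  exists d : deformation R N, F = Fmx d.
Proof.
move=> [lam [p [eF l0 F2 _ _]]] nK.
have FE i j : F i j = lam i * (j == bar i)%:R by rewrite eF antidiag_entry.
have [eps [e2 hF]] : exists eps : R, eps ^+ 2 = 1 /\ F *m F = eps%:M.
  case: F2 => h; first by exists 1; rewrite expr1n.
  by exists (-1); rewrite sqrrN expr1n h rmorphN.
have lrev i : lam i * lam (bar i) = eps.
  have /matrixP /(_ i i) := hF; rewrite !mxE eqxx mulr1n.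
  rewrite (bigD1 (bar i)) //= big1 => [|k ki].
    by rewrite !FE !rev_ordK !eqxx !mulr1 addr0.
  by rewrite !FE (negPf ki) mulr0 mul0r.
have FF i j : FstarF F i j = lam (bar i) ^+ 2 * (i == j)%:R.
  rewrite /FstarF !mxE (bigD1 (bar i)) //= big1 => [|k ki].
    by rewrite !mxE !FE rev_ordK eqxx mulr1 addr0 mulrA -expr2 eq_sym.
  rewrite !mxE FE; have -> : (i == bar k) = false.
    by apply/negbTE/eqP => e; move/eqP: ki; apply; rewrite e rev_ordK.
  by rewrite mulr0 mul0r.
have [j lj] : exists j, lam j ^+ 2 != 1.
  apply: contrapT => /forallNP h; apply: nK; apply/matrixP => i j.
  rewrite FF mxE; have /negP := h (bar i); rewrite negbK => /eqP ->.
  by rewrite mul1r.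
have l2 i : lam i ^+ 2 * lam (bar i) ^+ 2 = 1 by rewrite -exprMn lrev.
have lp i : 0 < lam i ^+ 2 by rewrite exprn_even_gt0 //= l0.
have jb : bar j != j.
  apply/eqP => e; have := l2 j; rewrite e => h.
  by move/eqP: lj; apply; have := lp j; nra.
(* The indices [j] and [bar j] are distinct, and their squares are inverse to each other and
   different from 1; these two already sum to more than 2. *)
have tau2 : 2 < \sum_i lam i ^+ 2.
  rewrite (bigD1 j) //= (bigD1 (bar j)) //= addrA ltr_wpDr //.
    by apply: sumr_ge0 => i _; exact: sqr_ge0.
  have h := l2 j; have h1 := lp j; have h2 := lp (bar j).
  set a := lam j ^+ 2 in lj h h1 *; set b := lam (bar j) ^+ 2 in h h2 *.
  have : 0 < (a - 1) ^+ 2 by rewrite exprn_even_gt0 //= subr_eq0.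
  rewrite -(ltr_pM2l h1) => h3.
  have -> : a * (a + b) = a ^+ 2 + 1 by rewrite mulrDr h.
  by nra.
have [q [q0 q1 hq]] := quantum_parameter tau2.
exists (Deformation lrev e2 q0 q1 hq).
by rewrite eF.
Qed.

End CanonicalMatrix.

Section GeometricSums.
Variable R : realType.

Lemma geometric_sum_le (x : R) n : 0 <= x -> x < 1 -> \sum_(p < n) x ^+ p <= (1 - x)^-1.
Proof.
move=> x0 x1; have h : 0 < 1 - x by rewrite subr_gt0.
rewrite -[X in _ <= X]mul1r ler_pdivlMr // mulrC.
have := subrX1 x n; have : 0 <= x ^+ n by exact: exprn_ge0.
by set s := \sum_(p < n) _; nra.
Qed.

Lemma geometric_sum_le2 (x : R) n : 1 < x -> \sum_(p < n.+1) x ^+ p <= x ^+ n * (1 - x^-1)^-1.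
Proof.
move=> x1; have x0 : 0 < x by lra.
have h : 0 < 1 - x^-1 by rewrite subr_gt0 invf_lt1.
rewrite ler_pdivlMr //.
have := subrX1 x n.+1; set s := \sum_(p < n.+1) _ => e.
rewrite -(ler_pM2r x0) -mulrA mulrBl mul1r mulVf ?gt_eqF // -exprSr mulrC -e.
by rewrite gerBl.
Qed.

End GeometricSums.

Lemma unsorted_split (T : Type) (r : rel T) (s : seq T) : ~~ sorted r s ->
  exists p x y t, s = p ++ [:: x, y & t] /\ ~~ r x y.
Proof.
case: s => // x s; elim: s x => // y s IH x /=.
case rxy : (r x y) => /= h.
  by have [p [x' [y' [t [-> h']]]]] := IH y h; exists (x :: p), x', y', t.
by exists [::], x, y, s; rewrite rxy.
Qed.

(** * Basis tensors in H_k and the values of R *)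

Section LegRatios.
Variables (R : realType) (N : nat) (d : deformation R N).
Local Notation I := 'I_N.
Local Notation L := ('I_N * 'I_N)%type.
Local Notation bar := (@rev_ord N).
Local Notation lam := (lam d).
Local Notation F := (Fmx d).
Local Notation reduced := (@reduced N).

(** If two consecutive letters cancelled, the contraction at their place would be the nonzero number
    [lam (bar x)]. *)
Lemma in_H_reduced k (s : k.-tuple I) : in_H F (basis_tensor R s) ->
  sorted (fun x y => y != bar x) s.
Proof.
move=> h; apply: contrapT => /negP /unsorted_split [p [x [y [t [es /negPn /eqP ey]]]]].
have ek : (size p + (2 + size t))%N = k.
  by rewrite -(size_tuple s) es size_cat.
have := h _ _ ek (in_tuple p) (in_tuple t).
(* Only the two-letter word [[tuple x; y]] completes [p] and [t] to [s]. *)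
rewrite /contractT (bigD1 [tuple x; y]) //= big1 ?addr0 => [|w wn].
  have -> : tcast ek [tuple of in_tuple p ++ [tuple of [tuple x; y] ++ in_tuple t]] = s.
    by apply: val_inj; rewrite /= val_tcast /= es.
  rewrite !ffunE [s == s]eqxx mulr1 => /eqP; rewrite conjC_eq0.
  rewrite (bigD1 x) //= big1 ?addr0 => [|j /negPf jx]; last first.
    by rewrite (tnth_nth x) /= eq_sym jx mul0r.
  rewrite !(tnth_nth x) /= (eqxx x) mul1r FmxE ey rev_ordK (eqxx x) mulr1.
  rewrite eq_complex /= eqxx andbT => /eqP hl.
  by have := lam_neq0 d (bar x); rewrite hl eqxx.
have basis0 (v : k.-tuple I) : v <> s -> basis_tensor R s v = 0.
  by move=> vs; rewrite ffunE; case: eqP.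
rewrite basis0 ?mulr0 // => e.
move/eqP: wn; apply; apply: val_inj => /=.
have : p ++ (val w ++ t) = p ++ [:: x, y & t].
  by rewrite -es -e val_tcast.
move/eqP; rewrite eqseq_cat // eqxx /= -[[:: x, y & t]]/([:: x; y] ++ t).
by rewrite eqseq_cat ?size_tuple // => /andP[/eqP].
Qed.

Lemma zip_reduced (s t : seq I) : size s = size t ->
  sorted (fun x y => y != bar x) s -> sorted (fun x y => y != bar x) t ->
  sorted reduced (zip s t).
Proof.
case: s t => [|x s] [|y t] //= [].
elim: s x t y => [|x' s IH] x [|y' t] y //= [e] /andP[h1 h2] /andP[h3 h4].
by rewrite /reduced /= h1 h3 /=; exact: IH.
Qed.

Definition ratio (e : L) : R :=
  FstarF F e.1 e.1 `^ (1 / 4) * FstarF F e.2 e.2 `^ (1 / 4).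

Lemma FstarFE j : FstarF F j j = lam (bar j) ^+ 2.
Proof.
rewrite /FstarF !mxE (bigD1 (bar j)) //= big1 => [|k kj].
  by rewrite !mxE !FmxE rev_ordK eqxx mulr1 addr0 expr2.
rewrite !mxE FmxE; have -> : (j == bar k) = false.
  by apply/negbTE/eqP => e; move/eqP: kj; apply; rewrite e rev_ordK.
by rewrite mulr0 mul0r.
Qed.

Lemma ratio_ge0 e : 0 <= ratio e.
Proof. by rewrite mulr_ge0 ?powR_ge0. Qed.

Lemma ratio4 e : ratio e ^+ 4 = leg_ratio d e.
Proof.
have h (x : R) : 0 <= x -> (x `^ (1 / 4)) ^+ 4 = x.
  move=> x0; rewrite -powR_mulrn ?powR_ge0 // -powRrM.
  have -> : 1 / 4 * 4%:R = 1 :> R by field.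
  by rewrite powRr1.
by rewrite /ratio exprMn !h ?FstarFE ?sqr_ge0.
Qed.

Lemma max_ratio_ub k m (s t : 'I_m -> k.-tuple I) x i :
  ratio (tnth (s x) i, tnth (t x) i) <= max_ratio F s t.
Proof.
apply: le_trans (le_bigmax _ (fun x => \big[Num.max/0]_(i < k) _) x).
exact: (le_bigmax _ (fun i => ratio (tnth (s x) i, tnth (t x) i)) i).
Qed.

(** However long and numerous the words are, R is a value of [ratio] at one of the N^2 pairs of
    indices; this frees the constant from [k] and [m]. *)
Lemma max_ratio_attained k m (s t : 'I_m -> k.-tuple I) : (1 <= k)%N -> (1 <= m)%N ->
  exists e, max_ratio F s t = ratio e.
Proof.
case: k s t => // k s t _; case: m s t => // m s t _.
rewrite /max_ratio.
have h (x : 'I_m.+1) : exists e, \big[Num.max/0]_(i < k.+1)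
    (FstarF F (tnth (s x) i) (tnth (s x) i) `^ (1 / 4) *
     FstarF F (tnth (t x) i) (tnth (t x) i) `^ (1 / 4)) = ratio e.
  rewrite (bigmax_eq_arg _ ord0) // => [|i _]; last by rewrite mulr_ge0 ?powR_ge0.
  by eexists (_, _); reflexivity.
rewrite (bigmax_eq_arg _ ord0) // => x _.
by have [e ->] := h x; exact: ratio_ge0.
Qed.

End LegRatios.

(** * The estimate in the reduced algebra *)

Section NormEstimate.
Variables (R : realType) (N : nat) (d : deformation R N).
Local Notation C := R[i].
Local Notation I := 'I_N.
Local Notation L := ('I_N * 'I_N)%type.
Local Notation F := (Fmx d).
Local Notation E := (fockv d).
Local Notation B := (bop_cstar (fock_hilbert d)).
Local Notation Q := (qpar d ^+ 2).

Definition norm_const : R := qfact_inf d ^-2 / Num.sqrt (1 - Q).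

Lemma norm_const_ge0 : 0 <= norm_const.
Proof. by rewrite mulr_ge0 ?invr_ge0 ?sqr_ge0 ?sqrtr_ge0. Qed.

Variables (A : cstarAlgType R) (u : 'M[A]_N) (h : {scalar A}).
Hypotheses (hu : OF_relations F u) (hh : is_haar_state u h).
Variable rep : {lrmorphism A -> B}.
Hypotheses (rep_star : is_star_morphism rep)
  (rep_u : forall i j, rep (u i j) = v_mx d i j).

Lemma Pol_monl_mem l : Pol u (monl u l).
Proof.
rewrite /monl; elim: l => [|e l IH]; first by rewrite big_nil; exact: Pol_one.
by rewrite big_cons; apply: Pol_mul => //; exact: Pol_gen.
Qed.

Lemma Pol0 : Pol u 0.
Proof. by rewrite -(scale0r 1); apply: Pol_scale; exact: Pol_one. Qed.

Lemma coefficient_monl k (s t : k.-tuple I) :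
  coefficient u (basis_tensor R s) (basis_tensor R t) = monl u (zip s t).
Proof.
have b1 (v : k.-tuple I) : basis_tensor R v v = 1 by rewrite ffunE eqxx.
have b0 (v w : k.-tuple I) : w != v -> basis_tensor R v w = 0.
  by move=> vw; rewrite ffunE (negPf vw).
rewrite /coefficient (bigD1 s) //= [X in _ + X]big1 ?addr0 => [|s' s's]; last first.
  by rewrite big1 // => t' _; rewrite b0 // rmorph0 mul0r scale0r.
rewrite (bigD1 t) //= [X in _ + X]big1 ?addr0 => [|t' t't]; last first.
  by rewrite [basis_tensor R t t']b0 // mulr0 scale0r.
rewrite !b1 rmorph1 mulr1 scale1r -star_monomial_monl.
by apply: eq_bigr => l _; rewrite tnth_nseq.
Qed.

Lemma rep_monl l (y : E) : fval ((rep (monl u l) : bop (fock_hilbert d)) y) = vseq d l y.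
Proof.
have repM a b : (rep (a * b) : bop (fock_hilbert d)) y =
    (rep a : bop (fock_hilbert d)) ((rep b : bop (fock_hilbert d)) y) by rewrite rmorphM.
rewrite /monl; elim: l => [|e l IH]; first by rewrite big_nil rmorph1.
rewrite big_cons repM rep_u mxE v_opE IH.
by [].
Qed.

Variables (k m : nat) (s t : 'I_m -> k.-tuple I).
Hypothesis hst : forall x : 'I_m,
  in_H F (basis_tensor R (s x)) /\ in_H F (basis_tensor R (t x)).
Variable c : 'I_m -> C.

Definition span_elt : A :=
  \sum_(x < m) c x *: coefficient u (basis_tensor R (s x)) (basis_tensor R (t x)).
(** Different indices [x] may name the same pair of words, so their coefficients are added first. *)
Definition word_coef (l : seq L) : C := \sum_(x < m | zip (s x) (t x) == l) c x.

Lemma word_coefP l : word_coef l != 0 -> size l = k ->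
  sorted (@reduced N) l /\ all (fun e => leg_ratio d e <= (max_ratio F s t ^+ 2) ^+ 2) l.
Proof.
move=> al _.
have [x /eqP <-] : exists x, zip (s x) (t x) == l.
  apply: contrapT => /forallNP hx; move/eqP: al; apply.
  by rewrite /word_coef big_pred0 // => x; apply/negbTE/negP; exact: hx.
have [h1 h2] := hst x; split.
  by apply: zip_reduced; [rewrite !size_tuple | exact: in_H_reduced | exact: in_H_reduced].
apply/allP => -[a b] he; have [i ik <-] := nthP (a, b) he.
move: ik; rewrite size_zip !size_tuple minnn => ik.
rewrite nth_zip ?size_tuple //.
have := max_ratio_ub d s t x (Ordinal ik); rewrite (tnth_nth a) (tnth_nth b) /=.
set e' := (_, _) => le.
rewrite -exprM -ratio4 ler_pXn2r ?nnegrE ?ratio_ge0 //.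
exact: le_trans (ratio_ge0 d e') le.
Qed.

Lemma Pol_span_elt : Pol u span_elt.
Proof.
rewrite /span_elt; elim/big_rec: _ => [|x a _ ha]; first exact: Pol0.
by apply: Pol_add => //; apply: Pol_scale; rewrite coefficient_monl; exact: Pol_monl_mem.
Qed.

Lemma rep_span_elt (y : E) :
  fval ((rep span_elt : bop (fock_hilbert d)) y) = span_op d k word_coef y.
Proof.
have -> : fval ((rep span_elt : bop (fock_hilbert d)) y) =
    \sum_(x < m) c x *: vseq d (zip (s x) (t x)) y.
  have rl e a b : (rep (e *: a + b) : bop (fock_hilbert d)) y =
      e *: (rep a : bop (fock_hilbert d)) y + (rep b : bop (fock_hilbert d)) y.
    rewrite linearP.
    by rewrite -[LHS]/(((e *: rep a + rep b) : bop (fock_hilbert d)) y) bopDE bopZE.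
  rewrite /span_elt; elim/big_rec2: _ => [|x z a _ IH]; first by rewrite linear0.
  by rewrite rl coefficient_monl fvalD fvalZ rep_monl IH.
rewrite /span_op (partition_big (fun x => [tuple of zip (s x) (t x)]) xpredT) //=.
apply: eq_bigr => l _; rewrite /word_coef scaler_suml.
rewrite (eq_bigl (fun x => zip (s x) (t x) == l)) //.
by apply: eq_bigr => x /eqP ->.
Qed.

Lemma fnorm_ipT_le M (y : E) : fnorm (@ipT R N M) y <= fnorm (fip d) y.
Proof. by apply: ler_wsqrtr; exact: ipT_le_fip. Qed.

Lemma fnorm_fip_le (y : E) (K : R) : 0 <= K ->
  (forall M, fnorm (@ipT R N M) y <= K) -> fnorm (fip d) y <= K.
Proof.
move=> K0 hy; rewrite -ler_sqr ?nnegrE ?fnorm_ge0 // (fnorm_sqr (fip_semi d)).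
apply: fip_le => M; rewrite -(fnorm_sqr (ipT_semi R N M)).
by rewrite ler_sqr ?nnegrE ?fnorm_ge0.
Qed.

(** This is [span_op_estimate] with [rho] = R^2, applied to the vector of [g]; the image of the
    vacuum supplies the L^2 norm of the element itself. *)
Lemma l2norm_mul_le g : Pol u g -> l2norm h (span_elt * g) <=
  norm_const * (\sum_(p < k.+1) (max_ratio F s t ^+ 2) ^+ p) * l2norm h span_elt * l2norm h g.
Proof.
move=> hg; have hp := Pol_span_elt.
have nrm f : Pol u f -> l2norm h f = fnorm (fip d) (vac_vec rep f).
  exact: (l2norm_vac hu hh rep_star rep_u).
rewrite !nrm //; last exact: Pol_mul.
have S0 : 0 <= \sum_(p < k.+1) (max_ratio F s t ^+ 2) ^+ p.
  by apply: sumr_ge0 => p _; rewrite exprn_ge0 ?sqr_ge0.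
have cS := mulr_ge0 norm_const_ge0 S0.
apply: fnorm_fip_le; first by rewrite mulr_ge0 ?fnorm_ge0 // mulr_ge0 ?fnorm_ge0.
move=> M; rewrite vac_vecM rep_span_elt.
apply: le_trans (span_op_estimate (sqr_ge0 _) word_coefP M _) _.
rewrite ler_wpM2r ?fnorm_ge0 // ler_wpM2l //.
by rewrite -(rep_span_elt (vacuum d)); exact: fnorm_ipT_le.
Qed.

(** The vectors in the supremum are sequences in [Pol], and the inequality passes to their
    limits. *)
Lemma reduced_norm_le (K : R) (f : A) : 0 <= K ->
  (forall g, Pol u g -> l2norm h (f * g) <= K * l2norm h g) ->
  (reduced_norm u h f <= K%:E)%E.
Proof.
move=> K0 hK; apply: ub_ereal_sup => _ [r [g [b [[gP _] gb b1 fr]]] <-].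
rewrite lee_fin; apply: le_trans (_ : K * b <= K); last first.
  by rewrite -[X in _ <= X]mulr1 ler_wpM2l.
have h2 : K * l2norm h (g n) @[n --> \oo] --> K * b by exact: cvgMr.
rewrite -(cvg_lim _ fr) // -(cvg_lim _ h2) //.
apply: ler_lim; [by apply/cvg_ex; eexists; exact: fr | by apply/cvg_ex; eexists; exact: h2 |].
by apply: nearW => n; exact: hK.
Qed.

Lemma l2norm0 : l2norm h 0 = 0.
Proof. by rewrite /l2norm mulr0 linear0 /= sqrtr0. Qed.

(** The constant sequence 1 is a test vector of norm one. *)
Lemma reduced_norm_ge (f : A) : ((l2norm h f)%:E <= reduced_norm u h f)%E.
Proof.
apply: ereal_sup_ubound; exists (l2norm h f) => //.
exists (fun=> 1), 1; split => //.
- split => [n|e e0]; first exact: Pol_one.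
  by exists 0%N => n n' _ _; rewrite subrr l2norm0.
- have -> : l2norm h 1 = 1.
    rewrite /l2norm star1 mulr1; have [[-> _] _] := hh.
    by rewrite /= sqrtr1.
  exact: cvg_cst.
- by under eq_fun do rewrite mulr1; exact: cvg_cst.
Qed.

End NormEstimate.

Theorem corollary3p3 (R : realType) (N : nat) (F : 'M[R]_N)
    (hN : (2 <= N)%N) (hF : canonical_F F) (hnK : ~ kac_type F) :
  exists2 K : R, 1 <= K &
  forall (A : cstarAlgType R) (u : 'M[A]_N) (h : {scalar A}),
    is_free_orthogonal F u -> is_haar_state u h ->
  forall (k m : nat) (s t : 'I_m -> k.-tuple 'I_N),
    (1 <= k)%N -> (1 <= m)%N ->
    (forall x : 'I_m,
       in_H F (basis_tensor R (s x)) /\ in_H F (basis_tensor R (t x))) ->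
  forall f : A,
    in_span (fun x : 'I_m =>
      coefficient u (basis_tensor R (s x)) (basis_tensor R (t x))) f ->
    (1 < max_ratio F s t ->
       (reduced_norm u h f
         <= (K * max_ratio F s t ^+ (2 * k) * l2norm h f)%:E)%E) /\
    (max_ratio F s t < 1 ->
       ((K^-1 * l2norm h f)%:E <= reduced_norm u h f)%E /\
       (reduced_norm u h f <= (K * l2norm h f)%:E)%E).
Proof.
have [d ->] := canonical_deformation hF hnK.
(* These are the constants of the two geometric sums. Summing them over all pairs dominates the pair
   that attains R; absolute values keep every term nonnegative, and a pair of ratio 1 contributes 0,
   the inverse of 0. *)
pose low (e : 'I_N * 'I_N) := `|(1 - ratio d e ^+ 2)^-1|.
pose high (e : 'I_N * 'I_N) := `|(1 - (ratio d e ^+ 2)^-1)^-1|.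
pose K0 := norm_const d * \sum_e (low e + high e).
have n0 := norm_const_ge0 d.
have lh0 e : 0 <= low e + high e by rewrite addr_ge0 ?normr_ge0.
have K00 : 0 <= K0 by rewrite mulr_ge0 // sumr_ge0.
have K1 : 1 <= 1 + K0 by rewrite lerDl.
(* The summand 1 makes the constant at least 1, as the lower bound for R < 1 also requires. *)
exists (1 + K0) => // A u h [hu _ univ] hh k m s t k1 m1 hst f [c ->].
have [rep rep_star rep_u] := univ (bop_cstar (fock_hilbert d)) (v_mx d) (v_OF d).
have [e0 eR] := max_ratio_attained d s t k1 m1.
have bound e : low e + high e <= \sum_e (low e + high e).
  by rewrite (bigD1 e) //= lerDl sumr_ge0.
have f0 : 0 <= l2norm h (span_elt u s t c) by exact: sqrtr_ge0.
have est (S : R) : \sum_(p < k.+1) (max_ratio (Fmx d) s t ^+ 2) ^+ p <= S ->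
    (reduced_norm u h (span_elt u s t c) <= (norm_const d * S * l2norm h (span_elt u s t c))%:E)%E.
  move=> hS.
  have S0 : 0 <= S by apply: le_trans hS; apply: sumr_ge0 => p _; rewrite exprn_ge0 ?sqr_ge0.
  apply: reduced_norm_le => [|g hg]; first by rewrite mulr_ge0 // mulr_ge0.
  apply: le_trans (l2norm_mul_le hu hh rep_star rep_u hst c hg) _.
  by rewrite ler_wpM2r ?sqrtr_ge0 // ler_wpM2r // ler_wpM2l.
have Rp : 0 <= max_ratio (Fmx d) s t by rewrite eR ratio_ge0.
(* For R > 1 the last term R^(2k) is factored out of the sum; for R < 1 the sum is bounded
   independently of [k]. *)
split => [R1|R1].
- have R2 : 1 < max_ratio (Fmx d) s t ^+ 2 by rewrite exprn_egt1.
  apply: le_trans (est _ (geometric_sum_le2 k R2)) _.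
  rewrite lee_fin ler_wpM2r // exprM mulrCA [X in _ <= X]mulrC.
  rewrite ler_wpM2l ?exprn_ge0 ?sqr_ge0 //.
  apply: le_trans (_ : K0 <= _); last by rewrite lerDr.
  rewrite ler_wpM2l //; apply: le_trans (bound e0); rewrite eR.
  by apply: ler_wpDl; [exact: normr_ge0 | exact: ler_norm].
- have R2 : max_ratio (Fmx d) s t ^+ 2 < 1 by rewrite exprn_ilt1.
  split.
    apply: (le_trans _ (reduced_norm_ge hh (span_elt u s t c))).
    by rewrite lee_fin ler_piMl // invf_le1 // (lt_le_trans ltr01).
  apply: le_trans (est _ (geometric_sum_le k.+1 (sqr_ge0 _) R2)) _.
  rewrite lee_fin ler_wpM2r //; apply: le_trans (_ : K0 <= _); last by rewrite lerDr.
  rewrite ler_wpM2l //; apply: le_trans (bound e0); rewrite eR.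
  by apply: ler_wpDr; [exact: normr_ge0 | exact: ler_norm].
Qed.
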